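(* Let $0<T\le\infty$ and let the coefficients $a_n$, $b_{n,j}$, $k_{n,j}$, the weight $w$, the number $\kappa$, the exponent $\alpha$ and the weight $\widetilde w$ satisfy all the standing assumptions listed in the context (including one of the cases (CI) or (CII)). Let $\mathring u=(\mathring u_n)_{n=1}^\infty\in(\ell^1_{\widetilde w})_+$. Then: (i) There exists $t_{\max}\in(0,T]$ such that the problem $u'(t)=G^{(w)}u(t)+K(t,u(t))$, $u(0)=\mathring u$, has a unique maximal positive mild solution $u\in C([0,t_{\max}),\ell^1_{\widetilde w})$. (ii) If $t_{\max}<T$, then $\|u(t)\|_{\widetilde w}\to\infty$ as $t\to t_{\max}^-$. (iii) For every $\tau\in(0,t_{\max})$ there exist $r_\tau>0$ and $M_\tau>0$ such that, whenever $\mathring v\in(\ell^1_{\widetilde w})_+$ satisfies $\|\mathring v-\mathring u\|_{\widetilde w}\le r_\tau$ and $v$ is the corresponding maximal mild solution (with initial value $\mathring v$), then $v$ is defined on $[0,\tau]$ and $\|v(t)-u(t)\|_{\widetilde w}\le M_\tau\|\mathring v-\mathring u\|_{\widetilde w}$ for all $t\in[0,\tau]$. (iv) Let $\phi_{[1]}(f)=\sum_{n=1}^\infty nf_n$. If $\sum_{n=1}^{j-1}nb_{n,j}\le j$ for all $j\ge2$, then $\phi_{[1]}(u(t))\le\phi_{[1]}(\mathring u)$ for all $t\in[0,t_{\max})$. If $a_1=0$ and $\sum_{n=1}^{j-1}nb_{n,j}=j$ for all $j\ge 2$, then $\phi_{[1]}(u(t))=\phi_{[1]}(\mathring u)$ for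 all $t\in[0,t_{\max})$.
   Context: Standing assumptions. Let $0<T\le\infty$. Let $a_n\ge0$ for $n\in\mathbb N$, $b_{n,j}\ge0$ for $n,j\in\mathbb N$ with $b_{n,j}=0$ whenever $j\le n$, and $k_{n,j}:[0,T)\to[0,\infty)$ with $k_{n,j}(t)=k_{j,n}(t)$ for all $n,j\in\mathbb N$, $t\in[0,T)$. For a sequence $v=(v_n)_{n\ge1}$ of positive reals, $\ell^1_v$ denotes the space of real sequences $f=(f_n)$ with $\|f\|_v=\sum_{n}v_n|f_n|<\infty$; it is a Banach lattice with the componentwise order, and $(\ell^1_v)_+$ denotes its non-negative elements. Weight: $w=(w_n)$ satisfies $w_n\ge n$ for all $n$, $(w_n)$ is monotone increasing, and there is $\kappa\in(0,1]$ with $\sum_{n=1}^{j-1}w_nb_{n,j}\le\kappa w_j$ for all $j\ge2$. Fragmentation operator: on $\ell^1_w$ let $A^{(w)}f=(-a_nf_n)_{n}$ and $B^{(w)}f=(\sum_{j=n+1}^\infty a_jb_{n,j}f_j)_n$, each with maximal domain $\{f\in\ell^1_w:$ the image lies in $\ell^1_w\}$, and let $G^{(w)}$ be the closure of $A^{(w)}+B^{(w)}$. It is known that $G^{(w)}$ generates a substochastic $C_0$-semigroup $(S^{(w)}(t))_{t\ge0}$ on $\ell^1_w$ (and if $\kappa<1$ no closure is needed and the semigroup is analytic). Coagulation: $\alpha\in[0,1)$ and either (CI) $\kappa\in(0,1]$ and $\alpha=0$, or (CII) $\kappa\in(0,1)$ and $\alpha\in(0,1)$. Each $k_{n,j}$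 is continuous on $[0,T)$, and for every $t'\in(0,T)$ there is $c(t')>0$ with $k_{n,j}(t)\le c(t')\widetilde w_n\widetilde w_j/w_{n+j}$ for all $n,j\in\mathbb N$, $t\in[0,t']$, where $\widetilde w_n=(1+a_n)^\alpha w_n$ and $\widetilde w=(\widetilde w_n)$. The coagulation operator is $K(t,f)=\bigl(\tfrac12\sum_{j=1}^{n-1}k_{n-j,j}(t)f_{n-j}f_j-\sum_{j=1}^\infty k_{n,j}(t)f_nf_j\bigr)_{n=1}^\infty$ for $t\in[0,T)$, $f\in\ell^1_{\widetilde w}$; it maps $[0,T)\times\ell^1_{\widetilde w}$ continuously into $\ell^1_w$. A mild solution on $[0,t_1)$, $t_1\in(0,T]$, is a function $u\in C([0,t_1),\ell^1_{\widetilde w})$ with $u(t)=S^{(w)}(t)\mathring u+\int_0^tS^{(w)}(t-s)K(s,u(s))\,ds$ in $\ell^1_w$ for all $t\in[0,t_1)$; it is maximal if it admits no extension to a mild solution on a strictly larger interval $[0,\tilde t_1)$ with $\tilde t_1\le T$. It is positive if $u(t)\ge0$ for all $t$. *)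

(* Defs.v *)
From Stdlib Require Import Reals Lra.
From Coquelicot Require Import Coquelicot.
Open Scope R_scope.

(* Sequences (f_n)_{n>=1} are represented as nat -> R; index 0 is unused and
   elements of the weighted l^1 spaces are required to vanish at index 0. *)
Definition seqR := nat -> R.

Definition vadd (f g : seqR) : seqR := fun n => f n + g n.
Definition vsub (f g : seqR) : seqR := fun n => f n - g n.
Definition vscal (c : R) (f : seqR) : seqR := fun n => c * f n.

Definition in_l1 (v f : seqR) : Prop :=
  f 0%nat = 0 /\ ex_series (fun n => v n * Rabs (f n)).
Definition l1norm (v f : seqR) : R := Series (fun n => v n * Rabs (f n)).
Definition in_l1_pos (v f : seqR) : Prop := in_l1 v f /\ forall n, 0 <= f n.

Fixpoint sum1 (m : nat) (F : nat -> R) : R :=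
  match m with O => 0 | S m' => sum1 m' F + F (S m') end.

Definition wtilde (a w : seqR) (alpha : R) : seqR :=
  fun n => Rpower (1 + a n) alpha * w n.

Definition fragA (a f : seqR) : seqR := fun n => - (a n * f n).
Definition fragB_term (a : seqR) (b : nat -> nat -> R) (f : seqR) (n : nat) : nat -> R :=
  fun j => if (n <? j)%nat then a j * b n j * f j else 0.
Definition fragB (a : seqR) (b : nat -> nat -> R) (f : seqR) : seqR :=
  fun n => match n with O => 0 | S _ => Series (fragB_term a b f n) end.

Definition dom_A (w a f : seqR) : Prop := in_l1 w f /\ in_l1 w (fragA a f).
Definition dom_B (w a : seqR) (b : nat -> nat -> R) (f : seqR) : Prop :=
  in_l1 w f /\ (forall n, (1 <= n)%nat -> ex_series (fragB_term a b f n)) /\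
  in_l1 w (fragB a b f).

(* graph of G^(w) = closure (in l^1_w x l^1_w) of A^(w) + B^(w) on D(A) ∩ D(B) *)
Definition frag_G_graph (w a : seqR) (b : nat -> nat -> R) (f g : seqR) : Prop :=
  in_l1 w f /\ in_l1 w g /\
  exists fk : nat -> seqR,
    (forall m, dom_A w a (fk m) /\ dom_B w a b (fk m)) /\
    is_lim_seq (fun m => l1norm w (vsub (fk m) f)) 0 /\
    is_lim_seq (fun m => l1norm w (vsub (vadd (fragA a (fk m)) (fragB a b (fk m))) g)) 0.

Definition C0_semigroup_generated_by (w : seqR) (Sg : R -> seqR -> seqR)
    (Gr : seqR -> seqR -> Prop) : Prop :=
  (forall t f, 0 <= t -> in_l1 w f -> in_l1 w (Sg t f)) /\
  (forall t c f g, 0 <= t -> in_l1 w f -> in_l1 w g ->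
     Sg t (vadd f (vscal c g)) = vadd (Sg t f) (vscal c (Sg t g))) /\
  (forall t, 0 <= t -> exists M, forall f, in_l1 w f ->
     l1norm w (Sg t f) <= M * l1norm w f) /\
  (forall f, in_l1 w f -> Sg 0 f = f) /\
  (forall t s f, 0 <= t -> 0 <= s -> in_l1 w f -> Sg (t + s) f = Sg t (Sg s f)) /\
  (forall f t, in_l1 w f -> 0 <= t -> forall eps, 0 < eps ->
     exists delta, 0 < delta /\ forall s, 0 <= s -> Rabs (s - t) < delta ->
       l1norm w (vsub (Sg s f) (Sg t f)) < eps) /\
  (forall f g, Gr f g <->
     (in_l1 w f /\ in_l1 w g /\
      filterlim (fun h => l1norm w (vsub (vscal (/ h) (vsub (Sg h f) f)) g))
                (at_right 0) (locally 0))).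

Definition coagK (k : nat -> nat -> R -> R) (t : R) (f : seqR) : seqR :=
  fun n => match n with
  | O => 0
  | S _ => / 2 * sum1 (n - 1)%nat (fun j => k (n - j)%nat j t * f (n - j)%nat * f j)
           - Series (fun j => k n j t * f n * f j)
  end.

(* The l^1_w-valued integral is written coordinatewise (coordinate
   evaluation is a bounded linear functional on l^1_w). *)
Definition mild_solution (T : Rbar) (w wt : seqR) (Sg : R -> seqR -> seqR)
    (k : nat -> nat -> R -> R) (u0 : seqR) (t1 : Rbar) (u : R -> seqR) : Prop :=
  Rbar_lt 0 t1 /\ Rbar_le t1 T /\
  (forall t, 0 <= t -> Rbar_lt t t1 -> in_l1 wt (u t)) /\
  (forall t, 0 <= t -> Rbar_lt t t1 -> forall eps, 0 < eps ->
     exists delta, 0 < delta /\ forall s, 0 <= s -> Rbar_lt s t1 ->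
       Rabs (s - t) < delta -> l1norm wt (vsub (u s) (u t)) < eps) /\
  (forall t, 0 <= t -> Rbar_lt t t1 -> forall n,
     ex_RInt (fun s => Sg (t - s) (coagK k s (u s)) n) 0 t /\
     u t n = Sg t u0 n + RInt (fun s => Sg (t - s) (coagK k s (u s)) n) 0 t).

Definition maximal_mild_solution (T : Rbar) (w wt : seqR) (Sg : R -> seqR -> seqR)
    (k : nat -> nat -> R -> R) (u0 : seqR) (t1 : Rbar) (u : R -> seqR) : Prop :=
  mild_solution T w wt Sg k u0 t1 u /\
  ~ (exists (t2 : Rbar) (v : R -> seqR), Rbar_lt t1 t2 /\
       mild_solution T w wt Sg k u0 t2 v /\
       forall t, 0 <= t -> Rbar_lt t t1 -> v t = u t).

Definition positive_on (t1 : Rbar) (u : R -> seqR) : Prop :=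
  forall t, 0 <= t -> Rbar_lt t t1 -> forall n, 0 <= u t n.

Definition phi1 (f : seqR) : R := Series (fun n => INR n * f n).

(* Main.v *)
(** Dispersivity of [A + B] with respect to the half-norms [f |-> sum_n v_n max(f_n, 0)], for every
    weight [v <= w] with [sum_(n<j) v_n b_(n,j) <= v_j], passes to the closure [G], and a Dini
    derivative argument turns it into monotonicity of these half-norms along the semigroup.  The
    choices [v = w], [v = w 1_(n>j)] and [v = n] give positivity and contractivity, the triangular
    structure, and mass dissipation.

    If [kappa < 1], let [u(t) = S(t) e_j], which is finitely supported.  Then
    [(||u||_w)' <= - c ||G u(t)||_w], while [G u(t) = S(t) G e_j] has non-increasing norm; hence
    [t ||a u(t)||_w <= C w_j] and also [||a u(t)||_w <= C a_j w_j].  Interpolating between [w] and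
    [a w] and summing over [j] gives [||S(t) f||_wt <= C t^(-alpha) ||f||_w], boundedness and strong
    continuity on [l^1_wt].

    Local solutions come from Picard iteration with the integrable singularity [t^(-alpha)].  For
    positive data the equation is solved with [K(t, max(u, 0))] in place of [K(t, u)]: from
    [u(t + h) = S(h) (u(t) + h K) + o(h)] in [l^1_w], the half-norm of [- u] has non-positive Dini
    derivative, so [u >= 0] and the modification is void.  The same expansion applied to the first
    moment gives the mass (in)equality, since [K] conserves mass.  Continuation until blow-up gives
    maximality, and Lipschitz dependence on [0, tau] together with blow-up shows that nearby
    solutions live beyond [tau]. *)
Require Import Defs.
From Stdlib Require Import Reals Lra Lia Classical ClassicalEpsilon FunctionalExtensionality.
From Coquelicot Require Import Coquelicot.
Open Scope R_scope.

(** * Finite sums and weighted l^1 norms *)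

(** All information on the semigroup comes from its generator being the closure [frag_G_graph], so
    the smoothing bound has to be extracted from the coefficients. What makes this elementary is
    that clusters break only into smaller ones: the orbit of [e_j] stays in the first [j]
    coordinates, where [G] is the explicit finite expression [fragAB]. Bounds on all columns
    [S(t) e_j] then superpose. The kernel bound allows a loss rate of order [wt n / w n], which may
    be unbounded when [alpha > 0]; one cannot make the coagulation term monotone by adding a
    constant multiple of [u]. Replacing the argument by its positive part keeps the local Lipschitz
    constant and switches the loss off wherever [u n <= 0]. The integrand [S(t - s) K(s, u(s))] is
    continuous in [l^1_w], while its [wt]-bound is singular at [s = t]. Integrals are therefore
    formed coordinatewise, and their [wt]-bounds are first obtained away from the singularity and
    then carried over by an approximation in [l^1_w]. *)

Lemma sum1_ext m F G :
  (forall i, (1 <= i <= m)%nat -> F i = G i) -> sum1 m F = sum1 m G.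
Proof.
  induction m as [|m IH]; simpl; intros H; auto.
  rewrite IH, (H (S m)); auto; try lia. intros; apply H; lia.
Qed.

Lemma sum1_S m F : sum1 (S m) F = sum1 m F + F (S m).
Proof. reflexivity. Qed.

Lemma sum1_le m F G :
  (forall i, (1 <= i <= m)%nat -> F i <= G i) -> sum1 m F <= sum1 m G.
Proof.
  induction m as [|m IH]; simpl; intros H; [lra|].
  assert (sum1 m F <= sum1 m G) by (apply IH; intros; apply H; lia).
  specialize (H (S m)). assert (F (S m) <= G (S m)) by (apply H; lia). lra.
Qed.

Lemma sum1_0 m F : (forall i, (1 <= i <= m)%nat -> F i = 0) -> sum1 m F = 0.
Proof.
  induction m as [|m IH]; simpl; intros H; auto.
  rewrite IH, (H (S m)); [lra|lia|]. intros; apply H; lia.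
Qed.

Lemma sum1_plus m F G : sum1 m (fun i => F i + G i) = sum1 m F + sum1 m G.
Proof. induction m as [|m IH]; simpl; [lra|rewrite IH; lra]. Qed.

Lemma sum1_scal m c F : sum1 m (fun i => c * F i) = c * sum1 m F.
Proof. induction m as [|m IH]; simpl; [lra|rewrite IH; lra]. Qed.

Lemma sum1_minus m F G : sum1 m (fun i => F i - G i) = sum1 m F - sum1 m G.
Proof. induction m as [|m IH]; simpl; [lra|rewrite IH; lra]. Qed.

Lemma sum1_ge0 m F : (forall i, (1 <= i <= m)%nat -> 0 <= F i) -> 0 <= sum1 m F.
Proof.
  intros H. rewrite <- (sum1_0 m (fun _ => 0)) by auto. now apply sum1_le.
Qed.

Lemma sum1_abs m F : Rabs (sum1 m F) <= sum1 m (fun i => Rabs (F i)).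
Proof.
  induction m as [|m IH]; simpl; [rewrite Rabs_R0; lra|].
  eapply Rle_trans; [apply Rabs_triang|]. lra.
Qed.

Lemma sum1_mono m m' F :
  (m <= m')%nat -> (forall i, (1 <= i <= m')%nat -> 0 <= F i) -> sum1 m F <= sum1 m' F.
Proof.
  intros Hm. induction Hm as [|m' Hm IH]; intros H; [lra|]. simpl.
  assert (0 <= F (S m')) by (apply H; lia).
  assert (sum1 m F <= sum1 m' F) by (apply IH; intros; apply H; lia). lra.
Qed.

Lemma sum1_pad m m' F :
  (m <= m')%nat -> (forall i, (m < i <= m')%nat -> F i = 0) -> sum1 m' F = sum1 m F.
Proof.
  intros Hm. induction Hm as [|m' Hm IH]; intros H; auto. simpl.
  rewrite (H (S m')), IH; [lra| |lia]. intros; apply H; lia.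
Qed.

Lemma sum1_term m F i :
  (1 <= i <= m)%nat -> (forall i, (1 <= i <= m)%nat -> 0 <= F i) -> F i <= sum1 m F.
Proof.
  induction m as [|m IH]; [lia|]. intros Hi H. simpl.
  assert (0 <= sum1 m F) by (apply sum1_ge0; intros; apply H; lia).
  destruct (Nat.eq_dec i (S m)) as [->|Hn]; [lra|].
  assert (0 <= F (S m)) by (apply H; lia).
  assert (F i <= sum1 m F) by (apply IH; [lia|intros; apply H; lia]). lra.
Qed.

Lemma sum1_swap m n (F : nat -> nat -> R) :
  sum1 m (fun i => sum1 n (fun j => F i j)) = sum1 n (fun j => sum1 m (fun i => F i j)).
Proof.
  induction m as [|m IH]; simpl.
  - now rewrite sum1_0.
  - rewrite IH. now rewrite <- sum1_plus.
Qed.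

(* The triangle [i + j <= M] swept by the anti-diagonals [i + j = n]. *)
Lemma sum1_diag M (G : nat -> nat -> R) :
  sum1 M (fun n => sum1 (n - 1) (fun j => G (n - j)%nat j)) =
  sum1 M (fun j => sum1 (M - j) (fun i => G i j)).
Proof.
  induction M as [|M IH]; [reflexivity|].
  rewrite !(sum1_S M), IH. replace (S M - S M)%nat with 0%nat by lia.
  replace (S M - 1)%nat with M by lia. change (sum1 0 _) with 0.
  rewrite Rplus_0_r, <- sum1_plus. apply sum1_ext; intros j Hj.
  replace (S M - j)%nat with (S (M - j)) by lia. reflexivity.
Qed.

Lemma sum_n_sum1 F N : F 0%nat = 0 -> sum_n F N = sum1 N F.
Proof.
  intros H0. induction N as [|N IH].
  - now rewrite sum_O.
  - rewrite sum_Sn, IH. reflexivity.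
Qed.

Lemma ex_series_bounded F M :
  F 0%nat = 0 -> (forall n, (1 <= n)%nat -> 0 <= F n) -> (forall N, sum1 N F <= M) ->
  ex_series F /\ Series F <= M.
Proof.
  intros H0 Hp HM.
  assert (Hex : ex_finite_lim_seq (sum_n F)).
  { apply ex_finite_lim_seq_incr with M.
    - intros n. rewrite !sum_n_sum1 by auto. simpl. specialize (Hp (S n)).
      assert (0 <= F (S n)) by (apply Hp; lia). lra.
    - intros n. rewrite sum_n_sum1; auto. }
  destruct Hex as [l Hl].
  assert (Hs : is_series F l) by exact Hl.
  split; [now exists l|]. rewrite (is_series_unique _ _ Hs).
  change (Rbar_le l M). apply is_lim_seq_le with (u := sum_n F) (v := fun _ => M); auto.
  - intros n. rewrite sum_n_sum1; auto.
  - apply is_lim_seq_const.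
Qed.

Lemma sum1_le_Series F N :
  F 0%nat = 0 -> (forall n, (1 <= n)%nat -> 0 <= F n) -> ex_series F ->
  sum1 N F <= Series F.
Proof.
  intros H0 Hp [l Hl]. rewrite (is_series_unique _ _ Hl).
  change (Rbar_le (sum1 N F) l).
  apply is_lim_seq_le_loc with (u := fun _ => sum1 N F) (v := sum_n F); auto.
  - exists N. intros n Hn. rewrite sum_n_sum1; auto. apply sum1_mono; auto.
    intros; apply Hp; lia.
  - apply is_lim_seq_const.
Qed.

Lemma Series_finite F N :
  F 0%nat = 0 -> (forall n, (N < n)%nat -> F n = 0) -> ex_series F /\ Series F = sum1 N F.
Proof.
  intros H0 Hz.
  assert (Hs : is_series F (sum1 N F)).
  { change (is_lim_seq (sum_n F) (sum1 N F)).
    apply is_lim_seq_ext_loc with (fun _ => sum1 N F).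
    - exists N. intros n Hn. rewrite sum_n_sum1; auto. symmetry. apply sum1_pad; auto.
      intros; apply Hz; lia.
    - apply is_lim_seq_const. }
  split; [now exists (sum1 N F)|]. now apply is_series_unique.
Qed.

Lemma sum1_lim_Series F :
  F 0%nat = 0 -> ex_series F -> is_lim_seq (fun N => sum1 N F) (Series F).
Proof.
  intros H0 He. apply is_lim_seq_ext with (sum_n F).
  - intros n; now apply sum_n_sum1.
  - exact (Series_correct _ He).
Qed.

Lemma sum1_lim N (G : nat -> nat -> R) (l : nat -> R) :
  (forall n, (1 <= n <= N)%nat -> is_lim_seq (G n) (l n)) ->
  is_lim_seq (fun J => sum1 N (fun n => G n J)) (sum1 N l).
Proof.
  induction N as [|N IH]; intros H; simpl.
  - apply is_lim_seq_const.
  - apply is_lim_seq_plus'; [apply IH; intros; apply H; lia|apply H; lia].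
Qed.

(* [nle v f M] reads "f lies in l^1_v and has norm at most M"; being a condition on
   finite sums, it passes to coordinatewise limits and under integrals. *)
Definition nle (v f : seqR) (M : R) : Prop :=
  f 0%nat = 0 /\ forall N, sum1 N (fun n => v n * Rabs (f n)) <= M.

Definition wpos (v : seqR) : Prop := forall n, (1 <= n)%nat -> 0 < v n.

Definition trunc (N : nat) (f : seqR) : seqR := fun n => if (n <=? N)%nat then f n else 0.

Section Nle.
Variable v : seqR.
Hypothesis Hv : wpos v.

Lemma nle_in_l1 f M : nle v f M -> in_l1 v f /\ l1norm v f <= M.
Proof.
  intros [H0 HM].
  destruct (ex_series_bounded (fun n => v n * Rabs (f n)) M) as [He Hl].
  - rewrite H0, Rabs_R0. lra.
  - intros n Hn. apply Rmult_le_pos; [left; auto|apply Rabs_pos].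
  - exact HM.
  - repeat split; auto.
Qed.

Lemma in_l1_nle f : in_l1 v f -> nle v f (l1norm v f).
Proof.
  intros [H0 He]. split; auto. intros N. apply (sum1_le_Series (fun n => v n * Rabs (f n))); auto.
  - rewrite H0, Rabs_R0. lra.
  - intros n Hn. apply Rmult_le_pos; [left; auto|apply Rabs_pos].
Qed.

Lemma nle_weaken f M M' : nle v f M -> M <= M' -> nle v f M'.
Proof. intros [H0 H] HM. split; auto. intros N. specialize (H N). lra. Qed.

Lemma nle_nonneg f M : nle v f M -> 0 <= M.
Proof. intros [_ H]. exact (H 0%nat). Qed.

Lemma nle_le_abs f g M :
  nle v g M -> f 0%nat = 0 -> (forall n, (1 <= n)%nat -> Rabs (f n) <= Rabs (g n)) -> nle v f M.
Proof.
  intros [H0 H] Hf Hle. split; auto. intros N. eapply Rle_trans; [|apply (H N)].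
  apply sum1_le; intros i Hi. apply Rmult_le_compat_l; [left; apply Hv; lia|apply Hle; lia].
Qed.

Lemma nle_ext f g M : nle v g M -> (forall n, f n = g n) -> nle v f M.
Proof. intros H E. apply nle_le_abs with g; auto. rewrite E; apply H. intros; rewrite E; lra. Qed.

Lemma nle_add f g M N : nle v f M -> nle v g N -> nle v (vadd f g) (M + N).
Proof.
  intros [F0 F] [G0 G]. split; [unfold vadd; lra|]. intros n.
  eapply Rle_trans; [|apply Rplus_le_compat; [apply (F n)|apply (G n)]].
  rewrite <- sum1_plus. apply sum1_le; intros i Hi. unfold vadd.
  pose proof (Rabs_triang (f i) (g i)). pose proof (Hv i ltac:(lia)). nra.
Qed.

Lemma nle_scal c f M : nle v f M -> nle v (vscal c f) (Rabs c * M).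
Proof.
  intros [F0 F]. split; [unfold vscal; rewrite F0; lra|]. intros n.
  rewrite (sum1_ext n _ (fun i => Rabs c * (v i * Rabs (f i)))).
  - rewrite sum1_scal. apply Rmult_le_compat_l; [apply Rabs_pos|apply F].
  - intros i _. unfold vscal. rewrite Rabs_mult. lra.
Qed.

Lemma nle_sub f g M N : nle v f M -> nle v g N -> nle v (vsub f g) (M + N).
Proof.
  intros F G. apply nle_ext with (vadd f (vscal (-1) g)).
  - apply nle_add; auto. replace N with (Rabs (-1) * N); [now apply nle_scal|].
    rewrite Rabs_left by lra. lra.
  - intros n. unfold vsub, vadd, vscal. lra.
Qed.

Lemma nle_sym f g M : nle v (vsub f g) M -> nle v (vsub g f) M.
Proof.
  intros H. apply nle_le_abs with (vsub f g); auto.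
  - destruct H as [H _]. unfold vsub in *. lra.
  - intros n _. unfold vsub. rewrite Rabs_minus_sym. lra.
Qed.

Lemma nle_tri f g h M N : nle v (vsub f g) M -> nle v (vsub g h) N -> nle v (vsub f h) (M + N).
Proof.
  intros F G. apply nle_ext with (vadd (vsub f g) (vsub g h)); [now apply nle_add|].
  intros n. unfold vsub, vadd. lra.
Qed.

Lemma nle_of_sub f g M N : nle v (vsub f g) M -> nle v g N -> nle v f (M + N).
Proof.
  intros F G. apply nle_ext with (vadd (vsub f g) g); [now apply nle_add|].
  intros n. unfold vsub, vadd. lra.
Qed.

Lemma nle_zero f M : (forall n, f n = 0) -> 0 <= M -> nle v f M.
Proof.
  intros H HM. split; auto. intros N. rewrite sum1_0; auto. intros; rewrite H, Rabs_R0; lra.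
Qed.

Lemma nle_sub_refl f M : 0 <= M -> nle v (vsub f f) M.
Proof. intros. apply nle_zero; auto. intros; unfold vsub; lra. Qed.

Lemma nle_coord f M n : nle v f M -> (1 <= n)%nat -> Rabs (f n) <= M / v n.
Proof.
  intros [F0 F] Hn. assert (v n * Rabs (f n) <= M).
  { eapply Rle_trans; [|apply (F n)]. apply (sum1_term n (fun i => v i * Rabs (f i))); [lia|].
    intros; apply Rmult_le_pos; [left; apply Hv; lia|apply Rabs_pos]. }
  pose proof (Hv n Hn). apply Rmult_le_reg_l with (v n); auto. field_simplify; lra.
Qed.

Lemma nle_eq0 f : nle v f 0 -> forall n, f n = 0.
Proof.
  intros H [|n]; [apply H|]. pose proof (nle_coord f 0 (S n) H ltac:(lia)) as E.
  unfold Rdiv in E. rewrite Rmult_0_l in E. apply Rabs_eq_0. pose proof (Rabs_pos (f (S n))). lra.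
Qed.

(** An error [e] in each of the first [N] coordinates costs at most [e] times the partial sum of the
    weights, which fixes [e]. Only coordinatewise closeness is asked for, so a bound in a strong
    norm reaches a limit that is known in a weaker norm only; [Sg_superposition] and
    [conv_smoothing] pass from [w] to a larger weight in this way. *)
Lemma nle_closed f M :
  f 0%nat = 0 ->
  (forall N eps, 0 < eps -> exists g, nle v g (M + eps) /\
     forall n, (1 <= n <= N)%nat -> Rabs (g n - f n) <= eps) -> nle v f M.
Proof.
  intros F0 H. split; auto. intros N. apply le_epsilon. intros eps He.
  set (W := sum1 N v). assert (HW : 0 <= W) by (apply sum1_ge0; intros; left; apply Hv; lia).
  set (e := eps / (1 + W)).
  assert (He' : 0 < e) by (apply Rdiv_lt_0_compat; lra).
  destruct (H N e He') as [g [[G0 G] Hg]].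
  apply Rle_trans with (sum1 N (fun n => v n * Rabs (g n)) + sum1 N (fun n => e * v n)).
  - rewrite <- sum1_plus. apply sum1_le; intros i Hi.
    pose proof (Hg i Hi). pose proof (Hv i ltac:(lia)).
    assert (Rabs (f i) <= Rabs (g i) + e).
    { replace (f i) with (g i - (g i - f i)) by lra. eapply Rle_trans; [apply Rabs_triang|].
      rewrite Rabs_Ropp. lra. }
    nra.
  - rewrite sum1_scal. fold W. specialize (G N).
    assert (e * (1 + W) = eps) by (unfold e; field; lra). lra.
Qed.

Lemma nle_trunc N f M : nle v f M -> nle v (trunc N f) M.
Proof.
  intros H. apply nle_le_abs with f; auto.
  - unfold trunc. destruct (0 <=? N)%nat; auto; apply H.
  - intros n _. unfold trunc. destruct (n <=? N)%nat; [lra|]. rewrite Rabs_R0. apply Rabs_pos.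
Qed.

Lemma nle_tail f M eps :
  nle v f M -> 0 < eps -> exists N0, forall N, (N0 <= N)%nat -> nle v (vsub f (trunc N f)) eps.
Proof.
  intros H He. destruct (nle_in_l1 f M H) as [[F0 Hex] _].
  set (F := fun n => v n * Rabs (f n)).
  assert (HF0 : F 0%nat = 0) by (unfold F; rewrite F0, Rabs_R0; lra).
  assert (HFp : forall n, (1 <= n)%nat -> 0 <= F n).
  { intros; apply Rmult_le_pos; [left; auto|apply Rabs_pos]. }
  pose proof (sum1_lim_Series F HF0 Hex) as Hl.
  apply is_lim_seq_spec in Hl. destruct (Hl (mkposreal eps He)) as [N0 HN]. simpl in HN.
  exists N0. intros N HNN. split.
  - unfold vsub, trunc. destruct (0 <=? N)%nat; lra.
  - intros K.
    assert (Hz : sum1 N (fun n => v n * Rabs (vsub f (trunc N f) n)) = 0).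
    { apply sum1_0. intros i Hi. unfold vsub, trunc.
      destruct (Nat.leb_spec i N); [|lia]. rewrite Rminus_diag, Rabs_R0. lra. }
    apply Rle_trans with (sum1 (Nat.max K N) (fun n => v n * Rabs (vsub f (trunc N f) n))).
    { apply sum1_mono; [lia|]. intros; apply Rmult_le_pos; [left; apply Hv; lia|apply Rabs_pos]. }
    assert (HE : sum1 (Nat.max K N) (fun n => v n * Rabs (vsub f (trunc N f) n)) =
                 sum1 (Nat.max K N) F - sum1 (Nat.max K N) (fun n => v n * Rabs (trunc N f n))).
    { rewrite <- sum1_minus. apply sum1_ext; intros i _. unfold F, vsub, trunc.
      destruct (i <=? N)%nat; [rewrite Rminus_diag, Rabs_R0; lra|].
      rewrite Rminus_0_r, Rabs_R0; lra. }
    assert (HE2 : sum1 (Nat.max K N) (fun n => v n * Rabs (trunc N f n)) = sum1 N F).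
    { rewrite (sum1_pad N).
      - apply sum1_ext; intros i Hi. unfold trunc, F. destruct (Nat.leb_spec i N); [auto|lia].
      - lia.
      - intros i Hi. unfold trunc. destruct (Nat.leb_spec i N); [lia|]. rewrite Rabs_R0; lra. }
    rewrite HE, HE2.
    pose proof (sum1_le_Series F (Nat.max K N) HF0 HFp Hex).
    specialize (HN N HNN). apply Rabs_lt_between in HN. lra.
Qed.

End Nle.

Lemma nle_mono_weight v v' f M :
  (forall n, (1 <= n)%nat -> v n <= v' n) -> nle v' f M -> nle v f M.
Proof.
  intros H [F0 F]. split; auto. intros N. eapply Rle_trans; [|apply (F N)].
  apply sum1_le; intros i Hi. apply Rmult_le_compat_r; [apply Rabs_pos|apply H; lia].
Qed.

(** The supremum of the points up to which [Q] holds is itself such a point by left closure, and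
    cannot lie below [b] by right extension. This stands in for compactness of [[a, b]] and drives
    the bootstrap in [sol_dependence_short]. *)
Lemma real_induction (a b : R) (Q : R -> Prop) :
  Q a ->
  (forall t, a <= t < b -> (forall s, a <= s <= t -> Q s) ->
     exists d, 0 < d /\ forall s, t < s < t + d -> s <= b -> Q s) ->
  (forall t, a < t <= b -> (forall s, a <= s < t -> Q s) -> Q t) ->
  forall t, a <= t <= b -> Q t.
Proof.
  intros Qa Hr Hl t0 Ht0.
  set (E := fun x => a <= x <= b /\ forall s, a <= s <= x -> Q s).
  assert (Ea : E a) by (split; [lra|]; intros s Hs; replace s with a by lra; auto).
  destruct (completeness E) as [x [Hub Hlub]].
  { exists b. intros y [Hy _]. lra. }
  { now exists a. }
  assert (Hax : a <= x) by (apply Hub; auto).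
  assert (Hxb : x <= b) by (apply Hlub; intros y [Hy _]; lra).
  assert (Hlt : forall s, a <= s < x -> Q s).
  { intros s Hs. destruct (classic (exists y, E y /\ s <= y)) as [[y [[Hy HQ] Hsy]]|Hno].
    - apply HQ; lra.
    - exfalso. assert (x <= s); [|lra]. apply Hlub. intros y Ey.
      destruct (Rle_lt_dec y s); auto. exfalso; apply Hno. exists y; split; auto; lra. }
  assert (Qx : Q x).
  { destruct (Req_dec x a) as [->|Hne]; auto. apply Hl; auto. lra. }
  assert (Hle : forall s, a <= s <= x -> Q s).
  { intros s Hs. destruct (Req_dec s x) as [->|Hne]; auto. apply Hlt; lra. }
  destruct (Req_dec x b) as [->|Hne]; [apply Hle; auto|].
  destruct (Hr x) as [d [Hd HQ]]; [lra|auto|].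
  set (y := Rmin (x + d / 2) b).
  assert (Hy : x < y <= b /\ y < x + d).
  { unfold y, Rmin. destruct (Rle_dec (x + d / 2) b); lra. }
  assert (y <= x); [|lra]. apply Hub. split; [lra|]. intros s Hs.
  destruct (Rle_lt_dec s x); [apply Hle; lra|apply HQ; lra].
Qed.

(** The second condition says that the upper right Dini derivative is at most 0. With a tolerated
    slope [e], the inequality [phi t <= phi a + e * (t - a)] survives a short step to the right, and
    the one-sided bound from the left carries it to limits. *)
Lemma dini_nonincreasing (a b : R) (phi : R -> R) :
  a <= b ->
  (forall t, a < t <= b -> forall eps, 0 < eps -> exists d, 0 < d /\
     forall s, a <= s < t -> t - s < d -> phi t <= phi s + eps) ->
  (forall t, a <= t < b -> forall eps, 0 < eps -> exists d, 0 < d /\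
     forall h, 0 < h < d -> t + h <= b -> phi (t + h) <= phi t + eps * h) ->
  phi b <= phi a.
Proof.
  intros Hab Hc Hd. apply le_epsilon. intros e0 He0.
  set (e := e0 / (1 + (b - a))).
  assert (He : 0 < e) by (apply Rdiv_lt_0_compat; lra).
  assert (HQ : forall t, a <= t <= b -> phi t <= phi a + e * (t - a)).
  { apply real_induction.
    - lra.
    - intros t Ht HQ. destruct (Hd t Ht e He) as [d [Hd0 Hdd]]. exists d. split; auto.
      intros s Hs Hsb. specialize (Hdd (s - t)). replace (t + (s - t)) with s in Hdd by lra.
      specialize (HQ t ltac:(lra)). assert (phi s <= phi t + e * (s - t)) by (apply Hdd; lra). lra.
    - intros t Ht HQ. apply le_epsilon. intros eps Heps.
      destruct (Hc t Ht eps Heps) as [d [Hd0 Hdd]].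
      set (s := Rmax a (t - d / 2)).
      assert (Hs : a <= s < t /\ t - s < d).
      { unfold s, Rmax. destruct (Rle_dec a (t - d / 2)); lra. }
      specialize (Hdd s (proj1 Hs) (proj2 Hs)). specialize (HQ s (proj1 Hs)).
      assert (e * (s - a) <= e * (t - a)) by (apply Rmult_le_compat_l; lra). lra. }
  specialize (HQ b ltac:(lra)).
  assert (e * (1 + (b - a)) = e0) by (unfold e; field; lra). lra.
Qed.

Lemma nle_lim v (f : nat -> seqR) (l : seqR) M p0 :
  (forall n, is_lim_seq (fun p => f p n) (l n)) ->
  (forall p, (p0 <= p)%nat -> nle v (f p) M) -> nle v l M.
Proof.
  intros Hl Hf. split.
  - assert (E : is_lim_seq (fun p => f p 0%nat) 0).
    { apply is_lim_seq_ext_loc with (fun _ => 0); [|apply is_lim_seq_const].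
      exists p0. intros p Hp. symmetry. apply (Hf p Hp). }
    apply is_lim_seq_unique in E. specialize (Hl 0%nat). apply is_lim_seq_unique in Hl.
    apply (f_equal real) in E. rewrite Hl in E. exact E.
  - intros N.
    change (Rbar_le (sum1 N (fun n => v n * Rabs (l n))) M).
    apply is_lim_seq_le_loc with (fun p => sum1 N (fun n => v n * Rabs (f p n))) (fun _ => M).
    + exists p0. intros p Hp. apply (Hf p Hp).
    + apply (sum1_lim N (fun n p => v n * Rabs (f p n))). intros n _.
      apply is_lim_seq_scal_l with (lu := Finite (Rabs (l n))).
      apply is_lim_seq_abs with (l := Finite (l n)), Hl.
    + apply is_lim_seq_const.
Qed.

Lemma nle_eps v f M : (forall eps, 0 < eps -> nle v f (M + eps)) -> nle v f M.
Proof.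
  intros H. split; [apply (H 1 Rlt_0_1)|]. intros N. apply le_epsilon. intros eps He. apply (H eps He).
Qed.

(** * Continuous curves in weighted spaces *)

Definition cont_on (v : seqR) (u : R -> seqR) (a b : R) : Prop :=
  (forall t, a <= t <= b -> exists M, nle v (u t) M) /\
  forall t, a <= t <= b -> forall eps, 0 < eps -> exists d, 0 < d /\
    forall s, a <= s <= b -> Rabs (s - t) < d -> nle v (vsub (u s) (u t)) eps.

Section ContOn.
Variable v : seqR.
Hypothesis Hv : wpos v.

Lemma cont_on_sub u a b a' b' :
  cont_on v u a b -> a <= a' -> b' <= b -> cont_on v u a' b'.
Proof.
  intros [H1 H2] Ha Hb. split; [intros; apply H1; lra|].
  intros t Ht eps He. destruct (H2 t ltac:(lra) eps He) as [d [Hd H]]. exists d; split; auto.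
  intros; apply H; auto; lra.
Qed.

Lemma cont_on_ext u u' a b :
  cont_on v u a b -> (forall t, a <= t <= b -> forall n, u' t n = u t n) -> cont_on v u' a b.
Proof.
  intros [H1 H2] E. split.
  - intros t Ht. destruct (H1 t Ht) as [M HM]. exists M. apply nle_ext with (u t); auto.
  - intros t Ht eps He. destruct (H2 t Ht eps He) as [d [Hd H]]. exists d; split; auto.
    intros s Hs Hst. apply nle_ext with (vsub (u s) (u t)); auto.
    intros n; unfold vsub. rewrite !E; auto.
Qed.

Lemma cont_on_bounded u a b : cont_on v u a b -> exists M, 0 < M /\ forall t, a <= t <= b -> nle v (u t) M.
Proof.
  intros [H1 H2]. destruct (Rle_lt_dec a b) as [Hab|Hab]; [|exists 1; split; intros; lra].
  enough (H : forall t, a <= t <= b -> exists M, forall s, a <= s <= t -> nle v (u s) M).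
  { destruct (H b ltac:(lra)) as [M HM]. exists (Rabs M + 1). pose proof (Rle_abs M). pose proof (Rabs_pos M).
    split; [lra|]. intros t Ht. apply nle_weaken with M; [apply HM; lra|lra]. }
  assert (Hloc : forall t, a <= t <= b -> exists d B, 0 < d /\ forall s, a <= s <= b -> Rabs (s - t) < d -> nle v (u s) B).
  { intros t Ht. destruct (H1 t Ht) as [M HM]. destruct (H2 t Ht 1 ltac:(lra)) as [d [Hd H]].
    exists d, (1 + M). split; auto. intros s Hs Hst. apply nle_of_sub with (u t); auto. }
  apply real_induction.
  - destruct (H1 a ltac:(lra)) as [M HM]. exists M. intros s Hs. now replace s with a by lra.
  - intros t Ht HQ. destruct (HQ t ltac:(lra)) as [M HM].
    destruct (Hloc t ltac:(lra)) as [d [B [Hd HB]]]. exists d. split; auto. intros s Hs Hsb.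
    exists (Rmax M B). intros r Hr. destruct (Rle_lt_dec r t).
    + apply nle_weaken with M; [apply HM; lra|apply Rmax_l].
    + apply nle_weaken with B; [|apply Rmax_r]. apply HB; [lra|]. rewrite Rabs_pos_eq; lra.
  - intros t Ht HQ. destruct (Hloc t ltac:(lra)) as [d [B [Hd HB]]].
    set (r := Rmax a (t - d / 2)).
    assert (Hr : a <= r < t /\ t - r < d) by (unfold r, Rmax; destruct (Rle_dec a (t - d / 2)); lra).
    destruct (HQ r (proj1 Hr)) as [M HM].
    exists (Rmax M B). intros s Hs. destruct (Rle_lt_dec s r).
    + apply nle_weaken with M; [apply HM; lra|apply Rmax_l].
    + apply nle_weaken with B; [|apply Rmax_r]. apply HB; [lra|].
      apply Rabs_def1; lra.
Qed.

Lemma cont_on_unif u a b : cont_on v u a b -> forall eps, 0 < eps -> exists d, 0 < d /\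
  forall s t, a <= s <= b -> a <= t <= b -> Rabs (s - t) < d -> nle v (vsub (u s) (u t)) eps.
Proof.
  intros [H1 H2] eps He. destruct (Rle_lt_dec a b) as [Hab|Hab]; [|exists 1; split; intros; lra].
  set (Q := fun t => exists d, 0 < d /\ forall r s, a <= r <= t -> a <= s <= t ->
              Rabs (r - s) < d -> nle v (vsub (u r) (u s)) eps).
  assert (Hloc : forall t, a <= t <= b -> exists d, 0 < d /\ forall r s, a <= r <= b -> a <= s <= b ->
     Rabs (r - t) < d -> Rabs (s - t) < d -> nle v (vsub (u r) (u s)) eps).
  { intros t Ht. destruct (H2 t Ht (eps / 2) ltac:(lra)) as [d [Hd H]]. exists d; split; auto.
    intros r s Hr Hs H3 H4. replace eps with (eps / 2 + eps / 2) by field.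
    apply nle_tri with (u t); auto. apply nle_sym; auto. }
  (* Two points up to [x] either both lie left of [t'], or one lies right of [t' >= t - d / 2];
     being less than [d / 2] apart, both are then within [d] of [t]. *)
  assert (Hext : forall t d, a <= t <= b -> 0 < d ->
     (forall r s, a <= r <= b -> a <= s <= b ->
        Rabs (r - t) < d -> Rabs (s - t) < d -> nle v (vsub (u r) (u s)) eps) ->
     forall t', a <= t' -> t - d / 2 <= t' <= t -> Q t' -> forall x, x <= b -> x < t + d -> Q x).
  { intros t d Ht Hd H t' Hat Ht' [d' [Hd' HQ]] x Hxb Hx. exists (Rmin d' (d / 2)).
    assert (Hm : 0 < Rmin d' (d / 2) /\ Rmin d' (d / 2) <= d' /\ Rmin d' (d / 2) <= d / 2).
    { pose proof (Rmin_l d' (d / 2)); pose proof (Rmin_r d' (d / 2)).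
      split; [apply Rmin_pos; lra|]. lra. }
    split; [lra|]. intros r s Hr Hs Hrs.
    destruct (Rle_lt_dec r t').
    - destruct (Rle_lt_dec s t'); [apply HQ; lra|].
      apply Rabs_def2 in Hrs. apply H; try lra; apply Rabs_def1; lra.
    - apply Rabs_def2 in Hrs. apply H; try lra; apply Rabs_def1; lra. }
  assert (HQ : forall t, a <= t <= b -> Q t).
  { apply real_induction.
    - exists 1. split; [lra|]. intros r s Hr Hs _. replace r with a by lra. replace s with a by lra.
      apply nle_sub_refl. lra.
    - intros t Ht HQ. destruct (Hloc t ltac:(lra)) as [d [Hd H]]. exists d. split; auto.
      intros s Hs Hsb. apply (Hext t d) with t; auto; try lra. apply HQ; lra.
    - intros t Ht HQ. destruct (Hloc t ltac:(lra)) as [d [Hd H]].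
      set (r := Rmax a (t - d / 2)).
      assert (Hr : a <= r < t /\ t - d / 2 <= r) by (unfold r, Rmax; destruct (Rle_dec a (t - d / 2)); lra).
      apply (Hext t d) with r; auto; try lra. apply HQ; lra. }
  destruct (HQ b ltac:(lra)) as [d [Hd H]]. exists d; split; auto.
Qed.

Lemma cont_on_add f g a b : cont_on v f a b -> cont_on v g a b -> cont_on v (fun t => vadd (f t) (g t)) a b.
Proof.
  intros [F1 F2] [G1 G2]. split.
  - intros t Ht. destruct (F1 t Ht) as [M HM]. destruct (G1 t Ht) as [N HN]. exists (M + N). now apply nle_add.
  - intros t Ht eps He. destruct (F2 t Ht (eps / 2) ltac:(lra)) as [d [Hd H]].
    destruct (G2 t Ht (eps / 2) ltac:(lra)) as [d' [Hd' H']].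
    exists (Rmin d d'). split; [apply Rmin_pos; auto|]. intros s Hs Hst.
    pose proof (Rmin_l d d'). pose proof (Rmin_r d d').
    apply nle_ext with (vadd (vsub (f s) (f t)) (vsub (g s) (g t))); auto.
    + replace eps with (eps / 2 + eps / 2) by lra. apply nle_add; auto; [apply H|apply H']; auto; lra.
    + intros n. unfold vsub, vadd. lra.
Qed.

Lemma cont_on_scal c f a b : cont_on v f a b -> cont_on v (fun t => vscal c (f t)) a b.
Proof.
  intros [F1 F2]. split.
  - intros t Ht. destruct (F1 t Ht) as [M HM]. eexists. apply nle_scal; eauto.
  - intros t Ht eps He. pose proof (Rabs_pos c).
    destruct (F2 t Ht (eps / (1 + Rabs c))) as [d [Hd H']]; [apply Rdiv_lt_0_compat; lra|].
    exists d. split; auto. intros s Hs Hst.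
    apply nle_ext with (vscal c (vsub (f s) (f t))); auto.
    + apply nle_weaken with (Rabs c * (eps / (1 + Rabs c))).
      * apply nle_scal; auto.
      * apply Rmult_le_reg_r with (1 + Rabs c); [lra|]. field_simplify; [|lra]. nra.
    + intros n. unfold vsub, vscal. lra.
Qed.

Lemma cont_on_limit f a b :
  (forall t, a <= t <= b -> f t 0%nat = 0) ->
  (forall eps, 0 < eps -> exists g, cont_on v g a b /\
     forall t, a <= t <= b -> nle v (vsub (f t) (g t)) eps) -> cont_on v f a b.
Proof.
  intros F0 H. split.
  - intros t Ht. destruct (H 1 ltac:(lra)) as [g [[G _] Hg]]. destruct (G t Ht) as [M HM].
    exists (1 + M). apply nle_of_sub with (g t); auto.
  - intros t Ht eps He. destruct (H (eps / 3) ltac:(lra)) as [g [[_ G] Hg]].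
    destruct (G t Ht (eps / 3) ltac:(lra)) as [d [Hd Hdd]]. exists d; split; auto. intros s Hs Hst.
    replace eps with (eps / 3 + (eps / 3 + eps / 3)) by lra.
    apply nle_tri with (g s); auto. apply nle_tri with (g t); auto. apply nle_sym; auto.
Qed.

End ContOn.

Lemma nle_scal_weight v c f M : 0 <= c -> nle v f M -> nle (fun n => c * v n) f (c * M).
Proof.
  intros Hc [F0 F]. split; auto. intros N.
  rewrite (sum1_ext N _ (fun n => c * (v n * Rabs (f n)))) by (intros; ring).
  rewrite sum1_scal. apply Rmult_le_compat_l; auto.
Qed.

(** * The fragmentation semigroup *)

Lemma Series_le_signed F G :
  ex_series F -> ex_series G -> (forall n, F n <= G n) -> Series F <= Series G.
Proof.
  intros HF HG H.
  change (Rbar_le (Series F) (Series G)).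
  apply is_lim_seq_le with (sum_n F) (sum_n G).
  - intros n. induction n as [|n IH]; [rewrite !sum_O; auto|].
    rewrite !sum_Sn. unfold plus; simpl. specialize (H (S n)). lra.
  - exact (Series_correct _ HF).
  - exact (Series_correct _ HG).
Qed.

Lemma Series_zero F : (forall n, F n = 0) -> Series F = 0.
Proof. intros H. exact (proj2 (Series_finite F 0 (H 0%nat) (fun n _ => H n))). Qed.

(** The [v]-norm of the positive part. It is used for [f] with a bound [nle w f M] and
    [0 <= v <= w], where the series converges; [v] may vanish at some indices, which is how supports
    are controlled in [Sg_supp]. *)
Definition halfnorm (v f : seqR) : R := Series (fun n => v n * Rmax (f n) 0).

Definition unitv (j : nat) : seqR := fun n => if (n =? j)%nat then 1 else 0.

Lemma nle_fin v f N :
  wpos v -> f 0%nat = 0 -> (forall n, (N < n)%nat -> f n = 0) ->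
  nle v f (sum1 N (fun n => v n * Rabs (f n))).
Proof.
  intros Hv H0 Hz. split; auto. intros K.
  assert (Hp : forall i, (1 <= i)%nat -> 0 <= v i * Rabs (f i)).
  { intros; apply Rmult_le_pos; [left; auto|apply Rabs_pos]. }
  apply Rle_trans with (sum1 (Nat.max N K) (fun n => v n * Rabs (f n))).
  - apply sum1_mono; [lia|]. intros; apply Hp; lia.
  - rewrite (sum1_pad N); [lra|lia|]. intros i Hi. rewrite Hz by lia. rewrite Rabs_R0; lra.
Qed.

Lemma trunc_supp N f n : (N < n)%nat -> trunc N f n = 0.
Proof. intros H. unfold trunc. destruct (Nat.leb_spec n N); [lia|auto]. Qed.

Lemma trunc_0 N f : f 0%nat = 0 -> trunc N f 0%nat = 0.
Proof. intros H. unfold trunc. destruct (0 <=? N)%nat; auto. Qed.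

Lemma vsub_alt f g : vsub f g = vadd f (vscal (-1) g).
Proof. extensionality n. unfold vsub, vadd, vscal. lra. Qed.

Section HalfNorm.
Variables v w : seqR.
Hypothesis Hw : wpos w.
Hypothesis Hv : forall n, (1 <= n)%nat -> 0 <= v n <= w n.

Lemma halfnorm_term0 f : f 0%nat = 0 -> v 0%nat * Rmax (f 0%nat) 0 = 0.
Proof. intros ->. rewrite Rmax_left; lra. Qed.

Lemma halfnorm_term_pos f n : (1 <= n)%nat -> 0 <= v n * Rmax (f n) 0.
Proof. intros Hn. apply Rmult_le_pos; [apply Hv; auto|apply Rmax_r]. Qed.

Lemma halfnorm_le f M :
  f 0%nat = 0 -> (forall N, sum1 N (fun n => v n * Rmax (f n) 0) <= M) -> halfnorm v f <= M.
Proof.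
  intros H0 H. apply (ex_series_bounded (fun n => v n * Rmax (f n) 0)); auto.
  - now apply halfnorm_term0.
  - intros; now apply halfnorm_term_pos.
Qed.

Lemma halfnorm_ex f M : nle w f M -> ex_series (fun n => v n * Rmax (f n) 0).
Proof.
  intros [H0 H]. apply (ex_series_bounded _ M).
  - now apply halfnorm_term0.
  - intros; now apply halfnorm_term_pos.
  - intros N. eapply Rle_trans; [|apply (H N)]. apply sum1_le; intros i Hi.
    specialize (Hv i ltac:(lia)). pose proof (Rmax_r (f i) 0).
    assert (Rmax (f i) 0 <= Rabs (f i)).
    { apply Rmax_lub; [apply Rle_abs|apply Rabs_pos]. }
    nra.
Qed.

Lemma sum1_le_halfnorm f M N : nle w f M -> sum1 N (fun n => v n * Rmax (f n) 0) <= halfnorm v f.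
Proof.
  intros H. apply (sum1_le_Series (fun n => v n * Rmax (f n) 0)).
  - apply halfnorm_term0, H.
  - intros; now apply halfnorm_term_pos.
  - now apply halfnorm_ex with M.
Qed.

Lemma Rmax_0_lip x y : Rmax x 0 <= Rmax y 0 + Rabs (x - y).
Proof.
  apply Rmax_lub.
  - pose proof (Rle_abs (x - y)). pose proof (Rmax_l y 0). lra.
  - pose proof (Rabs_pos (x - y)). pose proof (Rmax_r y 0). lra.
Qed.

Lemma halfnorm_lip f g M D : f 0%nat = 0 -> nle w g M -> nle w (vsub f g) D ->
  halfnorm v f <= halfnorm v g + D.
Proof.
  intros F0 HG HD. apply halfnorm_le; auto. intros N.
  apply Rle_trans with (sum1 N (fun n => v n * Rmax (g n) 0) + sum1 N (fun n => w n * Rabs (vsub f g n))).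
  - rewrite <- sum1_plus. apply sum1_le; intros i Hi. specialize (Hv i ltac:(lia)).
    pose proof (Rmax_0_lip (f i) (g i)). unfold vsub. pose proof (Rabs_pos (f i - g i)). nra.
  - pose proof (sum1_le_halfnorm g M N HG). destruct HD as [_ HD]. specialize (HD N). lra.
Qed.

End HalfNorm.

Section Fragmentation.
Variables (w a : seqR) (b : nat -> nat -> R) (kappa : R) (Sg : R -> seqR -> seqR).
Hypothesis Ha : forall n, (1 <= n)%nat -> 0 <= a n.
Hypothesis Hb : forall n j, (1 <= n)%nat -> (1 <= j)%nat -> 0 <= b n j.
Hypothesis Hw : wpos w.
Hypothesis Hkappa : 0 < kappa <= 1.
Hypothesis Hwb : forall j, (2 <= j)%nat ->
  sum1 (j - 1) (fun n => w n * b n j) <= kappa * w j.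
Hypothesis HS : C0_semigroup_generated_by w Sg (frag_G_graph w a b).

Let Gr := frag_G_graph w a b.
Definition fragAB (f : seqR) : seqR := vadd (fragA a f) (fragB a b f).

(** * Dispersivity of the fragmentation operator *)

Lemma frag_col_le v j N : (forall n, (1 <= n)%nat -> 0 <= v n) -> (1 <= j)%nat ->
  sum1 N (fun n => v n * (if (n <? j)%nat then b n j else 0)) <=
  sum1 (j - 1) (fun n => v n * b n j).
Proof.
  intros Hv Hj.
  apply Rle_trans with (sum1 (Nat.max N (j - 1)) (fun n => v n * (if (n <? j)%nat then b n j else 0))).
  - apply sum1_mono; [lia|]. intros i Hi. apply Rmult_le_pos; [apply Hv; lia|].
    destruct (i <? j)%nat; [apply Hb; lia|lra].
  - rewrite (sum1_pad (j - 1)).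
    + apply sum1_le; intros i Hi. destruct (Nat.ltb_spec i j); [lra|lia].
    + lia.
    + intros i Hi. destruct (Nat.ltb_spec i j); [lia|lra].
Qed.

Lemma frag_b_le n j : (1 <= n)%nat -> (n < j)%nat -> b n j <= w j / w n.
Proof.
  intros Hn Hj. assert (w n * b n j <= kappa * w j).
  { eapply Rle_trans; [|apply Hwb; lia].
    apply (sum1_term (j - 1) (fun n => w n * b n j)); [lia|].
    intros; apply Rmult_le_pos; [left; apply Hw; lia|apply Hb; lia]. }
  pose proof (Hw n Hn). pose proof (Hw j ltac:(lia)).
  apply Rmult_le_reg_l with (w n); auto. replace (w n * (w j / w n)) with (w j) by (field; lra). nra.
Qed.

(** The column condition gives [b n j <= w j / w n], so each row of [B f] is dominated by [/ w n]
    times the [w]-norm of [A f]. *)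
Lemma fragB_term_ex f M n : (1 <= n)%nat -> nle w (fragA a f) M ->
  ex_series (fun j => Rabs (fragB_term a b f n j)).
Proof.
  intros Hn [_ HM].
  apply (ex_series_bounded _ (/ w n * M)).
  - unfold fragB_term. destruct (Nat.ltb_spec n 0); [lia|apply Rabs_R0].
  - intros; apply Rabs_pos.
  - intros N. eapply Rle_trans; [|apply Rmult_le_compat_l; [|apply (HM N)]].
    2: left; apply Rinv_0_lt_compat; auto.
    rewrite <- sum1_scal. apply sum1_le; intros j Hj. unfold fragB_term, fragA.
    pose proof (Hw n Hn). pose proof (Hw j ltac:(lia)).
    assert (0 < / w n) by (apply Rinv_0_lt_compat; auto).
    rewrite Rabs_Ropp.
    destruct (Nat.ltb_spec n j).
    + pose proof (frag_b_le n j Hn ltac:(lia)).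
      rewrite !Rabs_mult, (Rabs_pos_eq (b n j)) by (apply Hb; lia).
      pose proof (Rmult_le_pos _ _ (Rabs_pos (a j)) (Rabs_pos (f j))).
      unfold Rdiv in *. nra.
    + rewrite Rabs_R0. apply Rmult_le_pos; [lra|]. apply Rmult_le_pos; [lra|apply Rabs_pos].
Qed.

Lemma fragA_pos_part f M : nle w (fragA a f) M -> nle w (fragA a (fun n => Rmax (f n) 0)) M.
Proof.
  intros H. apply nle_le_abs with (fragA a f); auto.
  - destruct H as [H _]. unfold fragA in *. unfold Rmax. destruct (Rle_dec (f 0%nat) 0); lra.
  - intros n Hn. unfold fragA. rewrite !Rabs_Ropp, !Rabs_mult.
    apply Rmult_le_compat_l; [apply Rabs_pos|].
    rewrite (Rabs_pos_eq (Rmax _ _)) by apply Rmax_r.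
    apply Rmax_lub; [apply Rle_abs|apply Rabs_pos].
Qed.

(** Where [f n > 0], the entry of [f - h g] is at least [fp n + h a_n fp n - h (B fp) n], because
    [B f <= B fp]. Where [f n <= 0], its positive part is at least 0 and again at least this
    expression. Summed against [v], the column condition on [v] bounds the contribution of [B fp] by
    that of [a fp], so the terms of order [h] balance. *)
Lemma frag_dispersive_core v f g M h :
  (forall n, (1 <= n)%nat -> 0 <= v n <= w n) ->
  (forall j, (2 <= j)%nat -> sum1 (j - 1) (fun n => v n * b n j) <= v j) ->
  nle w f M -> nle w (fragA a f) M -> nle w g M -> (forall n, g n = fragAB f n) -> 0 <= h ->
  halfnorm v f <= halfnorm v (vsub f (vscal h g)).
Proof.
  intros Hv Hvb Hf HA Hg Eg Hh.
  set (fp := fun n => Rmax (f n) 0).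
  set (F := fun n => v n * (a n * fp n)).
  assert (fp0 : fp 0%nat = 0) by (unfold fp; rewrite (proj1 Hf); apply Rmax_left; lra).
  assert (fpp : forall n, 0 <= fp n) by (intros; apply Rmax_r).
  assert (F0 : F 0%nat = 0) by (unfold F; rewrite fp0; lra).
  assert (Fp : forall n, (1 <= n)%nat -> 0 <= F n).
  { intros n Hn. apply Rmult_le_pos; [apply Hv; auto|]. apply Rmult_le_pos; auto. }
  pose proof (fragA_pos_part f M HA) as HAp. fold fp in HAp.
  assert (HF : ex_series F).
  { apply (ex_series_bounded F M); auto. intros N. destruct HAp as [_ HAp].
    eapply Rle_trans; [|apply (HAp N)]. apply sum1_le; intros i Hi. unfold F, fragA.
    rewrite Rabs_Ropp, Rabs_mult, (Rabs_pos_eq (a i)), (Rabs_pos_eq (fp i)); auto.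
    2: apply Ha; lia.
    apply Rmult_le_compat_r; [|apply Hv; lia]. apply Rmult_le_pos; auto. apply Ha; lia. }
  set (Bp := fun n => Series (fragB_term a b fp n)).
  (* The double sum is exchanged only for finitely many columns [J]; then [J] tends to infinity in
     each row. *)
  assert (HBp : forall N, sum1 N (fun n => v n * Bp n) <= Series F).
  { intros N.
    change (Rbar_le (sum1 N (fun n => v n * Bp n)) (Series F)).
    apply is_lim_seq_le with
      (u := fun J => sum1 N (fun n => v n * sum1 J (fragB_term a b fp n))) (v := fun _ => Series F).
    - intros J.
      rewrite (sum1_ext N _ (fun n => sum1 J (fun j => v n * fragB_term a b fp n j)))
        by (intros; now rewrite sum1_scal).
      rewrite sum1_swap. eapply Rle_trans; [|apply (sum1_le_Series F J); auto].
      apply sum1_le; intros j Hj.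
      rewrite (sum1_ext N _ (fun n => (a j * fp j) * (v n * (if (n <? j)%nat then b n j else 0)))).
      2: { intros n Hn. unfold fragB_term. destruct (n <? j)%nat; ring. }
      rewrite sum1_scal. unfold F. rewrite (Rmult_comm (v j)).
      apply Rmult_le_compat_l; [apply Rmult_le_pos; auto; apply Ha; lia|].
      eapply Rle_trans; [apply frag_col_le; [intros; apply Hv; auto|lia]|].
      destruct (Nat.eq_dec j 1) as [->|Hj1]; [apply Hv; lia|apply Hvb; lia].
    - apply (sum1_lim N (fun n J => v n * sum1 J (fragB_term a b fp n))).
      intros n Hn. apply is_lim_seq_scal_l with (lu := Finite (Bp n)).
      apply sum1_lim_Series.
      + unfold fragB_term. destruct (Nat.ltb_spec n 0); [lia|auto].
      + apply ex_series_Rabs. apply fragB_term_ex with M; auto; lia.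
    - apply is_lim_seq_const. }
  assert (HB : forall n, (1 <= n)%nat -> fragB a b f n <= Bp n /\ 0 <= Bp n).
  { intros n Hn. destruct n as [|n]; [lia|]. unfold fragB.
    assert (He1 : ex_series (fragB_term a b f (S n))) by (apply ex_series_Rabs, fragB_term_ex with M; auto).
    assert (He2 : ex_series (fragB_term a b fp (S n))) by (apply ex_series_Rabs, fragB_term_ex with M; auto).
    assert (Hnn : forall j, 0 <= fragB_term a b fp (S n) j /\
                     fragB_term a b f (S n) j <= fragB_term a b fp (S n) j).
    { intros j. unfold fragB_term. destruct (Nat.ltb_spec (S n) j); [|lra].
      pose proof (Ha j ltac:(lia)). pose proof (Hb (S n) j Hn ltac:(lia)).
      assert (f j <= fp j) by apply Rmax_l. specialize (fpp j).
      pose proof (Rmult_le_pos _ _ H0 H1). split; nra. }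
    split.
    - apply Series_le_signed; auto. intros; apply Hnn.
    - change 0 with (sum1 0 (fragB_term a b fp (S n))).
      apply sum1_le_Series; auto. intros; apply Hnn. }
  assert (Hd : nle w (vsub f (vscal h g)) (M + Rabs h * M)) by (apply nle_sub, nle_scal; auto).
  (* At finite [N] the terms of order [h] leave the defect [h * (sum1 N F - Series F)], which
     vanishes as [N] grows. *)
  assert (Hmain : forall N, sum1 N (fun n => v n * Rmax (f n) 0) + h * sum1 N F - h * Series F
                     <= halfnorm v (vsub f (vscal h g))).
  { intros N. eapply Rle_trans; [|apply (sum1_le_halfnorm v w Hv _ _ N Hd)].
    apply Rle_trans with (sum1 N (fun n => v n * Rmax (f n) 0) + h * sum1 N F
                           - h * sum1 N (fun n => v n * Bp n)).
    { specialize (HBp N). nra. }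
    rewrite <- !sum1_scal, <- sum1_plus, <- sum1_minus. apply sum1_le; intros n Hn.
    destruct (HB n ltac:(lia)) as [HB1 HB2]. specialize (Hv n ltac:(lia)).
    unfold F, vsub, vscal. rewrite Eg. unfold fragAB, vadd, fragA. unfold fp.
    destruct (Rle_lt_dec (f n) 0).
    - rewrite (Rmax_right (f n)) by lra.
      pose proof (Rmax_r (f n - h * (- (a n * f n) + fragB a b f n)) 0).
      pose proof (Rmult_le_pos _ _ (proj1 Hv) H). pose proof (Rmult_le_pos _ _ (proj1 Hv) HB2). nra.
    - rewrite (Rmax_left (f n)) by lra.
      pose proof (Rmax_l (f n - h * (- (a n * f n) + fragB a b f n)) 0).
      assert (v n * (f n - h * (- (a n * f n) + Bp n)) <=
              v n * Rmax (f n - h * (- (a n * f n) + fragB a b f n)) 0); [|lra].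
      apply Rmult_le_compat_l; [lra|]. nra. }
  set (lim := halfnorm v f + h * Series F - h * Series F).
  replace (halfnorm v f) with lim by (unfold lim; lra).
  change (Rbar_le lim (halfnorm v (vsub f (vscal h g)))).
  eapply is_lim_seq_le; [apply Hmain| |apply is_lim_seq_const].
  unfold lim. apply is_lim_seq_minus'; [apply is_lim_seq_plus'|apply is_lim_seq_const].
  - apply (sum1_lim_Series (fun n => v n * Rmax (f n) 0)).
    + apply halfnorm_term0, Hf.
    + now apply (halfnorm_ex v w Hv f M).
  - apply is_lim_seq_scal_l with (lu := Finite (Series F)). now apply sum1_lim_Series.
Qed.

(** Both sides are Lipschitz in the graph norm, so the inequality passes from the approximants to
    their limit. The two replacements cost [e] and [e + h * e], whence the choice of [e]. *)
Lemma frag_dispersive v f g h :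
  (forall n, (1 <= n)%nat -> 0 <= v n <= w n) ->
  (forall j, (2 <= j)%nat -> sum1 (j - 1) (fun n => v n * b n j) <= v j) ->
  Gr f g -> 0 <= h -> halfnorm v f <= halfnorm v (vsub f (vscal h g)).
Proof.
  intros Hv Hvb [Hf [Hg [fk [Hdom [Hl1 Hl2]]]]] Hh.
  apply in_l1_nle in Hf, Hg; auto.
  apply le_epsilon. intros eps He.
  set (e := eps / (2 + h)). assert (He' : 0 < e) by (apply Rdiv_lt_0_compat; lra).
  apply is_lim_seq_spec in Hl1, Hl2.
  destruct (Hl1 (mkposreal e He')) as [N1 H1]. destruct (Hl2 (mkposreal e He')) as [N2 H2].
  simpl in H1, H2. set (m := Nat.max N1 N2).
  specialize (H1 m ltac:(unfold m; lia)). specialize (H2 m ltac:(unfold m; lia)).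
  destruct (Hdom m) as [[Fm FA] [_ [_ FB]]].
  apply in_l1_nle in Fm, FA, FB; auto.
  set (F := fk m) in *. fold (fragAB F) in H2.
  assert (FAB : nle w (fragAB F) (l1norm w (fragA a F) + l1norm w (fragB a b F))) by (apply nle_add; auto).
  assert (D1 : nle w (vsub F f) e).
  { apply nle_weaken with (l1norm w (vsub F f)).
    - apply in_l1_nle; auto. eapply nle_in_l1; eauto. apply nle_sub; eauto.
    - apply Rabs_lt_between in H1. lra. }
  assert (D2 : nle w (vsub (fragAB F) g) e).
  { apply nle_weaken with (l1norm w (vsub (fragAB F) g)).
    - apply in_l1_nle; auto. eapply nle_in_l1; eauto. apply nle_sub; eauto.
    - apply Rabs_lt_between in H2. lra. }
  assert (HF : halfnorm v F <= halfnorm v (vsub F (vscal h (fragAB F)))).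
  { set (M := Rmax (l1norm w F) (Rmax (l1norm w (fragA a F)) (l1norm w (fragA a F) + l1norm w (fragB a b F)))).
    apply frag_dispersive_core with M; auto.
    - eapply nle_weaken; [apply Fm|apply Rmax_l].
    - eapply nle_weaken; [apply FA|]. eapply Rle_trans; [apply Rmax_l|apply Rmax_r].
    - eapply nle_weaken; [apply FAB|]. eapply Rle_trans; [apply Rmax_r|apply Rmax_r]. }
  assert (E1 : halfnorm v f <= halfnorm v F + e).
  { eapply (halfnorm_lip v w); eauto. apply Hf. apply nle_sym; auto. }
  assert (E2 : halfnorm v (vsub F (vscal h (fragAB F))) <= halfnorm v (vsub f (vscal h g)) + (e + h * e)).
  { eapply (halfnorm_lip v w Hv).
    - unfold vsub, vscal. rewrite (proj1 Fm), (proj1 FAB). lra.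
    - apply nle_sub; eauto. apply nle_scal; eauto.
    - apply nle_ext with (vsub (vsub F f) (vscal h (vsub (fragAB F) g))); auto.
      + apply nle_sub; auto. rewrite <- (Rabs_pos_eq h) at 2 by auto. now apply nle_scal.
      + intros n. unfold vsub, vscal. lra. }
  assert (e * (2 + h) = eps) by (unfold e; field; lra). lra.
Qed.

(** * The semigroup and its generator *)

Lemma Sg_in t f M : 0 <= t -> nle w f M -> exists M', nle w (Sg t f) M'.
Proof.
  intros Ht Hf. destruct HS as [H _]. eexists. apply in_l1_nle; auto. apply H; auto.
  eapply nle_in_l1; eauto.
Qed.

Lemma Sg_bounded t : 0 <= t -> exists C, 0 < C /\ forall f M, nle w f M -> nle w (Sg t f) (C * M).
Proof.
  intros Ht. destruct HS as [H [_ [H2 _]]]. destruct (H2 t Ht) as [C HC].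
  exists (Rabs C + 1). pose proof (Rabs_pos C). split; [lra|]. intros f M Hf.
  destruct (nle_in_l1 w Hw f M Hf) as [Hi Hl]. apply nle_weaken with (l1norm w (Sg t f)).
  - apply in_l1_nle; auto.
  - specialize (HC f Hi). pose proof (nle_nonneg w _ _ (in_l1_nle w Hw f Hi)).
    pose proof (Rle_abs C). nra.
Qed.

Lemma Sg_lin t c f g M N : 0 <= t -> nle w f M -> nle w g N ->
  Sg t (vadd f (vscal c g)) = vadd (Sg t f) (vscal c (Sg t g)).
Proof. intros Ht Hf Hg. destruct HS as [_ [H _]]. apply H; auto; eapply nle_in_l1; eauto. Qed.

Lemma Sg_sub t f g M N : 0 <= t -> nle w f M -> nle w g N ->
  Sg t (vsub f g) = vsub (Sg t f) (Sg t g).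
Proof. intros Ht Hf Hg. rewrite !vsub_alt. eapply Sg_lin; eauto. Qed.

Lemma Sg_scal t c f M : 0 <= t -> nle w f M -> Sg t (vscal c f) = vscal c (Sg t f).
Proof.
  intros Ht Hf.
  assert (H0 : nle w (vsub f f) 0) by (apply nle_sub_refl; lra).
  pose proof (Sg_lin t c (vsub f f) f 0 M Ht H0 Hf) as E.
  rewrite (Sg_sub t f f M M) in E by auto.
  replace (vadd (vsub f f) (vscal c f)) with (vscal c f) in E.
  - rewrite E. extensionality n. unfold vadd, vsub, vscal. lra.
  - extensionality n. unfold vadd, vsub, vscal. lra.
Qed.

Lemma Sg_0 f M : nle w f M -> Sg 0 f = f.
Proof. intros Hf. destruct HS as [_ [_ [_ [H _]]]]. apply H. eapply nle_in_l1; eauto. Qed.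

Lemma Sg_plus t s f M : 0 <= t -> 0 <= s -> nle w f M -> Sg (t + s) f = Sg t (Sg s f).
Proof. intros Ht Hs Hf. destruct HS as [_ [_ [_ [_ [H _]]]]]. apply H; auto. eapply nle_in_l1; eauto. Qed.

Lemma Sg_cont f M : nle w f M -> forall t, 0 <= t -> forall eps, 0 < eps ->
  exists d, 0 < d /\ forall s, 0 <= s -> Rabs (s - t) < d -> nle w (vsub (Sg s f) (Sg t f)) eps.
Proof.
  intros Hf t Ht eps He. destruct HS as [HI [_ [_ [_ [_ [H _]]]]]].
  destruct (nle_in_l1 w Hw f M Hf) as [Hi _].
  destruct (H f t Hi Ht eps He) as [d [Hd Hdd]]. exists d; split; auto.
  intros s Hs Hst. apply nle_weaken with (l1norm w (vsub (Sg s f) (Sg t f))).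
  - apply in_l1_nle; auto. eapply nle_in_l1; auto. apply nle_sub; auto; apply in_l1_nle; auto.
  - left. auto.
Qed.

Lemma Gr_in f g : Gr f g -> exists M, nle w f M /\ nle w g M.
Proof.
  intros [Hf [Hg _]]. apply in_l1_nle in Hf, Hg; auto.
  exists (Rmax (l1norm w f) (l1norm w g)). split; eapply nle_weaken; eauto; [apply Rmax_l|apply Rmax_r].
Qed.

(** The difference quotient multiplied out: a remainder [eps * h] is the form in which Dini
    derivatives use the generator. [Gr_of_right_expansion] is the converse. *)
Lemma Gr_right_expansion f g : Gr f g -> forall eps, 0 < eps -> exists d, 0 < d /\
  forall h, 0 < h < d -> nle w (vsub (vsub (Sg h f) f) (vscal h g)) (eps * h).
Proof.
  intros HG eps He. pose proof (Gr_in f g HG) as [M [Hf Hg]].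
  destruct HS as [HI [_ [_ [_ [_ [_ HGen]]]]]].
  destruct (proj1 (HGen f g) HG) as [_ [_ Hlim]].
  destruct (Hlim (ball 0 (mkposreal eps He))) as [d Hd].
  { now exists (mkposreal eps He). }
  exists d. split; [apply d|]. intros h Hh.
  assert (HB : ball 0 d h).
  { unfold ball; simpl; unfold AbsRing_ball, abs, minus, plus, opp; simpl.
    rewrite Ropp_0, Rplus_0_r. rewrite Rabs_pos_eq; lra. }
  specialize (Hd h HB ltac:(lra)).
  unfold ball in Hd; simpl in Hd; unfold AbsRing_ball, abs, minus, plus, opp in Hd; simpl in Hd.
  rewrite Ropp_0, Rplus_0_r in Hd. apply Rabs_lt_between in Hd.
  destruct (Sg_in h f M) as [M' HM']; [lra|auto|].
  set (q := vsub (vscal (/ h) (vsub (Sg h f) f)) g) in *.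
  assert (Hq : nle w q eps).
  { apply nle_weaken with (l1norm w q); [|lra]. apply in_l1_nle; auto.
    eapply nle_in_l1; auto. unfold q. apply nle_sub; eauto. apply nle_scal; eauto. apply nle_sub; eauto. }
  apply nle_ext with (vscal h q); auto.
  - replace (eps * h) with (Rabs h * eps) by (rewrite Rabs_pos_eq; lra). now apply nle_scal.
  - intros n. unfold q, vsub, vscal. field. lra.
Qed.

Lemma Gr_of_right_expansion f g M :
  nle w f M -> nle w g M ->
  (forall eps, 0 < eps -> exists d, 0 < d /\
     forall h, 0 < h < d -> nle w (vsub (vsub (Sg h f) f) (vscal h g)) (eps * h)) -> Gr f g.
Proof.
  intros Hf Hg H. destruct HS as [HI [_ [_ [_ [_ [_ HGen]]]]]]. apply HGen.
  repeat split; try apply (nle_in_l1 w Hw f M Hf); try apply (nle_in_l1 w Hw g M Hg).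
  intros P [e HP]. destruct (H (pos (pos_div_2 e))) as [d [Hd Hdd]]; [apply cond_pos|].
  exists (mkposreal d Hd). intros h HB Hh0. apply HP.
  unfold ball in HB |- *; simpl in HB |- *; unfold AbsRing_ball, abs, minus, plus, opp in HB |- *; simpl in HB |- *.
  rewrite Ropp_0, Rplus_0_r in *. apply Rabs_def2 in HB.
  specialize (Hdd h ltac:(lra)).
  set (q := vsub (vscal (/ h) (vsub (Sg h f) f)) g).
  assert (Hq : nle w q (e / 2)).
  { apply nle_ext with (vscal (/ h) (vsub (vsub (Sg h f) f) (vscal h g))); auto.
    - replace (e / 2) with (Rabs (/ h) * (e / 2 * h)).
      + now apply nle_scal.
      + rewrite Rabs_pos_eq; [field; lra|]. left; apply Rinv_0_lt_compat; auto.
    - intros n. unfold q, vsub, vscal. field. lra. }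
  destruct (nle_in_l1 w Hw q _ Hq) as [Hi Hl].
  pose proof (nle_nonneg w _ _ (in_l1_nle w Hw q Hi)). pose proof (cond_pos e).
  rewrite Rabs_pos_eq; lra.
Qed.

Lemma Gr_Sg t f g : 0 <= t -> Gr f g -> Gr (Sg t f) (Sg t g).
Proof.
  intros Ht HG. destruct (Gr_in f g HG) as [M [Hf Hg]].
  destruct (Sg_bounded t Ht) as [C [HC HCb]].
  apply Gr_of_right_expansion with (C * M); auto.
  intros eps He. destruct (Gr_right_expansion f g HG (eps / C)) as [d [Hd Hdd]].
  { apply Rdiv_lt_0_compat; auto. }
  exists d; split; auto. intros h Hh.
  destruct (Sg_in h f M) as [M' HM']; [lra|auto|].
  assert (H1 : nle w (vsub (Sg h f) f) (M' + M)) by (apply nle_sub; auto).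
  assert (H2 : nle w (vscal h g) (Rabs h * M)) by (apply nle_scal; auto).
  replace (vsub (vsub (Sg h (Sg t f)) (Sg t f)) (vscal h (Sg t g)))
    with (Sg t (vsub (vsub (Sg h f) f) (vscal h g))).
  - replace (eps * h) with (C * (eps / C * h)) by (field; lra). apply HCb. auto.
  - rewrite (Sg_sub t _ _ _ _ Ht H1 H2), (Sg_sub t _ _ _ _ Ht HM' Hf), (Sg_scal t h g M) by auto.
    rewrite <- (Sg_plus t h f M), (Rplus_comm t h), (Sg_plus h t f M) by (auto; lra). reflexivity.
Qed.

Lemma Gr_unique f g g' : Gr f g -> Gr f g' -> forall n, g n = g' n.
Proof.
  intros H H'. destruct (Gr_in f g H) as [M [Hf Hg]]. destruct (Gr_in f g' H') as [M' [_ Hg']].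
  assert (E : nle w (vsub g g') 0).
  { split. { unfold vsub. rewrite (proj1 Hg), (proj1 Hg'). lra. }
    intros N. apply le_epsilon. intros eps He.
    destruct (Gr_right_expansion f g H (eps / 2)) as [d [Hd Hdd]]; [lra|].
    destruct (Gr_right_expansion f g' H' (eps / 2)) as [d' [Hd' Hdd']]; [lra|].
    set (h := Rmin d d' / 2).
    assert (Hm : 0 < Rmin d d') by (apply Rmin_pos; auto).
    pose proof (Rmin_l d d'). pose proof (Rmin_r d d').
    specialize (Hdd h ltac:(unfold h; lra)). specialize (Hdd' h ltac:(unfold h; lra)).
    assert (Hh : 0 < h) by (unfold h; lra).
    assert (E : nle w (vsub g g') (Rabs (/ h) * (eps / 2 * h + eps / 2 * h))).
    { apply nle_ext with (vscal (/ h) (vsub (vsub (vsub (Sg h f) f) (vscal h g'))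
                      (vsub (vsub (Sg h f) f) (vscal h g)))); auto.
      - apply nle_scal; auto. apply nle_sub; auto.
      - intros n. unfold vsub, vscal. field. lra. }
    replace (Rabs (/ h) * (eps / 2 * h + eps / 2 * h)) with (0 + eps) in E; [apply E|].
    rewrite Rabs_pos_eq; [field; lra|]. left; apply Rinv_0_lt_compat; auto. }
  intros n. pose proof (nle_eq0 w Hw _ E n) as E'. unfold vsub in E'. lra.
Qed.


(** The constant sequence [f] witnesses membership in the closure. Column [j] of [B] reaches only
    rows below [j], so [B f] again vanishes beyond [N] and is summable. *)
Lemma Gr_fin f N : f 0%nat = 0 -> (forall n, (N < n)%nat -> f n = 0) -> Gr f (fragAB f).
Proof.
  intros H0 Hz.
  assert (Hf := nle_fin w f N Hw H0 Hz).
  assert (HA : nle w (fragA a f) (sum1 N (fun n => w n * Rabs (fragA a f n)))).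
  { apply nle_fin; auto; unfold fragA; [rewrite H0; lra|intros n Hn; rewrite (Hz n Hn); lra]. }
  assert (HBz : forall n, (N < n)%nat -> fragB a b f n = 0).
  { intros [|n] Hn; [reflexivity|]. unfold fragB.
    apply Series_zero. intros j.
    unfold fragB_term. destruct (Nat.ltb_spec (S n) j); auto. rewrite (Hz j) by lia. lra. }
  assert (HB : nle w (fragB a b f) (sum1 N (fun n => w n * Rabs (fragB a b f n)))).
  { apply nle_fin; auto. }
  assert (HAB : nle w (fragAB f) (sum1 N (fun n => w n * Rabs (fragA a f n)) +
                 sum1 N (fun n => w n * Rabs (fragB a b f n)))) by (apply nle_add; auto).
  assert (Hl : forall g, is_lim_seq (fun _ : nat => l1norm w (vsub g g)) 0).
  { intros g. apply is_lim_seq_ext with (fun _ => 0); [|apply is_lim_seq_const].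
    intros _. unfold l1norm. apply eq_sym, Series_zero. intros n. unfold vsub.
    rewrite Rminus_diag, Rabs_R0. lra. }
  split; [eapply nle_in_l1; eauto|]. split; [eapply nle_in_l1; eauto|].
  exists (fun _ => f). split; [intros _|split; apply Hl].
  repeat split; try apply H0; try (eapply nle_in_l1; eauto).
  intros n Hn. apply ex_series_Rabs. eapply fragB_term_ex; eauto.
Qed.

(** A backward Euler comparison: applied at [S(h) F], dissipativity gives [phi (S(h) F) <= phi (S(h)
    F - h G S(h) F)], and the argument on the right is [F] up to [o(h)]. Hence [phi] has
    non-positive Dini derivative along orbits in the domain, and the Lipschitz bound extends the
    result from finitely supported vectors to all of [l^1_w]. *)
Lemma Sg_functional_le (phi : seqR -> R) f M t :
  (forall f g N D, f 0%nat = 0 -> nle w g N -> nle w (vsub f g) D -> phi f <= phi g + D) ->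
  (forall f g h, Gr f g -> 0 <= h -> phi f <= phi (vsub f (vscal h g))) ->
  0 <= t -> nle w f M -> phi (Sg t f) <= phi f.
Proof.
  intros Hlip Hdiss Ht Hf.
  assert (Hdom : forall f g, Gr f g -> phi (Sg t f) <= phi f).
  { clear f M Hf. intros f g HG. destruct (Gr_in f g HG) as [M [Hf Hg]].
    rewrite <- (Sg_0 f M Hf) at 2.
    apply (dini_nonincreasing 0 t (fun s => phi (Sg s f))); auto.
    - intros s Hs eps He. destruct (Sg_cont f M Hf s ltac:(lra) eps He) as [d [Hd H]].
      exists d. split; auto. intros r Hr Hsr.
      destruct (Sg_in r f M ltac:(lra) Hf) as [Mr Hr']. destruct (Sg_in s f M ltac:(lra) Hf) as [Ms Hs'].
      apply Hlip with Mr; auto; [apply Hs'|]. apply nle_sym; auto. apply H; [lra|].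
      rewrite Rabs_left1; lra.
    - intros s Hs eps He.
      destruct (Sg_in s f M ltac:(lra) Hf) as [Ms HF]. destruct (Sg_in s g M ltac:(lra) Hg) as [Ns HGs].
      pose proof (Gr_Sg s f g ltac:(lra) HG) as HGr.
      set (F := Sg s f) in *. set (G := Sg s g) in *.
      destruct (Gr_right_expansion F G HGr (eps / 2)) as [d [Hd H]]; [lra|].
      destruct (Sg_cont G Ns HGs 0 ltac:(lra) (eps / 2) ltac:(lra)) as [d' [Hd' H']].
      exists (Rmin d d'). split; [apply Rmin_pos; auto|]. intros h Hh Hht.
      pose proof (Rmin_l d d'). pose proof (Rmin_r d d').
      rewrite (Rplus_comm s h), (Sg_plus h s f M) by (auto; lra). fold F.
      destruct (Sg_in h F Ms ltac:(lra) HF) as [MhF HhF]. destruct (Sg_in h G Ns ltac:(lra) HGs) as [MhG HhG].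
      eapply Rle_trans; [apply (Hdiss _ _ h (Gr_Sg h F G ltac:(lra) HGr)); lra|].
      apply Hlip with Ms; auto.
      { unfold vsub, vscal. rewrite (proj1 HhF), (proj1 HhG). lra. }
      specialize (H h ltac:(lra)). specialize (H' h ltac:(lra)). rewrite (Sg_0 G Ns HGs) in H'.
      assert (H2 := H' ltac:(rewrite Rabs_pos_eq; lra)).
      apply nle_ext with (vsub (vsub (vsub (Sg h F) F) (vscal h G)) (vscal h (vsub (Sg h G) G))); auto.
      + replace (eps * h) with (eps / 2 * h + Rabs h * (eps / 2)) by (rewrite Rabs_pos_eq; lra).
        apply nle_sub; auto. apply nle_scal; auto.
      + intros n. unfold vsub, vscal. lra. }
  apply le_epsilon. intros eps He.
  destruct (Sg_bounded t Ht) as [C [HC HCb]].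
  set (e := eps / (1 + C)). assert (He' : 0 < e) by (apply Rdiv_lt_0_compat; lra).
  destruct (nle_tail w Hw f M e Hf He') as [N HN]. specialize (HN N (Nat.le_refl N)).
  set (g := trunc N f) in *. assert (Hg : nle w g M) by (apply nle_trunc; auto).
  assert (HGr : Gr g (fragAB g)).
  { apply Gr_fin with N; [apply Hg|apply trunc_supp]. }
  apply Rle_trans with (phi (Sg t g) + C * e).
  - apply Hlip with (C * M); auto.
    + destruct (Sg_in t f M Ht Hf) as [M' HM']. apply HM'.
    + rewrite <- (Sg_sub t f g M M) by auto. auto.
  - pose proof (Hdom _ _ HGr). pose proof (Hlip g f M e (proj1 Hg) Hf (nle_sym w Hw _ _ _ HN)).
    assert (e * (1 + C) = eps) by (unfold e; field; lra). nra.
Qed.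

Lemma Sg_halfnorm_le v f M t :
  (forall n, (1 <= n)%nat -> 0 <= v n <= w n) ->
  (forall j, (2 <= j)%nat -> sum1 (j - 1) (fun n => v n * b n j) <= v j) ->
  0 <= t -> nle w f M -> halfnorm v (Sg t f) <= halfnorm v f.
Proof.
  intros Hv Hvb Ht Hf. apply Sg_functional_le with M; auto.
  - intros; apply halfnorm_lip with w N; auto.
  - intros; apply frag_dispersive; auto.
Qed.

Lemma w_subadmissible j : (2 <= j)%nat -> sum1 (j - 1) (fun n => w n * b n j) <= w j.
Proof. intros Hj. pose proof (Hwb j Hj). pose proof (Hw j ltac:(lia)). nra. Qed.

Lemma Sg_w_halfnorm_le f M t : 0 <= t -> nle w f M -> halfnorm w (Sg t f) <= halfnorm w f.
Proof.
  intros Ht Hf. apply Sg_halfnorm_le with M; auto.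
  - intros n Hn. pose proof (Hw n Hn). lra.
  - apply w_subadmissible.
Qed.

Lemma halfnorm_0_nonpos v f M n :
  (forall n, (1 <= n)%nat -> 0 <= v n <= w n) -> nle w f M -> halfnorm v f <= 0 ->
  (1 <= n)%nat -> 0 < v n -> f n <= 0.
Proof.
  intros Hv Hf H Hn Hvn.
  assert (v n * Rmax (f n) 0 <= 0).
  { eapply Rle_trans; [|apply H]. eapply Rle_trans; [|apply (sum1_le_halfnorm v w Hv f M n Hf)].
    apply (sum1_term n (fun i => v i * Rmax (f i) 0)); [lia|].
    intros; apply Rmult_le_pos; [apply Hv; lia|apply Rmax_r]. }
  pose proof (Rmax_l (f n) 0). nra.
Qed.

Lemma w_self n : (1 <= n)%nat -> 0 <= w n <= w n.
Proof. intros Hn. pose proof (Hw n Hn). lra. Qed.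

(** The half-norm of [- f] is 0 and cannot grow. *)
Lemma Sg_pos f M t : 0 <= t -> nle w f M -> (forall n, 0 <= f n) -> forall n, 0 <= Sg t f n.
Proof.
  intros Ht Hf Hp. destruct (Sg_in t f M Ht Hf) as [M' HM'].
  intros [|n]; [right; symmetry; apply HM'|].
  assert (Hm : nle w (vscal (-1) f) (Rabs (-1) * M)) by (apply nle_scal; auto).
  destruct (Sg_in t _ _ Ht Hm) as [M2 HM2].
  assert (H : Sg t (vscal (-1) f) (S n) <= 0).
  { apply (halfnorm_0_nonpos w _ M2); auto; [apply w_self| |lia|apply Hw; lia].
    eapply Rle_trans; [eapply Sg_w_halfnorm_le; eauto|].
    apply (halfnorm_le w w w_self); [unfold vscal; rewrite (proj1 Hf); lra|].
    intros N. rewrite sum1_0; [lra|]. intros i Hi. unfold vscal. specialize (Hp i).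
    rewrite Rmax_right by lra. lra. }
  rewrite (Sg_scal t _ f M) in H by auto. unfold vscal in H. lra.
Qed.

(** The norm is the half-norm of [f] plus that of [- f], and neither grows. *)
Lemma Sg_contr f M t : 0 <= t -> nle w f M -> nle w (Sg t f) M.
Proof.
  intros Ht Hf. destruct (Sg_in t f M Ht Hf) as [M' HM'].
  split; [apply HM'|]. intros N.
  assert (Hm : nle w (vscal (-1) f) (Rabs (-1) * M)) by (apply nle_scal; auto).
  destruct (Sg_in t _ _ Ht Hm) as [M2 HM2].
  pose proof (sum1_le_halfnorm w w w_self _ _ N HM').
  pose proof (sum1_le_halfnorm w w w_self _ _ N HM2).
  pose proof (Sg_w_halfnorm_le f M t Ht Hf). pose proof (Sg_w_halfnorm_le _ _ t Ht Hm).
  assert (Hsum : halfnorm w f + halfnorm w (vscal (-1) f) <= M).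
  { unfold halfnorm. rewrite <- Series_plus; try (eapply (halfnorm_ex w w w_self); eauto).
    apply (ex_series_bounded (fun n => w n * Rmax (f n) 0 + w n * Rmax (vscal (-1) f n) 0)).
    - unfold vscal. rewrite (proj1 Hf), Rmult_0_r, Rmax_left; lra.
    - intros n Hn. pose proof (Hw n Hn). pose proof (Rmax_r (f n) 0). pose proof (Rmax_r (vscal (-1) f n) 0). nra.
    - intros K. destruct Hf as [_ Hf]. eapply Rle_trans; [|apply (Hf K)]. right.
      apply sum1_ext; intros i _. unfold vscal, Rabs.
      destruct (Rcase_abs (f i)); [rewrite Rmax_right, Rmax_left by lra; lra|rewrite Rmax_left, Rmax_right by lra; lra]. }
  apply Rle_trans with (sum1 N (fun n => w n * Rmax (Sg t f n) 0) +
                        sum1 N (fun n => w n * Rmax (Sg t (vscal (-1) f) n) 0)); [|lra].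
  rewrite <- sum1_plus. right. apply sum1_ext; intros i _.
  rewrite (Sg_scal t _ f M) by auto. unfold vscal, Rabs.
  destruct (Rcase_abs (Sg t f i)); [rewrite Rmax_right, Rmax_left by lra; lra|rewrite Rmax_left, Rmax_right by lra; lra].
Qed.

(** The weight [v] keeps [w] beyond [J] and is 0 up to [J]. It inherits the column condition from
    [w], and its half-norm vanishes at [f], hence at [S(t) f]. *)
Lemma Sg_supp f M J t : 0 <= t -> nle w f M -> (forall n, 0 <= f n) ->
  (forall n, (J < n)%nat -> f n = 0) -> forall n, (J < n)%nat -> Sg t f n = 0.
Proof.
  intros Ht Hf Hp Hz n Hn. destruct (Sg_in t f M Ht Hf) as [M' HM'].
  set (v := fun n => if (J <? n)%nat then w n else 0).
  assert (Hv : forall n, (1 <= n)%nat -> 0 <= v n <= w n).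
  { intros i Hi. pose proof (Hw i Hi). unfold v. destruct (J <? i)%nat; lra. }
  apply Rle_antisym; [|apply Sg_pos with M; auto].
  apply (halfnorm_0_nonpos v _ M'); auto; [|lia|].
  2: { unfold v. destruct (Nat.ltb_spec J n); [apply Hw; lia|lia]. }
  eapply Rle_trans; [eapply Sg_halfnorm_le; eauto|].
  - intros j Hj. unfold v at 2. destruct (Nat.ltb_spec J j).
    + eapply Rle_trans; [|apply (w_subadmissible j Hj)]. apply sum1_le; intros i Hi.
      apply Rmult_le_compat_r; [apply Hb; lia|apply Hv; lia].
    + rewrite sum1_0; [lra|]. intros i Hi. unfold v. destruct (Nat.ltb_spec J i); [lia|lra].
  - apply (halfnorm_le v w Hv); [apply Hf|]. intros N. rewrite sum1_0; [lra|]. intros i Hi.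
    unfold v. destruct (Nat.ltb_spec J i); [|lra]. rewrite Hz by lia. rewrite Rmax_left; lra.
Qed.

Lemma unitv_nle v j : wpos v -> (1 <= j)%nat -> nle v (unitv j) (v j).
Proof.
  intros Hv Hj. apply nle_weaken with (sum1 j (fun n => v n * Rabs (unitv j n))).
  - apply nle_fin; auto; unfold unitv.
    + destruct (Nat.eqb_spec 0 j); [lia|auto].
    + intros n Hn. destruct (Nat.eqb_spec n j); [lia|auto].
  - destruct j as [|j]; [lia|]. rewrite sum1_S, sum1_0.
    + unfold unitv. rewrite Nat.eqb_refl, Rabs_R1. lra.
    + intros i Hi. unfold unitv. destruct (Nat.eqb_spec i (S j)); [lia|]. rewrite Rabs_R0; lra.
Qed.

Lemma unitv_pos j n : 0 <= unitv j n.
Proof. unfold unitv. destruct (n =? j)%nat; lra. Qed.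

Lemma unitv_supp j n : (j < n)%nat -> unitv j n = 0.
Proof. intros H. unfold unitv. destruct (Nat.eqb_spec n j); [lia|auto]. Qed.

Lemma trunc_S N f : trunc (S N) f = vadd (trunc N f) (vscal (f (S N)) (unitv (S N))).
Proof.
  extensionality n. unfold trunc, vadd, vscal, unitv.
  destruct (Nat.leb_spec n (S N)), (Nat.leb_spec n N), (Nat.eqb_spec n (S N)); try lia; subst; lra.
Qed.

Lemma Sg_trunc_nle v c f M t N : wpos v -> 0 <= t ->
  (forall j, (1 <= j)%nat -> nle v (Sg t (unitv j)) (c j)) ->
  nle w f M -> nle v (Sg t (trunc N f)) (sum1 N (fun j => c j * Rabs (f j))).
Proof.
  intros Hv Ht Hc Hf. induction N as [|N IH].
  - assert (Hz : forall n, trunc 0 f n = 0).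
    { intros [|n]; [apply trunc_0, Hf|reflexivity]. }
    apply nle_zero; [|simpl; lra]. intros n.
    assert (H : nle w (trunc 0 f) 0) by (apply nle_zero; auto; lra).
    apply (nle_eq0 w Hw). now apply Sg_contr.
  - rewrite trunc_S, (Sg_lin t _ _ _ M (w (S N))); auto.
    + rewrite sum1_S. apply nle_add; auto. rewrite Rmult_comm. apply nle_scal; auto. apply Hc; lia.
    + apply nle_trunc; auto.
    + apply unitv_nle; auto; lia.
Qed.

(** Bounds on the columns [S(t) e_j] bound [S(t)] from the space weighted by [c] to the one weighted
    by [v]. Truncations of [f] satisfy the bound by linearity, but their images are known to
    converge only in [l^1_w]; [nle_closed] absorbs this. *)
Lemma Sg_superposition v c f M L t : wpos v -> 0 <= t ->
  (forall j, (1 <= j)%nat -> nle v (Sg t (unitv j)) (c j)) ->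
  nle w f L -> nle c f M -> nle v (Sg t f) M.
Proof.
  intros Hv Ht Hc Hf Hcf. destruct (Sg_in t f L Ht Hf) as [L' HL'].
  apply nle_closed; auto; [apply HL'|]. intros N eps He.
  (* [m] converts an error in the [w]-norm into an error in each of the first [N] coordinates. *)
  set (m := sum1 N (fun n => / w n)).
  assert (Hm : 0 <= m).
  { apply sum1_ge0. intros; left; apply Rinv_0_lt_compat, Hw; lia. }
  assert (He' : 0 < eps / (1 + m)) by (apply Rdiv_lt_0_compat; lra).
  destruct (nle_tail w Hw f L _ Hf He') as [K HK]. specialize (HK K (Nat.le_refl K)).
  exists (Sg t (trunc K f)). split.
  - apply nle_weaken with M; [|lra].
    apply nle_weaken with (sum1 K (fun j => c j * Rabs (f j))); [|apply Hcf].
    apply Sg_trunc_nle with L; auto.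
  - intros n Hn. rewrite Rabs_minus_sym.
    change (Sg t f n - Sg t (trunc K f) n) with (vsub (Sg t f) (Sg t (trunc K f)) n).
    rewrite <- (Sg_sub t f (trunc K f) L L); auto; [|apply nle_trunc; auto].
    apply (Sg_contr _ _ t Ht) in HK.
    eapply Rle_trans; [apply (nle_coord w Hw _ _ n HK); lia|].
    assert (/ w n <= m).
    { apply (sum1_term N (fun i => / w i)); [lia|]. intros; left; apply Rinv_0_lt_compat, Hw; lia. }
    assert (eps / (1 + m) * (1 + m) = eps) by (field; lra). unfold Rdiv at 1. nra.
Qed.

Lemma fragB_fin f J n : (forall n, (J < n)%nat -> f n = 0) -> (1 <= n)%nat ->
  fragB a b f n = sum1 J (fun j => if (n <? j)%nat then a j * b n j * f j else 0).
Proof.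
  intros Hz Hn. destruct n as [|n]; [lia|]. unfold fragB.
  apply (Series_finite (fragB_term a b f (S n))); [reflexivity|].
  intros j Hj. unfold fragB_term. destruct (S n <? j)%nat; auto. rewrite Hz by auto. lra.
Qed.

(** Exchange of the two sums: [c] paired with [(A + B) f] becomes [f] paired with the adjoint
    applied to [c]. Conservation and dissipation along orbits are read off from the bracket. *)
Lemma fragAB_weighted_sum c f J : (forall n, (J < n)%nat -> f n = 0) ->
  sum1 J (fun n => c n * fragAB f n) =
  sum1 J (fun j => a j * f j * (sum1 (j - 1) (fun n => c n * b n j) - c j)).
Proof.
  intros Hz.
  rewrite (sum1_ext J _ (fun n => sum1 J (fun j => c n * (if (n <? j)%nat then a j * b n j * f j else 0))
                                  - c n * (a n * f n))).
  2: { intros n Hn. rewrite sum1_scal. rewrite <- fragB_fin by (auto; lia).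
       unfold fragAB, vadd, fragA. lra. }
  rewrite sum1_minus, sum1_swap, <- sum1_minus. apply sum1_ext. intros j Hj.
  rewrite (sum1_pad (j - 1)); [|lia|].
  - rewrite (sum1_ext (j - 1) _ (fun n => (a j * f j) * (c n * b n j))).
    + rewrite sum1_scal. ring.
    + intros n Hn. destruct (Nat.ltb_spec n j); [ring|lia].
  - intros n Hn. destruct (Nat.ltb_spec n j); [lia|ring].
Qed.

Lemma finite_functional_lip c J f g D : (forall n, (1 <= n)%nat -> Rabs (c n) <= w n) ->
  nle w (vsub f g) D ->
  Rabs (sum1 J (fun n => c n * f n) - sum1 J (fun n => c n * g n)) <= D.
Proof.
  intros Hc [_ H]. rewrite <- sum1_minus. eapply Rle_trans; [apply sum1_abs|].
  eapply Rle_trans; [|apply (H J)]. apply sum1_le; intros i Hi.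
  replace (c i * f i - c i * g i) with (c i * vsub f g i) by (unfold vsub; ring).
  rewrite Rabs_mult. apply Rmult_le_compat_r; [apply Rabs_pos|apply Hc; lia].
Qed.

(** * Orbits of the unit vectors *)

Section UnitOrbit.
Variable j : nat.
Hypothesis Hj : (1 <= j)%nat.
Let u t := Sg t (unitv j).

Lemma orbit_nle t : 0 <= t -> nle w (u t) (w j).
Proof. intros Ht. apply Sg_contr; auto. apply unitv_nle; auto. Qed.

Lemma orbit_pos t n : 0 <= t -> 0 <= u t n.
Proof.
  intros Ht. apply Sg_pos with (w j); auto; [apply unitv_nle; auto|apply unitv_pos].
Qed.

Lemma orbit_supp t n : 0 <= t -> (j < n)%nat -> u t n = 0.
Proof.
  intros Ht Hn. apply Sg_supp with (w j) j; auto; [apply unitv_nle; auto|apply unitv_pos|].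
  intros; now apply unitv_supp.
Qed.

Lemma orbit_Gr t : 0 <= t -> Gr (u t) (fragAB (u t)).
Proof.
  intros Ht. apply Gr_fin with j; [apply (orbit_nle t Ht)|]. intros; now apply orbit_supp.
Qed.

Lemma orbit_semigroup t s : 0 <= t -> 0 <= s -> u (t + s) = Sg t (u s).
Proof. intros Ht Hs. apply Sg_plus with (w j); auto. apply unitv_nle; auto. Qed.

(** Both sides are the image of [u (t + s)] under [G]: the left one because the orbit is finitely
    supported, the right one because [S(t)] commutes with [G]. *)
Lemma orbit_fragAB t s n : 0 <= t -> 0 <= s -> fragAB (u (t + s)) n = Sg t (fragAB (u s)) n.
Proof.
  intros Ht Hs. apply (Gr_unique (u (t + s))); [apply orbit_Gr; lra|].
  rewrite orbit_semigroup by auto. apply Gr_Sg; auto. now apply orbit_Gr.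
Qed.

Lemma orbit_functional_deriv c t : (forall n, (1 <= n)%nat -> Rabs (c n) <= w n) -> 0 <= t ->
  forall eps, 0 < eps -> exists d, 0 < d /\ forall h, 0 < h < d ->
    Rabs (sum1 j (fun n => c n * u (t + h) n) - sum1 j (fun n => c n * u t n)
          - h * sum1 j (fun n => c n * fragAB (u t) n)) <= eps * h.
Proof.
  intros Hc Ht eps He.
  destruct (Gr_right_expansion _ _ (orbit_Gr t Ht) eps He) as [d [Hd H]].
  exists d; split; auto. intros h Hh. specialize (H h Hh).
  rewrite <- orbit_semigroup in H by lra. rewrite (Rplus_comm t h).
  replace (sum1 j (fun n => c n * u (h + t) n) - sum1 j (fun n => c n * u t n)
          - h * sum1 j (fun n => c n * fragAB (u t) n)) with
    (sum1 j (fun n => c n * vsub (u (h + t)) (u t) n) - sum1 j (fun n => c n * vscal h (fragAB (u t)) n)).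
  - apply finite_functional_lip; auto.
  - rewrite <- sum1_scal, <- !sum1_minus. apply sum1_ext; intros i _. unfold vsub, vscal. ring.
Qed.

Lemma orbit_functional_cont c t : (forall n, (1 <= n)%nat -> Rabs (c n) <= w n) -> 0 <= t ->
  forall eps, 0 < eps -> exists d, 0 < d /\ forall s, 0 <= s -> Rabs (s - t) < d ->
    Rabs (sum1 j (fun n => c n * u s n) - sum1 j (fun n => c n * u t n)) <= eps.
Proof.
  intros Hc Ht eps He. destruct (Sg_cont (unitv j) (w j) (unitv_nle w j Hw Hj) t Ht eps He) as [d [Hd H]].
  exists d; split; auto. intros s Hs Hst. apply finite_functional_lip; auto. exact (H s Hs Hst).
Qed.

Lemma unitv_sum c : sum1 j (fun n => c n * unitv j n) = c j.
Proof.
  destruct j as [|i]; [lia|]. rewrite sum1_S, sum1_0.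
  - unfold unitv. rewrite Nat.eqb_refl. lra.
  - intros k Hk. unfold unitv. destruct (Nat.eqb_spec k (S i)); [lia|lra].
Qed.

Lemma orbit_0 : u 0 = unitv j.
Proof. apply (Sg_0 _ (w j)). now apply unitv_nle. Qed.

(** The last hypothesis puts [c] in the kernel of the adjoint, so the pairing with the orbit has
    derivative 0. A Dini derivative yields one inequality at a time, hence the two signs [sg]. The
    factor [a i] matters at [i = 1], where the inner sum is empty. *)
Lemma orbit_conserved c t : (forall n, (1 <= n)%nat -> Rabs (c n) <= w n) -> 0 <= t ->
  (forall i, (1 <= i)%nat -> a i * (sum1 (i - 1) (fun n => c n * b n i) - c i) = 0) ->
  sum1 j (fun n => c n * u t n) = c j.
Proof.
  intros Hc Ht Hz. rewrite <- (unitv_sum c), <- orbit_0.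
  assert (Hz' : forall s, 0 <= s -> sum1 j (fun n => c n * fragAB (u s) n) = 0).
  { intros s Hs. rewrite fragAB_weighted_sum by (intros; now apply orbit_supp).
    apply sum1_0. intros i Hi. specialize (Hz i ltac:(lia)).
    rewrite (Rmult_comm (a i)), Rmult_assoc, Hz. lra. }
  assert (Hle : forall sg, sg = 1 \/ sg = -1 ->
     sg * sum1 j (fun n => c n * u t n) <= sg * sum1 j (fun n => c n * u 0 n)).
  { intros sg Hsg.
    apply (dini_nonincreasing 0 t (fun s => sg * sum1 j (fun n => c n * u s n))); auto.
    - intros s Hs eps He. destruct (orbit_functional_cont c s Hc ltac:(lra) eps He) as [d [Hd H]].
      exists d; split; auto. intros r Hr Hsr. specialize (H r ltac:(lra)).
      rewrite Rabs_left1 in H by lra. specialize (H ltac:(lra)). apply Rabs_le_between in H.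
      destruct Hsg; subst sg; lra.
    - intros s Hs eps He. destruct (orbit_functional_deriv c s Hc ltac:(lra) eps He) as [d [Hd H]].
      exists d; split; auto. intros h Hh _. specialize (H h Hh). rewrite Hz' in H by lra.
      apply Rabs_le_between in H. destruct Hsg; subst sg; lra. }
  pose proof (Hle 1 ltac:(auto)). pose proof (Hle (-1) ltac:(auto)). lra.
Qed.

Hypothesis Hkappa1 : kappa < 1.
(** The [w]-norm of [A u(t)]: all terms are non-negative and those beyond [j] vanish. *)
Let P t := sum1 j (fun n => w n * (a n * u t n)).

Lemma frag_col_kappa i : (1 <= i)%nat -> sum1 (i - 1) (fun n => w n * b n i) <= kappa * w i.
Proof.
  intros Hi. destruct (Nat.eq_dec i 1) as [->|Hn]; [|apply Hwb; lia].
  simpl. pose proof (Hw 1%nat ltac:(lia)). nra.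
Qed.

Lemma orbit_absorption_pos t : 0 <= t -> 0 <= P t.
Proof.
  intros Ht. apply sum1_ge0. intros i Hi. pose proof (Hw i ltac:(lia)). pose proof (Ha i ltac:(lia)).
  pose proof (orbit_pos t i Ht). apply Rmult_le_pos; [lra|]. apply Rmult_le_pos; auto.
Qed.

Lemma orbit_dissipation t : 0 <= t -> sum1 j (fun n => w n * fragAB (u t) n) <= - (1 - kappa) * P t.
Proof.
  intros Ht. rewrite fragAB_weighted_sum by (intros; now apply orbit_supp).
  unfold P. rewrite <- sum1_scal. apply sum1_le; intros i Hi.
  pose proof (frag_col_kappa i ltac:(lia)). pose proof (Ha i ltac:(lia)).
  pose proof (orbit_pos t i Ht). pose proof (Rmult_le_pos _ _ H0 H1). nra.
Qed.

(** Since [B u >= 0], one has [|G u| <= G u + 2 a u] in each entry. The [w]-sum of [G u] is at most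
    [- (1 - kappa) * P t], and [2 - (1 - kappa) = 1 + kappa]. *)
Lemma orbit_fragAB_nle t : 0 <= t -> nle w (fragAB (u t)) ((1 + kappa) * P t).
Proof.
  intros Ht. set (f := u t).
  assert (Hz : forall n, (j < n)%nat -> f n = 0) by (intros; now apply orbit_supp).
  assert (Hp : forall n, 0 <= f n) by (intros; now apply orbit_pos).
  assert (HB : forall n, (1 <= n)%nat -> 0 <= fragB a b f n).
  { intros n Hn. rewrite (fragB_fin f j) by auto. apply sum1_ge0. intros i Hi.
    destruct (Nat.ltb_spec n i); [|lra]. apply Rmult_le_pos; auto. apply Rmult_le_pos; auto.
    - apply Ha; lia.
    - apply Hb; lia. }
  assert (HBz : forall n, (j < n)%nat -> fragB a b f n = 0).
  { intros n Hn. rewrite (fragB_fin f j) by (auto; lia). apply sum1_0. intros i Hi.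
    destruct (Nat.ltb_spec n i); [lia|auto]. }
  apply nle_weaken with (sum1 j (fun n => w n * Rabs (fragAB f n))).
  - apply nle_fin; auto.
    + unfold fragAB, vadd, fragA. assert (E : f 0%nat = 0) by apply (orbit_nle t Ht). rewrite E. simpl. lra.
    + intros n Hn. unfold fragAB, vadd, fragA. rewrite Hz, HBz by auto. lra.
  - apply Rle_trans with (sum1 j (fun n => w n * fragAB f n) + 2 * P t).
    + unfold P. rewrite <- sum1_scal, <- sum1_plus. apply sum1_le; intros n Hn.
      fold f. unfold fragAB, vadd, fragA. pose proof (HB n ltac:(lia)). pose proof (Hw n ltac:(lia)).
      pose proof (Rmult_le_pos _ _ (Ha n ltac:(lia)) (Hp n)).
      assert (Rabs (- (a n * f n) + fragB a b f n) <= a n * f n + fragB a b f n) by (apply Rabs_le; lra).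
      nra.
    + pose proof (orbit_dissipation t Ht). fold f in H. lra.
Qed.

(** Dissipation bounds [(1 - kappa) * P t] by the norm of [G u(t) = S(t - s) G u(s)], contractivity
    moves this to time [s], and [orbit_fragAB_nle] returns to [P s]. *)
Lemma orbit_absorption_decay s t : 0 <= s <= t -> (1 - kappa) * P t <= (1 + kappa) * P s.
Proof.
  intros Hst. pose proof (orbit_dissipation t ltac:(lra)).
  assert (HN : nle w (fragAB (u t)) ((1 + kappa) * P s)).
  { apply nle_ext with (Sg (t - s) (fragAB (u s))); auto.
    - apply Sg_contr; [lra|]. apply orbit_fragAB_nle; lra.
    - intros n. rewrite <- orbit_fragAB by lra. f_equal. f_equal. f_equal. lra. }
  destruct HN as [_ HN]. specialize (HN j).
  assert (- sum1 j (fun n => w n * fragAB (u t) n) <= sum1 j (fun n => w n * Rabs (fragAB (u t) n))); [|lra].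
  rewrite <- (Rmult_1_l (sum1 j _)), Ropp_mult_distr_l, <- sum1_scal. apply sum1_le; intros n Hn.
  pose proof (Hw n ltac:(lia)). pose proof (Rle_abs (- fragAB (u t) n)). rewrite Rabs_Ropp in H1. nra.
Qed.

(* [(sum w u)' <= - (1 - kappa) P], and [P] is bounded below on [0, t] by a multiple of [P t]. *)
Lemma orbit_smoothing t : 0 < t -> t * ((1 - kappa) ^ 2 / (1 + kappa)) * P t <= w j.
Proof.
  intros Ht. set (m := (1 - kappa) ^ 2 / (1 + kappa) * P t).
  assert (Hc : forall n, (1 <= n)%nat -> Rabs (w n) <= w n).
  { intros n Hn. rewrite Rabs_pos_eq; [lra|left; auto]. }
  pose proof (dini_nonincreasing 0 t (fun s => sum1 j (fun n => w n * u s n) + m * s)) as D.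
  simpl in D. rewrite orbit_0, unitv_sum in D.
  assert (0 <= sum1 j (fun n => w n * u t n)).
  { apply sum1_ge0. intros i Hi. apply Rmult_le_pos; [left; apply Hw; lia|apply orbit_pos; lra]. }
  assert (Hm : 0 <= m).
  { unfold m. apply Rmult_le_pos; [|apply orbit_absorption_pos; lra].
    left; apply Rdiv_lt_0_compat; [apply pow_lt; lra|lra]. }
  assert (sum1 j (fun n => w n * u t n) + m * t <= w j + m * 0); [|unfold m in *; lra].
  apply D; [lra| |].
  - intros s Hs eps He. destruct (orbit_functional_cont w s Hc ltac:(lra) (eps / 2) ltac:(lra)) as [d [Hd H1]].
    assert (Hd' : 0 < eps / (2 * (1 + m))) by (apply Rdiv_lt_0_compat; lra).
    exists (Rmin d (eps / (2 * (1 + m)))). split; [apply Rmin_pos; auto|]. intros r Hr Hsr.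
    pose proof (Rmin_l d (eps / (2 * (1 + m)))). pose proof (Rmin_r d (eps / (2 * (1 + m)))).
    specialize (H1 r ltac:(lra)).
    rewrite Rabs_left1 in H1 by lra. specialize (H1 ltac:(lra)). apply Rabs_le_between in H1.
    assert ((1 + m) * (s - r) <= eps / 2).
    { apply Rle_trans with ((1 + m) * (eps / (2 * (1 + m)))); [apply Rmult_le_compat_l; lra|].
      right; field; lra. }
    lra.
  - intros s Hs eps He. destruct (orbit_functional_deriv w s Hc ltac:(lra) eps He) as [d [Hd H1]].
    exists d; split; auto. intros h Hh _. specialize (H1 h Hh).
    apply Rabs_le_between in H1.
    pose proof (orbit_dissipation s ltac:(lra)) as H2.
    pose proof (orbit_absorption_decay s t ltac:(lra)) as H3.
    assert (m <= (1 - kappa) * P s).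
    { unfold m. replace ((1 - kappa) ^ 2 / (1 + kappa) * P t)
        with ((1 - kappa) / (1 + kappa) * ((1 - kappa) * P t)) by (field; lra).
      apply Rle_trans with ((1 - kappa) / (1 + kappa) * ((1 + kappa) * P s)).
      - apply Rmult_le_compat_l; auto. apply Rmult_le_pos; [lra|]. left; apply Rinv_0_lt_compat; lra.
      - right; field; lra. }
    assert (h * sum1 j (fun n => w n * fragAB (u s) n) <= h * (- m)) by (apply Rmult_le_compat_l; lra).
    lra.
Qed.

(** The first bound compares with time 0, where [P 0 = a j * w j]; the second is [orbit_smoothing].
    The larger constant of the second serves for both. *)
Lemma orbit_absorption_bounds t : 0 <= t ->
  P t <= (1 + kappa) / (1 - kappa) ^ 2 * (a j * w j) /\ t * P t <= (1 + kappa) / (1 - kappa) ^ 2 * w j.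
Proof.
  intros Ht. assert (Hq : 0 < (1 + kappa) / (1 - kappa) ^ 2).
  { apply Rdiv_lt_0_compat; [lra|apply pow_lt; lra]. }
  pose proof (Ha j Hj). pose proof (Hw j Hj). split.
  - pose proof (orbit_absorption_decay 0 t ltac:(lra)) as H1.
    assert (E : P 0 = a j * w j).
    { unfold P. rewrite orbit_0, (sum1_ext j _ (fun n => (a n * w n) * unitv j n)) by (intros; ring).
      apply (unitv_sum (fun n => a n * w n)). }
    rewrite E in H1. pose proof (Rmult_le_pos _ _ H (Rlt_le _ _ H0)).
    apply Rmult_le_reg_l with (1 - kappa); [lra|].
    replace ((1 - kappa) * ((1 + kappa) / (1 - kappa) ^ 2 * (a j * w j)))
      with ((1 + kappa) * (a j * w j) / (1 - kappa)) by (field; lra).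
    apply Rle_trans with ((1 + kappa) * (a j * w j)); auto.
    apply Rmult_le_reg_r with (1 - kappa); [lra|].
    replace ((1 + kappa) * (a j * w j) / (1 - kappa) * (1 - kappa)) with ((1 + kappa) * (a j * w j)) by (field; lra).
    assert (0 <= (1 + kappa) * (a j * w j)) by (apply Rmult_le_pos; lra). nra.
  - destruct (Req_dec t 0) as [->|Hn]; [nra|].
    pose proof (orbit_smoothing t ltac:(lra)) as H1.
    apply Rle_trans with ((1 + kappa) / (1 - kappa) ^ 2 * (t * ((1 - kappa) ^ 2 / (1 + kappa)) * P t)).
    + right; field; lra.
    + apply Rmult_le_compat_l; lra.
Qed.

(** Split at [x = mu]: the power of [x / mu] is at most 1 or at most [x / mu]. The free scale [mu]
    trades the weight [w] against [a w]; it will be [1 + a j] for boundedness on [l^1_wt] and [/ t]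
    for smoothing. *)
Lemma Rpower_interpolation x mu alpha : 0 < x -> 0 < mu -> 0 <= alpha <= 1 ->
  Rpower x alpha <= Rpower mu alpha * (1 + x / mu).
Proof.
  intros Hx Hmu Hal.
  assert (Hq : 0 < x / mu) by (apply Rdiv_lt_0_compat; auto).
  replace x with (mu * (x / mu)) at 1 by (field; lra).
  rewrite <- Rpower_mult_distr by auto.
  apply Rmult_le_compat_l; [left; apply exp_pos|].
  destruct (Rle_lt_dec (x / mu) 1) as [H|H].
  - apply Rle_trans with (Rpower 1 alpha); [apply Rle_Rpower_l; lra|].
    unfold Rpower. rewrite ln_1, Rmult_0_r, exp_0. lra.
  - apply Rle_trans with (Rpower (x / mu) 1); [apply Rle_Rpower; lra|]. rewrite Rpower_1; lra.
Qed.

Lemma orbit_wtilde_nle alpha mu t : 0 <= alpha <= 1 -> 0 < mu -> 0 <= t ->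
  nle (wtilde a w alpha) (u t) (Rpower mu alpha * ((1 + / mu) * w j + / mu * P t)).
Proof.
  intros Hal Hmu Ht. pose proof (orbit_nle t Ht) as [H0 HN].
  assert (Hwt : wpos (wtilde a w alpha)).
  { intros n Hn. apply Rmult_lt_0_compat; [apply exp_pos|apply Hw; auto]. }
  apply nle_weaken with (sum1 j (fun n => wtilde a w alpha n * Rabs (u t n))).
  { apply nle_fin; auto. intros n Hn; now apply orbit_supp. }
  apply Rle_trans with (Rpower mu alpha * ((1 + / mu) * sum1 j (fun n => w n * Rabs (u t n)) + / mu * P t)).
  - unfold P. rewrite <- !sum1_scal, <- sum1_plus, <- sum1_scal. apply sum1_le; intros n Hn.
    pose proof (Ha n ltac:(lia)). pose proof (Hw n ltac:(lia)). pose proof (orbit_pos t n Ht).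
    rewrite Rabs_pos_eq by auto. unfold wtilde.
    pose proof (Rpower_interpolation (1 + a n) mu alpha ltac:(lra) Hmu Hal).
    apply Rle_trans with (Rpower mu alpha * (1 + (1 + a n) / mu) * (w n * u t n)).
    + rewrite Rmult_assoc. apply Rmult_le_compat_r; auto. apply Rmult_le_pos; lra.
    + right. field. lra.
  - apply Rmult_le_compat_l; [left; apply exp_pos|]. apply Rplus_le_compat_r, Rmult_le_compat_l; auto.
    assert (0 < / mu) by (apply Rinv_0_lt_compat; auto). lra.
Qed.

End UnitOrbit.

(** * Bounds and strong continuity in the space weighted by [wt] *)

Section SmoothingSpace.
Variable alpha : R.
Hypothesis Halpha : 0 <= alpha < 1.
Hypothesis Hcase : (0 < kappa <= 1 /\ alpha = 0) \/ (0 < kappa < 1 /\ 0 < alpha < 1).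
Let wt := wtilde a w alpha.

Lemma wtilde_pos : wpos wt.
Proof. intros n Hn. apply Rmult_lt_0_compat; [apply exp_pos|apply Hw; auto]. Qed.

Lemma wtilde_ge n : (1 <= n)%nat -> w n <= wt n.
Proof.
  intros Hn. unfold wt, wtilde. pose proof (Hw n Hn). pose proof (Ha n Hn).
  assert (1 <= Rpower (1 + a n) alpha); [|nra].
  apply Rle_trans with (Rpower (1 + a n) 0); [rewrite Rpower_O; lra|apply Rle_Rpower; lra].
Qed.

Lemma nle_wtilde_w f M : nle wt f M -> nle w f M.
Proof. apply nle_mono_weight, wtilde_ge. Qed.

(** Origin of [2 + q]: for [mu = 1 + a j] and for [mu = / t] the factor [1 + / mu] is at most 2, in
    the second case because [t <= 1], and [/ mu * P t] is at most [q * w j] by the matching half of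
    [orbit_absorption_bounds]. For [alpha = 0] the two weights coincide and contractivity
    suffices. *)
Lemma Sg_wtilde_bounds : exists C, 1 <= C /\
  (forall f M t, 0 <= t -> nle wt f M -> nle wt (Sg t f) (C * M)) /\
  (forall f M t, 0 < t <= 1 -> nle w f M -> nle wt (Sg t f) (C * Rpower t (- alpha) * M)).
Proof.
  destruct Hcase as [[_ E]|[Hk _]].
  - exists 1. split; [lra|].
    assert (Ew : forall n, wt n = w n).
    { intros n. unfold wt, wtilde, Rpower. rewrite E, Rmult_0_l, exp_0. lra. }
    assert (Hle : forall f M, nle w f M -> nle wt f M).
    { intros f M. apply nle_mono_weight. intros; rewrite Ew; lra. }
    split.
    + intros f M t Ht Hf. rewrite Rmult_1_l. apply Hle, Sg_contr; auto. now apply nle_wtilde_w.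
    + intros f M t Ht Hf. replace (1 * Rpower t (- alpha) * M) with M.
      * apply Hle, Sg_contr; auto; lra.
      * unfold Rpower. rewrite E, Ropp_0, Rmult_0_l, exp_0. lra.
  - set (q := (1 + kappa) / (1 - kappa) ^ 2).
    assert (Hq : 0 < q) by (apply Rdiv_lt_0_compat; [lra|apply pow_lt; lra]).
    exists (2 + q). split; [lra|]. split.
    + intros f M t Ht Hf.
      apply Sg_superposition with (fun j => (2 + q) * wt j) M; auto; [apply wtilde_pos| |now apply nle_wtilde_w|].
      2: apply nle_scal_weight; auto; lra.
      intros j Hj. pose proof (Ha j Hj). pose proof (Hw j Hj).
      eapply nle_weaken; [apply (orbit_wtilde_nle j Hj alpha (1 + a j)); lra|].
      destruct (orbit_absorption_bounds j Hj ltac:(lra) t Ht) as [HP _]. fold q in HP.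
      unfold wt, wtilde. rewrite <- Rmult_assoc, (Rmult_comm (2 + q)), Rmult_assoc.
      apply Rmult_le_compat_l; [left; apply exp_pos|].
      assert (Hi : 0 < / (1 + a j) <= 1).
      { split; [apply Rinv_0_lt_compat; lra|].
        pose proof (Rinv_le_contravar 1 (1 + a j) ltac:(lra) ltac:(lra)) as Hi. rewrite Rinv_1 in Hi. lra. }
      assert (/ (1 + a j) * (a j * w j) <= w j).
      { apply Rmult_le_reg_l with (1 + a j); [lra|]. rewrite <- Rmult_assoc, Rinv_r by lra. nra. }
      set (p := sum1 j (fun n => w n * (a n * Sg t (unitv j) n))) in *.
      assert (/ (1 + a j) * p <= q * w j).
      { apply Rle_trans with (/ (1 + a j) * (q * (a j * w j))); [apply Rmult_le_compat_l; lra|]. nra. }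
      nra.
    + intros f M t Ht Hf.
      apply Sg_superposition with (fun j => ((2 + q) * Rpower t (- alpha)) * w j) M; auto; [apply wtilde_pos|lra| |].
      2: { apply nle_scal_weight; auto. apply Rmult_le_pos; [lra|left; apply exp_pos]. }
      intros j Hj. pose proof (Hw j Hj).
      assert (Hi : 0 < / t) by (apply Rinv_0_lt_compat; lra).
      eapply nle_weaken; [apply (orbit_wtilde_nle j Hj alpha (/ t)); lra|].
      destruct (orbit_absorption_bounds j Hj ltac:(lra) t ltac:(lra)) as [_ HP]. fold q in HP.
      replace (Rpower (/ t) alpha) with (Rpower t (- alpha)).
      2: { unfold Rpower. rewrite ln_Rinv by lra. f_equal. lra. }
      rewrite (Rmult_comm (2 + q)), Rmult_assoc.
      apply Rmult_le_compat_l; [left; apply exp_pos|]. rewrite Rinv_inv. nra.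
Qed.

(** On vectors supported up to [j] the [wt]-norm is at most [W] times the [w]-norm, so continuity in
    [l^1_w] is enough. *)
Lemma orbit_wtilde_cont j T0 : (1 <= j)%nat -> cont_on wt (fun t => Sg t (unitv j)) 0 T0.
Proof.
  intros Hj. destruct Sg_wtilde_bounds as [C [HC [HY _]]].
  pose proof wtilde_pos as Hwt. pose proof (unitv_nle w j Hw Hj) as Hu.
  split.
  - intros t Ht. exists (C * wt j). apply HY; [lra|]. now apply unitv_nle.
  - intros t Ht eps He. set (W := sum1 j (fun n => Rpower (1 + a n) alpha)).
    assert (HW : 0 <= W) by (apply sum1_ge0; intros; left; apply exp_pos).
    destruct (Sg_cont (unitv j) (w j) Hu t ltac:(lra) (eps / (1 + W))) as [d [Hd H]].
    { apply Rdiv_lt_0_compat; lra. }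
    exists d; split; auto. intros s Hs Hst. specialize (H s ltac:(lra) Hst).
    set (f := vsub (Sg s (unitv j)) (Sg t (unitv j))) in *.
    apply nle_weaken with (sum1 j (fun n => wt n * Rabs (f n))).
    + apply nle_fin; auto; [apply H|]. intros n Hn. unfold f, vsub.
      rewrite !orbit_supp by (auto; lra). lra.
    + apply Rle_trans with (W * sum1 j (fun n => w n * Rabs (f n))).
      * rewrite <- sum1_scal. apply sum1_le; intros n Hn. unfold wt, wtilde. rewrite Rmult_assoc.
        apply Rmult_le_compat_r; [apply Rmult_le_pos; [left; apply Hw; lia|apply Rabs_pos]|].
        apply (sum1_term j (fun n => Rpower (1 + a n) alpha)); [lia|]. intros; left; apply exp_pos.
      * destruct H as [_ H]. specialize (H j).
        assert (eps / (1 + W) * (1 + W) = eps) by (field; lra).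
        assert (0 < eps / (1 + W)) by (apply Rdiv_lt_0_compat; lra). nra.
Qed.

Lemma trunc_0_zero f n : f 0%nat = 0 -> trunc 0 f n = 0.
Proof. intros H. destruct n as [|n]; [now apply trunc_0|reflexivity]. Qed.

Lemma Sg_trunc_0 t f M n : 0 <= t -> nle w f M -> Sg t (trunc 0 f) n = 0.
Proof.
  intros Ht Hf. apply (nle_eq0 w Hw). apply Sg_contr; auto. apply nle_zero; [|lra].
  intros; apply trunc_0_zero, Hf.
Qed.

Lemma Sg_trunc_S t f M N : 0 <= t -> nle w f M ->
  Sg t (trunc (S N) f) = vadd (Sg t (trunc N f)) (vscal (f (S N)) (Sg t (unitv (S N)))).
Proof.
  intros Ht Hf. rewrite trunc_S, (Sg_lin t _ _ _ M (w (S N))); auto.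
  - apply nle_trunc; auto.
  - apply unitv_nle; auto; lia.
Qed.

(** Finite combinations of unit orbits are continuous, and the bound [C] makes their convergence
    uniform in [t]. *)
Lemma Sg_wtilde_cont f M T0 : nle wt f M -> cont_on wt (fun t => Sg t f) 0 T0.
Proof.
  intros Hf. pose proof wtilde_pos as Hwt. pose proof (nle_wtilde_w f M Hf) as Hfw.
  destruct Sg_wtilde_bounds as [C [HC [HY _]]].
  assert (Htr : forall N, cont_on wt (fun t => Sg t (trunc N f)) 0 T0).
  { induction N as [|N IH].
    - split.
      + intros t Ht. exists 0. apply nle_zero; [|lra]. intros; apply Sg_trunc_0 with M; auto; lra.
      + intros t Ht eps He. exists 1. split; [lra|]. intros s Hs _. apply nle_zero; [|lra].
        intros n; unfold vsub. rewrite !(Sg_trunc_0 _ f M) by (auto; lra). lra.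
    - apply cont_on_ext with (fun t => vadd (Sg t (trunc N f)) (vscal (f (S N)) (Sg t (unitv (S N))))); auto.
      + apply cont_on_add; auto. apply cont_on_scal; auto. apply orbit_wtilde_cont; lia.
      + intros t Ht n. now rewrite (Sg_trunc_S t f M) by (auto; lra). }
  apply cont_on_limit; auto.
  - intros t Ht. apply (Sg_contr f M t ltac:(lra) Hfw).
  - intros eps He. assert (He' : 0 < eps / C) by (apply Rdiv_lt_0_compat; lra).
    destruct (nle_tail wt Hwt f M (eps / C) Hf He') as [N HN].
    exists (fun t => Sg t (trunc N f)). split; auto. intros t Ht.
    rewrite <- (Sg_sub t f (trunc N f) M M); auto; [|lra|apply nle_trunc; auto].
    replace eps with (C * (eps / C)) by (field; lra). apply HY; [lra|]. apply HN; lia.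
Qed.

End SmoothingSpace.

(** * The first moment along the semigroup *)

Section Mass.
Hypothesis Hwn : forall n, (1 <= n)%nat -> INR n <= w n.

Lemma INR_weight n : (1 <= n)%nat -> 0 <= INR n <= w n.
Proof. intros Hn. split; [apply pos_INR|auto]. Qed.

Lemma phi1_ex f M : nle w f M -> ex_series (fun n => INR n * f n).
Proof.
  intros [H0 H]. apply ex_series_Rabs. apply (ex_series_bounded _ M).
  - rewrite H0, Rmult_0_r, Rabs_R0. auto.
  - intros; apply Rabs_pos.
  - intros N. eapply Rle_trans; [|apply (H N)]. apply sum1_le; intros i Hi.
    rewrite Rabs_mult, (Rabs_pos_eq (INR i)) by apply pos_INR.
    apply Rmult_le_compat_r; [apply Rabs_pos|apply Hwn; lia].
Qed.

Lemma phi1_sub f g M N : nle w f M -> nle w g N -> phi1 (vsub f g) = phi1 f - phi1 g.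
Proof.
  intros Hf Hg. unfold phi1. rewrite <- Series_minus by (eapply phi1_ex; eauto).
  apply Series_ext. intros n. unfold vsub. ring.
Qed.

Lemma phi1_lin c f g M N : nle w f M -> nle w g N -> phi1 (vadd f (vscal c g)) = phi1 f + c * phi1 g.
Proof.
  intros Hf Hg. unfold phi1. rewrite <- Series_scal_l.
  rewrite <- Series_plus; [|eapply phi1_ex; eauto|].
  - apply Series_ext. intros n. unfold vadd, vscal. ring.
  - apply ex_series_ext with (fun n => INR n * vscal c g n); [intros n; change (INR n * (c * g n) = c * (INR n * g n)); ring|].
    eapply phi1_ex, nle_scal; eauto.
Qed.

Lemma phi1_le f M : nle w f M -> Rabs (phi1 f) <= M.
Proof.
  intros Hf.
  assert (H : forall f, nle w f M -> phi1 f <= M).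
  { intros g Hg. change (Rbar_le (phi1 g) M).
    apply is_lim_seq_le with (fun N => sum1 N (fun n => INR n * g n)) (fun _ => M).
    - intros N. destruct Hg as [_ Hg]. eapply Rle_trans; [|apply (Hg N)]. apply sum1_le; intros i Hi.
      pose proof (INR_weight i ltac:(lia)). pose proof (Rle_abs (g i)). pose proof (Rabs_pos (g i)). nra.
    - apply sum1_lim_Series; [simpl; lra|]. eapply phi1_ex; eauto.
    - apply is_lim_seq_const. }
  apply Rabs_le. split; [|now apply H].
  assert (Hs : nle w (vsub (vsub f f) f) M).
  { apply nle_le_abs with f; auto.
    - unfold vsub. rewrite (proj1 Hf). lra.
    - intros n _. unfold vsub. replace (f n - f n - f n) with (- f n) by ring. rewrite Rabs_Ropp. lra. }
  pose proof (H _ Hs). rewrite (phi1_sub _ _ (M + M) M), (phi1_sub f f M M) in H0; auto; [lra|].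
  apply nle_sub; auto.
Qed.

Lemma phi1_lip f g M N D : nle w f M -> nle w g N -> nle w (vsub f g) D -> Rabs (phi1 f - phi1 g) <= D.
Proof. intros Hf Hg HD. rewrite <- (phi1_sub f g M N) by auto. now apply phi1_le. Qed.

(** On non-negative vectors the first moment is the half-norm with weight [INR], for which the
    hypothesis is the column condition. *)
Lemma Sg_phi1_le f M t :
  (forall j, (2 <= j)%nat -> sum1 (j - 1) (fun n => INR n * b n j) <= INR j) ->
  0 <= t -> nle w f M -> (forall n, 0 <= f n) -> phi1 (Sg t f) <= phi1 f.
Proof.
  intros Hm Ht Hf Hp.
  assert (E : forall g, (forall n, 0 <= g n) -> phi1 g = halfnorm INR g).
  { intros g Hg. apply Series_ext. intros n. rewrite Rmax_left; auto. }
  rewrite !E; auto; [|intros; apply Sg_pos with M; auto].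
  apply Sg_halfnorm_le with M; auto. apply INR_weight.
Qed.

(** On [e_j] the moment is a finite sum, preserved by [orbit_conserved] with [c = INR]. Linearity
    gives all truncations, and continuity of [phi1] on [l^1_w] the rest; [f] may have any sign. *)
Lemma Sg_phi1_eq f M t : a 1%nat = 0 ->
  (forall j, (2 <= j)%nat -> sum1 (j - 1) (fun n => INR n * b n j) = INR j) ->
  0 <= t -> nle w f M -> phi1 (Sg t f) = phi1 f.
Proof.
  intros Ha1 Hm Ht Hf.
  assert (Hunit : forall j, (1 <= j)%nat -> phi1 (Sg t (unitv j)) = INR j).
  { intros j Hj. unfold phi1.
    destruct (Series_finite (fun n => INR n * Sg t (unitv j) n) j) as [_ ->].
    - simpl; lra.
    - intros n Hn. rewrite orbit_supp by auto. lra.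
    - apply orbit_conserved; auto.
      + intros n Hn. rewrite Rabs_pos_eq; [auto|apply pos_INR].
      + intros i Hi. destruct (Nat.eq_dec i 1) as [->|Hn]; [rewrite Ha1; lra|].
        rewrite Hm by lia. lra. }
  assert (Htr : forall N, phi1 (Sg t (trunc N f)) = phi1 (trunc N f)).
  { induction N as [|N IH].
    - unfold phi1. rewrite !Series_zero; auto.
      + intros n. rewrite trunc_0_zero by apply Hf. lra.
      + intros n. rewrite (Sg_trunc_0 t f M) by auto. lra.
    - pose proof (nle_trunc w Hw N f M Hf). pose proof (unitv_nle w (S N) Hw ltac:(lia)).
      rewrite (Sg_trunc_S t f M), trunc_S by auto.
      rewrite (phi1_lin _ _ _ M (w (S N))) by (apply Sg_contr; auto).
      rewrite (phi1_lin _ _ _ M (w (S N))) by auto.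
      rewrite IH, Hunit by lia. f_equal. f_equal. unfold phi1.
      destruct (Series_finite (fun n => INR n * unitv (S N) n) (S N)) as [_ ->].
      + simpl; lra.
      + intros n Hn. rewrite unitv_supp by auto. lra.
      + rewrite (unitv_sum (S N) ltac:(lia) INR). reflexivity. }
  apply Rminus_diag_uniq. apply Rabs_eq_0. apply Rle_antisym; [|apply Rabs_pos].
  apply le_epsilon. intros eps He.
  destruct (nle_tail w Hw f M (eps / 2) Hf ltac:(lra)) as [N HN]. specialize (HN N (Nat.le_refl N)).
  pose proof (nle_trunc w Hw N f M Hf) as HT.
  assert (HD : nle w (vsub (Sg t f) (Sg t (trunc N f))) (eps / 2)).
  { rewrite <- (Sg_sub t f (trunc N f) M M) by auto. now apply Sg_contr. }
  pose proof (phi1_lip _ _ _ _ _ (Sg_contr _ _ t Ht Hf) (Sg_contr _ _ t Ht HT) HD) as H1.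
  pose proof (phi1_lip _ _ _ _ _ Hf HT HN) as H2. rewrite Htr in H1.
  replace (phi1 (Sg t f) - phi1 f) with
    ((phi1 (Sg t f) - phi1 (trunc N f)) - (phi1 f - phi1 (trunc N f))) by lra.
  eapply Rle_trans; [apply Rabs_triang|]. rewrite Rabs_Ropp. lra.
Qed.

End Mass.

End Fragmentation.

(** * Semilinear equations for a smoothing semigroup *)

(** [f] is controlled inside [[a, b]] only. Composing it with the clamp [c] onto that interval gives
    a function continuous on the whole line with the same integral. *)
Lemma ex_RInt_within f a b : a <= b ->
  (forall t, a <= t <= b -> forall eps, 0 < eps -> exists d, 0 < d /\
     forall s, a <= s <= b -> Rabs (s - t) < d -> Rabs (f s - f t) <= eps) ->
  ex_RInt f a b.
Proof.
  intros Hab H. set (c := fun x => Rmax a (Rmin b x)).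
  assert (Hcv : forall x, (x <= a /\ c x = a) \/ (a <= x <= b /\ c x = x) \/ (b <= x /\ c x = b)).
  { intros x. unfold c. destruct (Rle_lt_dec b x).
    - rewrite Rmin_left, Rmax_right by lra. lra.
    - rewrite Rmin_right by lra. destruct (Rle_lt_dec a x); [rewrite Rmax_right|rewrite Rmax_left]; lra. }
  assert (Hc : forall x, a <= c x <= b) by (intros x; destruct (Hcv x) as [H1|[H1|H1]]; lra).
  assert (Hcid : forall x, a <= x <= b -> c x = x) by (intros x; destruct (Hcv x) as [H1|[H1|H1]]; lra).
  assert (Hc1 : forall x y, Rabs (c x - c y) <= Rabs (x - y)).
  { intros x y. unfold Rabs. destruct (Hcv x) as [H1|[H1|H1]], (Hcv y) as [H2|[H2|H2]];
    destruct (Rcase_abs (c x - c y)), (Rcase_abs (x - y)); lra. }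
  apply ex_RInt_ext with (fun x => f (c x)).
  { intros x. rewrite Rmin_left, Rmax_right by lra. intros Hx. rewrite Hcid by lra. auto. }
  apply (ex_RInt_continuous (V := R_CompleteNormedModule)). intros z _.
  intros P [e HP]. destruct (H (c z) (Hc z) (e / 2)) as [d [Hd Hdd]].
  { pose proof (cond_pos e). lra. }
  exists (mkposreal d Hd). intros y Hy. apply HP.
  unfold ball in *; simpl in *; unfold AbsRing_ball, abs, minus, plus, opp in *; simpl in *.
  eapply Rle_lt_trans; [apply Hdd; [apply Hc|]|].
  - eapply Rle_lt_trans; [apply Hc1|exact Hy].
  - pose proof (cond_pos e). lra.
Qed.

Lemma is_RInt_sum1 N (G : nat -> R -> R) a b :
  (forall n, (1 <= n <= N)%nat -> ex_RInt (G n) a b) ->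
  is_RInt (fun s => sum1 N (fun n => G n s)) a b (sum1 N (fun n => RInt (G n) a b)).
Proof.
  induction N as [|N IH]; intros H.
  - simpl. pose proof (is_RInt_const (V := R_NormedModule) a b 0) as E.
    change (is_RInt (fun _ : R => 0) a b ((b - a) * 0)) in E. now rewrite Rmult_0_r in E.
  - simpl. apply @is_RInt_plus.
    + apply IH. intros; apply H; lia.
    + apply (RInt_correct (V := R_CompleteNormedModule)), H. lia.
Qed.

(** * Coordinatewise integrals of curves *)

Definition vint (g : R -> seqR) (a b : R) : seqR := fun n => RInt (fun s => g s n) a b.

Section Vint.
Variable v : seqR.
Hypothesis Hv : wpos v.

Lemma cont_on_ex_RInt g a b n : a <= b -> cont_on v g a b -> ex_RInt (fun s => g s n) a b.
Proof.
  intros Hab [H1 H2]. apply ex_RInt_within; auto. intros t Ht eps He. destruct n as [|n].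
  - exists 1. split; [lra|]. intros s Hs _. destruct (H1 s Hs) as [M [Es _]]. destruct (H1 t Ht) as [M' [Et _]].
    rewrite Es, Et, Rminus_diag, Rabs_R0. lra.
  - pose proof (Hv (S n) ltac:(lia)).
    destruct (H2 t Ht (eps * v (S n))) as [d [Hd Hdd]]; [apply Rmult_lt_0_compat; auto|].
    exists d; split; auto. intros s Hs Hst.
    pose proof (nle_coord v Hv _ _ (S n) (Hdd s Hs Hst) ltac:(lia)) as Hn. unfold vsub in Hn.
    replace (eps * v (S n) / v (S n)) with eps in Hn by (field; lra). exact Hn.
Qed.

Lemma vint_nle g a b m I : a <= b -> (forall n, ex_RInt (fun s => g s n) a b) ->
  (forall s, a < s < b -> nle v (g s) (m s)) -> is_RInt m a b I -> nle v (vint g a b) I.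
Proof.
  intros Hab Hex Hle HI. split.
  - unfold vint. rewrite (RInt_ext _ (fun _ => 0)).
    + rewrite RInt_const. unfold scal; simpl; unfold mult; simpl. lra.
    + intros s. rewrite Rmin_left, Rmax_right by lra. intros Hs. apply (Hle s Hs).
  (* Freezing the signs of the integrals makes the partial norm linear in [g], so it can be written
     as one integral before absolute values are taken. *)
  - intros N. set (sg := fun n => if Rle_dec 0 (vint g a b n) then 1 else -1).
    assert (Hsg : forall n, vint g a b n * sg n = Rabs (vint g a b n)).
    { intros n. unfold sg. destruct (Rle_dec 0 (vint g a b n)).
      - rewrite Rabs_pos_eq; lra.
      - rewrite Rabs_left; lra. }
    apply (is_RInt_le (fun s => sum1 N (fun n => (v n * sg n) * g s n)) m a b); auto.
    + rewrite (sum1_ext N _ (fun n => RInt (fun s => (v n * sg n) * g s n) a b)).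
      * apply (is_RInt_sum1 N (fun n s => (v n * sg n) * g s n)). intros n _.
        apply (ex_RInt_scal (V := R_CompleteNormedModule)), Hex.
      * intros n _. rewrite <- Hsg. unfold vint.
        rewrite (RInt_scal (V := R_CompleteNormedModule)) by apply Hex.
        unfold scal; simpl; unfold mult; simpl. lra.
    + intros s Hs. destruct (Hle s Hs) as [_ HN]. eapply Rle_trans; [|apply (HN N)].
      apply sum1_le; intros n Hn. pose proof (Hv n ltac:(lia)).
      rewrite Rmult_assoc. apply Rmult_le_compat_l; [lra|]. unfold sg.
      pose proof (Rle_abs (g s n)). pose proof (Rle_abs (- g s n)). rewrite Rabs_Ropp in *.
      destruct (Rle_dec 0 (vint g a b n)); lra.
Qed.

Lemma vint_bound g a b B : a <= b -> (forall n, ex_RInt (fun s => g s n) a b) ->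
  (forall s, a < s < b -> nle v (g s) B) -> nle v (vint g a b) (B * (b - a)).
Proof.
  intros Hab Hex Hle. apply (vint_nle g a b (fun _ => B)); auto.
  replace (B * (b - a)) with (scal (b - a) B) by (unfold scal; simpl; unfold mult; simpl; ring).
  apply @is_RInt_const.
Qed.

Lemma vint_sub f g a b n : ex_RInt (fun s => f s n) a b -> ex_RInt (fun s => g s n) a b ->
  vint f a b n - vint g a b n = vint (fun s => vsub (f s) (g s)) a b n.
Proof.
  intros Hf Hg. unfold vint, vsub.
  symmetry. apply (RInt_minus (V := R_CompleteNormedModule)); auto.
Qed.

Lemma vint_const f a b n : vint (fun _ => f) a b n = (b - a) * f n.
Proof. unfold vint. rewrite RInt_const. reflexivity. Qed.

Lemma vint_point g a n : vint g a a n = 0.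
Proof. apply (RInt_point (V := R_CompleteNormedModule)). Qed.

Lemma vint_Chasles g a c b n : ex_RInt (fun s => g s n) a c -> ex_RInt (fun s => g s n) c b ->
  vint g a c n + vint g c b n = vint g a b n.
Proof. intros H1 H2. apply (RInt_Chasles (V := R_CompleteNormedModule)); auto. Qed.

Lemma vint_ext f g a b n : a <= b -> (forall s, a < s < b -> f s n = g s n) -> vint f a b n = vint g a b n.
Proof.
  intros Hab H. apply RInt_ext. intros s. rewrite Rmin_left, Rmax_right by lra. auto.
Qed.

Lemma vint_shift g c a b n : ex_RInt (fun s => g s n) (a + c) (b + c) ->
  vint (fun s => g (s + c)) a b n = vint g (a + c) (b + c) n.
Proof.
  intros H. unfold vint.
  pose proof (RInt_comp_lin (V := R_CompleteNormedModule) (fun s => g s n) 1 c a b) as E.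
  rewrite !Rmult_1_l in E. rewrite <- E by auto. apply RInt_ext. intros x _.
  change (g (x + c) n = 1 * g (1 * x + c) n). now rewrite !Rmult_1_l.
Qed.

Lemma vint_average g a b eps : a <= b -> (forall n, ex_RInt (fun s => g s n) a b) ->
  (forall s, a < s < b -> nle v (vsub (g s) (g a)) eps) ->
  nle v (vsub (vint g a b) (vscal (b - a) (g a))) (eps * (b - a)).
Proof.
  intros Hab Hex H. apply nle_ext with (vint (fun s => vsub (g s) (g a)) a b); auto.
  - apply vint_bound; auto. intros n. apply (ex_RInt_minus (V := R_CompleteNormedModule)); auto.
    apply ex_RInt_const.
  - intros n. rewrite <- (vint_sub g (fun _ => g a)); auto; [|apply ex_RInt_const].
    rewrite vint_const. reflexivity.
Qed.

(* A bounded functional [L] passes under the integral: the difference of the two sides,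
   as a function of the upper limit, has derivative zero. *)
Lemma vint_functional (L : seqR -> R) K G a b : a <= b ->
  (forall f M, nle v f M -> Rabs (L f) <= K * M) ->
  (forall f g M N, nle v f M -> nle v g N -> L (vsub f g) = L f - L g) ->
  (forall c f M, nle v f M -> L (vscal c f) = c * L f) ->
  cont_on v G a b -> L (vint G a b) = RInt (fun s => L (G s)) a b.
Proof.
  intros Hab HK Hsub Hscal HG.
  destruct (cont_on_bounded v Hv G a b HG) as [B [HB HGB]].
  assert (HK0 : 0 <= K).
  { pose proof (HK (fun _ => 0) 1 ltac:(apply nle_zero; auto; lra)).
    pose proof (Rabs_pos (L (fun _ => 0))). lra. }
  assert (Hex : forall x y n, a <= x -> x <= y -> y <= b -> ex_RInt (fun s => G s n) x y).
  { intros x y n H1 H2 H3. apply cont_on_ex_RInt; auto. apply cont_on_sub with a b; auto. }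
  assert (HexL : forall x y, a <= x -> x <= y -> y <= b -> ex_RInt (fun s => L (G s)) x y).
  { intros x y H1 H2 H3. apply ex_RInt_within; auto. intros t Ht eps He. destruct HG as [_ HG].
    destruct (HG t ltac:(lra) (eps / (1 + K))) as [d [Hd Hdd]]; [apply Rdiv_lt_0_compat; lra|].
    exists d; split; auto. intros s Hs Hst.
    rewrite <- (Hsub _ _ B B) by (apply HGB; lra).
    eapply Rle_trans; [apply HK, Hdd; auto; lra|].
    assert (eps / (1 + K) * (1 + K) = eps) by (field; lra).
    assert (0 < eps / (1 + K)) by (apply Rdiv_lt_0_compat; lra). nra. }
  set (Psi := fun x => L (vint G a x) - RInt (fun s => L (G s)) a x).
  assert (Hinc : forall x y eps, a <= x -> x <= y -> y <= b ->
     (forall s, x <= s <= y -> nle v (vsub (G s) (G x)) eps) ->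
     Rabs (Psi y - Psi x) <= 2 * K * eps * (y - x)).
  { intros x y eps H1 H2 H3 H.
    assert (EL : L (vint G a y) - L (vint G a x) = L (vint G x y)).
    { rewrite <- (Hsub _ _ (B * (y - a)) (B * (x - a))).
      - f_equal. extensionality n. unfold vsub. rewrite <- (vint_Chasles G a x y n) by (apply Hex; lra). lra.
      - apply vint_bound; [lra|intros; apply Hex; lra|intros; apply HGB; lra].
      - apply vint_bound; [lra|intros; apply Hex; lra|intros; apply HGB; lra]. }
    assert (ER : RInt (fun s => L (G s)) a y - RInt (fun s => L (G s)) a x = RInt (fun s => L (G s)) x y).
    { rewrite <- (RInt_Chasles (V := R_CompleteNormedModule) _ a x y) by (apply HexL; lra).
      unfold plus; simpl. lra. }
    assert (A1 : Rabs (L (vint G x y) - (y - x) * L (G x)) <= K * (eps * (y - x))).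
    { rewrite <- (Hscal _ _ B) by (apply HGB; lra).
      rewrite <- (Hsub _ _ (B * (y - x)) (Rabs (y - x) * B)).
      - apply HK, vint_average; auto. intros; apply H; lra.
      - apply vint_bound; [lra|intros; apply Hex; lra|intros; apply HGB; lra].
      - apply nle_scal; auto. apply HGB; lra. }
    assert (A2 : Rabs (RInt (fun s => L (G s)) x y - (y - x) * L (G x)) <= K * eps * (y - x)).
    { replace ((y - x) * L (G x)) with (RInt (fun _ => L (G x)) x y) by (rewrite RInt_const; reflexivity).
      rewrite <- (RInt_minus (V := R_CompleteNormedModule)) by (try apply ex_RInt_const; apply HexL; lra).
      rewrite (Rmult_comm (K * eps)). apply (abs_RInt_le_const _ x y (K * eps)); auto.
      - apply (ex_RInt_minus (V := R_CompleteNormedModule)); [apply HexL; lra|apply ex_RInt_const].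
      - intros t Ht. unfold minus, plus, opp; simpl.
        change (Rabs (L (G t) - L (G x)) <= K * eps).
        rewrite <- (Hsub _ _ B B) by (apply HGB; lra). apply HK, H. lra. }
    unfold Psi. replace (L (vint G a y) - RInt (fun s => L (G s)) a y - (L (vint G a x) - RInt (fun s => L (G s)) a x))
      with ((L (vint G x y) - (y - x) * L (G x)) - (RInt (fun s => L (G s)) x y - (y - x) * L (G x))) by lra.
    eapply Rle_trans; [apply Rabs_triang|]. rewrite Rabs_Ropp. lra. }
  assert (HPa : Psi a = 0).
  { unfold Psi. rewrite RInt_point. change (L (vint G a a) - 0 = 0).
    replace (vint G a a) with (vscal 0 (G a)).
    - rewrite (Hscal _ _ B) by (apply HGB; lra). lra.
    - extensionality n. rewrite vint_point. unfold vscal. lra. }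
  assert (Hsmall : forall eps, 0 < eps -> exists d, 0 < d /\ forall x y, a <= x -> x <= y -> y <= b ->
     y - x < d -> Rabs (Psi y - Psi x) <= eps * (y - x)).
  { intros eps He. destruct (cont_on_unif v Hv G a b HG (eps / (2 * (1 + K)))) as [d [Hd H]].
    { apply Rdiv_lt_0_compat; lra. }
    exists d; split; auto. intros x y H1 H2 H3 H4.
    eapply Rle_trans; [apply (Hinc x y (eps / (2 * (1 + K)))); auto|].
    - intros s Hs. apply H; try lra. rewrite Rabs_pos_eq; lra.
    - apply Rmult_le_compat_r; [lra|].
      replace (2 * K * (eps / (2 * (1 + K)))) with (eps * (K / (1 + K))) by (field; lra).
      rewrite <- (Rmult_1_r eps) at 2. apply Rmult_le_compat_l; [lra|].
      apply Rmult_le_reg_r with (1 + K); [lra|]. field_simplify; lra. }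
  assert (Hdini : forall c, Rabs c = 1 -> c * Psi b <= c * Psi a).
  { intros c Hc. apply (dini_nonincreasing a b (fun x => c * Psi x)); auto.
    - intros t Ht eps He. destruct (Hsmall 1 ltac:(lra)) as [d [Hd H]].
      exists (Rmin d eps). split; [apply Rmin_pos; auto|]. intros s Hs Hst.
      pose proof (Rmin_l d eps). pose proof (Rmin_r d eps).
      specialize (H s t ltac:(lra) ltac:(lra) ltac:(lra) ltac:(lra)).
      pose proof (Rle_abs (c * (Psi t - Psi s))). rewrite Rabs_mult, Hc in H2. lra.
    - intros t Ht eps He. destruct (Hsmall eps He) as [d [Hd H]]. exists d; split; auto.
      intros h Hh Hth. specialize (H t (t + h) ltac:(lra) ltac:(lra) ltac:(lra) ltac:(lra)).
      pose proof (Rle_abs (c * (Psi (t + h) - Psi t))). rewrite Rabs_mult, Hc in H0. lra. }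
  pose proof (Hdini 1 ltac:(rewrite Rabs_pos_eq; lra)). pose proof (Hdini (-1) ltac:(rewrite Rabs_left; lra)).
  rewrite HPa in *. assert (Psi b = 0) by lra. unfold Psi in H1. lra.
Qed.

End Vint.

(** What the construction of solutions draws from fragmentation. The smoothing bound is restricted
    to [t <= 1], which is why local steps are kept to length at most 1; one constant [C] serves for
    it and for boundedness on [l^1_wt]. *)
Record smoothing_semigroup (w wt : seqR) (Sg : R -> seqR -> seqR) (alpha C : R) : Prop := {
  sg_w : wpos w;
  sg_wt : forall n, (1 <= n)%nat -> w n <= wt n;
  sg_alpha : 0 <= alpha < 1;
  sg_C : 1 <= C;
  sg_lin : forall t c f g M N, 0 <= t -> nle w f M -> nle w g N ->
    Sg t (vadd f (vscal c g)) = vadd (Sg t f) (vscal c (Sg t g));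
  sg_0 : forall f M, nle w f M -> Sg 0 f = f;
  sg_plus : forall t s f M, 0 <= t -> 0 <= s -> nle w f M -> Sg (t + s) f = Sg t (Sg s f);
  sg_cont : forall f M, nle w f M -> forall t, 0 <= t -> forall eps, 0 < eps ->
    exists d, 0 < d /\ forall s, 0 <= s -> Rabs (s - t) < d -> nle w (vsub (Sg s f) (Sg t f)) eps;
  sg_contr : forall f M t, 0 <= t -> nle w f M -> nle w (Sg t f) M;
  sg_bound_wt : forall f M t, 0 <= t -> nle wt f M -> nle wt (Sg t f) (C * M);
  sg_smooth : forall f M t, 0 < t <= 1 -> nle w f M -> nle wt (Sg t f) (C * Rpower t (- alpha) * M);
  sg_cont_wt : forall f M T0, nle wt f M -> cont_on wt (fun t => Sg t f) 0 T0 }.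

Arguments sg_w {w wt Sg alpha C} _.
Arguments sg_wt {w wt Sg alpha C} _.
Arguments sg_alpha {w wt Sg alpha C} _.
Arguments sg_C {w wt Sg alpha C} _.
Arguments sg_lin {w wt Sg alpha C} _.
Arguments sg_0 {w wt Sg alpha C} _.
Arguments sg_plus {w wt Sg alpha C} _.
Arguments sg_cont {w wt Sg alpha C} _.
Arguments sg_contr {w wt Sg alpha C} _.
Arguments sg_bound_wt {w wt Sg alpha C} _.
Arguments sg_smooth {w wt Sg alpha C} _.
Arguments sg_cont_wt {w wt Sg alpha C} _.

Section Semilinear.
Variables (w wt : seqR) (Sg : R -> seqR -> seqR) (alpha C : R).
Hypothesis HSG : smoothing_semigroup w wt Sg alpha C.

Let Hw : wpos w := sg_w HSG.
Let HC : 1 <= C := sg_C HSG.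
Let Hal : 0 <= alpha < 1 := sg_alpha HSG.

Lemma wt_pos : wpos wt.
Proof. intros n Hn. pose proof (sg_wt HSG n Hn). pose proof (Hw n Hn). lra. Qed.
Let Hwt : wpos wt := wt_pos.

Lemma nle_wt_w f M : nle wt f M -> nle w f M.
Proof. apply nle_mono_weight, (sg_wt HSG). Qed.

Lemma cont_on_wt_w u a b : cont_on wt u a b -> cont_on w u a b.
Proof.
  intros [H1 H2]. split.
  - intros t Ht. destruct (H1 t Ht) as [M HM]. exists M. now apply nle_wt_w.
  - intros t Ht eps He. destruct (H2 t Ht eps He) as [d [Hd H]]. exists d; split; auto.
    intros; now apply nle_wt_w, H.
Qed.

Lemma S_sub t f g M N : 0 <= t -> nle w f M -> nle w g N -> Sg t (vsub f g) = vsub (Sg t f) (Sg t g).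
Proof. intros Ht Hf Hg. rewrite !vsub_alt. eapply (sg_lin HSG); eauto. Qed.

Lemma S_scal t c f M : 0 <= t -> nle w f M -> Sg t (vscal c f) = vscal c (Sg t f).
Proof.
  intros Ht Hf. assert (Hz : nle w (vsub f f) 0) by (apply nle_sub_refl; lra).
  pose proof (sg_lin HSG t c (vsub f f) f 0 M Ht Hz Hf) as E.
  rewrite (S_sub t f f M M) in E by auto.
  replace (vadd (vsub f f) (vscal c f)) with (vscal c f) in E.
  - rewrite E. extensionality n. unfold vadd, vsub, vscal. lra.
  - extensionality n. unfold vadd, vsub, vscal. lra.
Qed.

(* Antiderivative of [h ^ - alpha], vanishing at [0+]; the value at [0] is junk, as [Rpower 0 x = 1]. *)
Definition theta (h : R) : R := Rpower h (1 - alpha) / (1 - alpha).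

Lemma theta_pos h : 0 < theta h.
Proof. apply Rdiv_lt_0_compat; [apply exp_pos|lra]. Qed.

Lemma theta_mono h h' : 0 < h <= h' -> theta h <= theta h'.
Proof.
  intros H. apply Rmult_le_compat_r; [left; apply Rinv_0_lt_compat; lra|]. apply Rle_Rpower_l; lra.
Qed.

Lemma theta_small eps : 0 < eps -> exists d, 0 < d <= 1 /\ forall h, 0 < h <= d -> theta h <= eps.
Proof.
  intros He. set (d0 := Rpower (eps * (1 - alpha)) (/ (1 - alpha))).
  assert (Hp : 0 < eps * (1 - alpha)) by (apply Rmult_lt_0_compat; lra).
  assert (E : theta d0 = eps).
  { unfold theta, d0. rewrite Rpower_mult, Rinv_l, Rpower_1 by lra. field. lra. }
  exists (Rmin 1 d0). pose proof (Rmin_l 1 d0). pose proof (Rmin_r 1 d0).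
  split; [split; auto; apply Rmin_pos; [lra|apply exp_pos]|].
  intros h Hh. rewrite <- E. apply theta_mono. lra.
Qed.

Lemma theta_is_RInt x y c K : x < y < c ->
  is_RInt (fun s => K * Rpower (c - s) (- alpha)) x y (K * (theta (c - x) - theta (c - y))).
Proof.
  intros Hxy.
  replace (K * (theta (c - x) - theta (c - y)))
    with (minus ((fun s => - K * theta (c - s)) y) ((fun s => - K * theta (c - s)) x)).
  2: { unfold minus, plus, opp; simpl. ring. }
  apply (is_RInt_derive (fun s => - K * theta (c - s)) (fun s => K * Rpower (c - s) (- alpha))).
  - intros s. rewrite Rmin_left, Rmax_right by lra. intros Hs. unfold theta, Rpower.
    auto_derive; [lra|].
    change (c + - s) with (c - s).
    replace (- alpha * ln (c - s)) with ((1 - alpha) * ln (c - s) + - ln (c - s)) by ring.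
    rewrite exp_plus, exp_Ropp, exp_ln by lra. field. lra.
  - intros s. rewrite Rmin_left, Rmax_right by lra. intros Hs.
    apply (ex_derive_continuous (fun s => K * Rpower (c - s) (- alpha))).
    unfold Rpower. auto_derive. lra.
Qed.

Lemma cont_on_S rho g a b :
  (forall s, a <= s <= b -> 0 <= rho s) ->
  (forall s s', Rabs (rho s - rho s') <= Rabs (s - s')) ->
  cont_on w g a b -> cont_on w (fun s => Sg (rho s) (g s)) a b.
Proof.
  intros Hr Hl [H1 H2]. split.
  - intros s Hs. destruct (H1 s Hs) as [M HM]. exists M. apply (sg_contr HSG); auto.
  - intros t Ht eps He. destruct (H2 t Ht (eps / 2) ltac:(lra)) as [d [Hd H]].
    destruct (H1 t Ht) as [M HM].
    destruct (sg_cont HSG (g t) M HM (rho t) (Hr t Ht) (eps / 2) ltac:(lra)) as [d' [Hd' H']].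
    exists (Rmin d d'). split; [apply Rmin_pos; auto|]. intros s Hs Hst.
    pose proof (Rmin_l d d'). pose proof (Rmin_r d d').
    replace eps with (eps / 2 + eps / 2) by lra.
    apply nle_tri with (Sg (rho s) (g t)); auto.
    + destruct (H1 s Hs) as [Ms HMs]. rewrite <- (S_sub _ _ _ Ms M) by auto.
      apply (sg_contr HSG); auto. apply H; auto; lra.
    + apply H'; auto. eapply Rle_lt_trans; [apply Hl|lra].
Qed.

Lemma cont_on_S_back t g a b : b <= t -> cont_on w g a b -> cont_on w (fun s => Sg (t - s) (g s)) a b.
Proof.
  intros Hb Hg. apply (cont_on_S (fun s => t - s)); auto.
  - intros; lra.
  - intros s s'. rewrite <- Rabs_Ropp. right. f_equal. lra.
Qed.

Lemma conv_ex_RInt t g a b n : a <= b <= t -> cont_on w g a b -> ex_RInt (fun s => Sg (t - s) (g s) n) a b.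
Proof.
  intros Hb Hg. apply (cont_on_ex_RInt w Hw (fun s => Sg (t - s) (g s))); [lra|].
  apply cont_on_S_back; auto; lra.
Qed.

(** Up to [b - eta] the smoothing bound integrates to a difference of values of [theta]; the
    remaining piece has [w]-norm at most [B * eta], and [nle_closed] lets [eta] tend to 0. When
    [b < t], the singularity of the bound is moved from [t] to [b], which only enlarges it and
    leaves an estimate in terms of [b - a]. *)
Lemma conv_smoothing t g a b B : 0 <= a < b -> b <= t -> t - a <= 1 -> cont_on w g a b ->
  (forall s, a <= s <= b -> nle w (g s) B) ->
  nle wt (vint (fun s => Sg (t - s) (g s)) a b) (C * B * theta (b - a)).
Proof.
  intros Hab Hbt Hta Hg HB.
  assert (HB0 : 0 <= B) by (apply (nle_nonneg w (g a)); apply HB; lra).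
  assert (HS0 : nle w (vint (fun s => Sg (t - s) (g s)) a b) (B * (b - a))).
  { apply vint_bound; auto; [lra|intros; apply conv_ex_RInt; auto; lra|].
    intros s Hs. apply (sg_contr HSG); [lra|]. apply HB; lra. }
  apply nle_closed; auto; [apply HS0|]. intros N eps He.
  set (m := sum1 N (fun n => / w n)).
  assert (Hm : 0 <= m) by (apply sum1_ge0; intros; left; apply Rinv_0_lt_compat, Hw; lia).
  set (eta := Rmin ((b - a) / 2) (eps / (1 + B * m))).
  assert (HBm : 0 <= B * m) by (apply Rmult_le_pos; auto).
  assert (Heta : 0 < eta).
  { apply Rmin_pos; [lra|]. apply Rdiv_lt_0_compat; lra. }
  pose proof (Rmin_l ((b - a) / 2) (eps / (1 + B * m))) as He1. fold eta in He1.
  pose proof (Rmin_r ((b - a) / 2) (eps / (1 + B * m))) as He2. fold eta in He2.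
  exists (vint (fun s => Sg (t - s) (g s)) a (b - eta)). split.
  - apply nle_weaken with (C * B * theta (b - a)); [|lra].
    apply nle_weaken with (C * B * (theta (b - a) - theta (b - (b - eta)))).
    2: { apply Rmult_le_compat_l; [apply Rmult_le_pos; lra|]. pose proof (theta_pos (b - (b - eta))). lra. }
    apply (vint_nle wt Hwt _ a (b - eta) (fun s => C * B * Rpower (b - s) (- alpha))).
    + lra.
    + intros n. apply conv_ex_RInt; [lra|]. apply cont_on_sub with a b; auto; lra.
    + intros s Hs. apply nle_weaken with (C * Rpower (t - s) (- alpha) * B).
      * apply (sg_smooth HSG); [lra|]. apply HB; lra.
      * assert (Rpower (t - s) (- alpha) <= Rpower (b - s) (- alpha)).
        { rewrite !Rpower_Ropp. apply Rinv_le_contravar; [apply exp_pos|]. apply Rle_Rpower_l; lra. }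
        assert (0 <= C * B) by (apply Rmult_le_pos; lra). nra.
    + apply theta_is_RInt. lra.
  - intros n Hn. rewrite <- (vint_Chasles _ a (b - eta) b n).
    2: { apply conv_ex_RInt; [lra|]. apply cont_on_sub with a b; auto; lra. }
    2: { apply conv_ex_RInt; [lra|]. apply cont_on_sub with a b; auto; lra. }
    assert (HT : nle w (vint (fun s => Sg (t - s) (g s)) (b - eta) b) (B * (b - (b - eta)))).
    { apply vint_bound; auto; [lra| |].
      - intros k. apply conv_ex_RInt; [lra|]. apply cont_on_sub with a b; auto; lra.
      - intros s Hs. apply (sg_contr HSG); [lra|]. apply HB; lra. }
    pose proof (nle_coord w Hw _ _ n HT ltac:(lia)) as Hc.
    match goal with |- Rabs (?p - (?p + ?q)) <= _ => replace (p - (p + q)) with (- q) by lra end.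
    rewrite Rabs_Ropp. eapply Rle_trans; [apply Hc|].
    assert (Hi : / w n <= m).
    { apply (sum1_term N (fun i => / w i)); [lia|]. intros; left; apply Rinv_0_lt_compat, Hw; lia. }
    replace (B * (b - (b - eta)) / w n) with (eta * (B * / w n)) by (unfold Rdiv; ring).
    apply Rle_trans with (eta * (1 + B * m)).
    + apply Rmult_le_compat_l; [lra|]. assert (B * / w n <= B * m) by (apply Rmult_le_compat_l; auto). lra.
    + apply Rle_trans with (eps / (1 + B * m) * (1 + B * m)); [apply Rmult_le_compat_r; lra|].
      right; field; lra.
Qed.

(** * The variation-of-constants integral *)

Definition conv (g : R -> seqR) (t : R) : seqR := vint (fun s => Sg (t - s) (g s)) 0 t.

Lemma conv_0 g n : conv g 0 n = 0.
Proof. apply vint_point. Qed.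

Lemma conv_nle_w g t B : 0 <= t -> cont_on w g 0 t -> (forall s, 0 <= s <= t -> nle w (g s) B) ->
  nle w (conv g t) (B * t).
Proof.
  intros Ht Hg HB. replace (B * t) with (B * (t - 0)) by ring. apply vint_bound; auto.
  - intros; apply conv_ex_RInt; auto; lra.
  - intros s Hs. apply (sg_contr HSG); [lra|]. apply HB; lra.
Qed.

Lemma conv_nle g t d B : 0 <= t <= d -> 0 < d <= 1 -> cont_on w g 0 t ->
  (forall s, 0 <= s <= t -> nle w (g s) B) -> nle wt (conv g t) (C * B * theta d).
Proof.
  intros Ht Hd Hg HB. assert (HB0 : 0 <= B) by (apply (nle_nonneg w (g 0)); apply HB; lra).
  destruct (Req_dec t 0) as [->|Hn].
  - apply nle_zero; [intros; apply conv_0|]. pose proof (theta_pos d).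
    apply Rmult_le_pos; [apply Rmult_le_pos|]; lra.
  - apply nle_weaken with (C * B * theta (t - 0)).
    + apply conv_smoothing; auto; lra.
    + apply Rmult_le_compat_l; [apply Rmult_le_pos; lra|]. apply theta_mono; lra.
Qed.

Lemma conv_sub f g t n : 0 <= t -> cont_on w f 0 t -> cont_on w g 0 t ->
  conv f t n - conv g t n = conv (fun s => vsub (f s) (g s)) t n.
Proof.
  intros Ht Hf Hg. unfold conv. rewrite vint_sub by (apply conv_ex_RInt; auto; lra).
  apply vint_ext; auto. intros s Hs.
  destruct (proj1 Hf s ltac:(lra)) as [M HM]. destruct (proj1 Hg s ltac:(lra)) as [N HN].
  now rewrite (S_sub _ _ _ M N) by (auto; lra).
Qed.

Lemma cont_on_vsub v f g a b : wpos v -> cont_on v f a b -> cont_on v g a b -> cont_on v (fun s => vsub (f s) (g s)) a b.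
Proof.
  intros Hv Hf Hg. apply cont_on_ext with (fun s => vadd (f s) (vscal (-1) (g s))); auto.
  - apply cont_on_add; auto. apply cont_on_scal; auto.
  - intros; unfold vsub, vadd, vscal; lra.
Qed.

Lemma cont_on_shift v g c a b : cont_on v g (a + c) (b + c) -> cont_on v (fun s => g (s + c)) a b.
Proof.
  intros [H1 H2]. split.
  - intros t Ht. apply H1; lra.
  - intros t Ht eps He. destruct (H2 (t + c) ltac:(lra) eps He) as [d [Hd H]]. exists d; split; auto.
    intros s Hs Hst. apply H; [lra|]. now replace (s + c - (t + c)) with (s - t) by lra.
Qed.

(* [conv g t - conv g t'] is split at [h = t - t'] after translating the second integral by [h],
   which moves the increment from the semigroup onto [g]. *)
Lemma conv_increment g t' t b B om : 0 <= t' < t -> t <= b -> b <= 1 -> cont_on w g 0 b ->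
  (forall s, 0 <= s <= b -> nle w (g s) B) ->
  (forall s, 0 <= s -> s + (t - t') <= b -> nle w (vsub (g (s + (t - t'))) (g s)) om) ->
  nle wt (vsub (conv g t) (conv g t')) (C * B * theta (t - t') + C * om * theta 1).
Proof.
  intros Ht Htb Hb1 Hg HB Hom. set (h := t - t') in *.
  assert (Hg' : forall x y, 0 <= x -> y <= b -> cont_on w g x y).
  { intros x y Hx Hy. apply cont_on_sub with 0 b; auto. }
  assert (Hsh : cont_on w (fun s => g (s + h)) 0 t').
  { apply cont_on_shift. apply Hg'; unfold h; lra. }
  apply nle_ext with (vadd (vint (fun s => Sg (t - s) (g s)) 0 h) (conv (fun s => vsub (g (s + h)) (g s)) t')); auto.
  - apply nle_add; auto.
    + replace h with (h - 0) at 2 by ring. apply conv_smoothing; unfold h in *; try lra.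
      * apply Hg'; lra.
      * intros; apply HB; lra.
    + apply conv_nle; try lra.
      * apply cont_on_vsub; auto. apply Hg'; lra.
      * intros s Hs. apply Hom; unfold h; lra.
  - intros n. unfold vsub at 1, vadd.
    rewrite <- conv_sub; auto; [|lra|apply Hg'; lra].
    unfold conv. rewrite <- (vint_Chasles _ 0 h t n) by (apply conv_ex_RInt; [unfold h; lra|apply Hg'; unfold h; lra]).
    assert (E : vint (fun s => Sg (t' - s) (g (s + h))) 0 t' n = vint (fun s => Sg (t - s) (g s)) h t n).
    { pose proof (vint_shift (fun s => Sg (t - s) (g s)) h 0 t' n) as E.
      replace (0 + h) with h in E by ring. replace (t' + h) with t in E by (unfold h; ring).
      rewrite <- E by (apply conv_ex_RInt; [unfold h; lra|apply Hg'; unfold h; lra]).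
      apply vint_ext; [lra|]. intros s Hs. f_equal. unfold h. lra. }
    rewrite E. lra.
Qed.

Lemma conv_cont g b : b <= 1 -> cont_on w g 0 b -> cont_on wt (conv g) 0 b.
Proof.
  intros Hb1 Hg. destruct (cont_on_bounded w Hw g 0 b Hg) as [B [HB HgB]].
  assert (Hg' : forall y, y <= b -> cont_on w g 0 y).
  { intros y Hy. apply cont_on_sub with 0 b; auto; lra. }
  split.
  - intros t Ht. exists (C * B * theta 1). apply conv_nle; try lra; [apply Hg'; lra|].
    intros; apply HgB; lra.
  - intros t0 Ht0 eps He.
    pose proof (theta_pos 1) as Hth.
    assert (Hom : 0 < eps / (2 * (C * theta 1))).
    { apply Rdiv_lt_0_compat; auto. apply Rmult_lt_0_compat; [lra|]. apply Rmult_lt_0_compat; lra. }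
    destruct (cont_on_unif w Hw g 0 b Hg _ Hom) as [d1 [Hd1 H1]].
    assert (HCB : 0 < C * B) by (apply Rmult_lt_0_compat; lra).
    destruct (theta_small (eps / (2 * (C * B)))) as [d2 [Hd2 H2]].
    { apply Rdiv_lt_0_compat; lra. }
    exists (Rmin d1 d2). split; [apply Rmin_pos; lra|].
    pose proof (Rmin_l d1 d2). pose proof (Rmin_r d1 d2).
    assert (Hinc : forall t' t, 0 <= t' < t -> t <= b -> t - t' < Rmin d1 d2 ->
              nle wt (vsub (conv g t) (conv g t')) eps).
    { intros t' t Ht Htb Hd.
      eapply nle_weaken; [apply (conv_increment g t' t b B (eps / (2 * (C * theta 1)))); auto|].
      - intros s Hs Hsb. apply H1; try lra. rewrite Rabs_pos_eq; lra.
      - specialize (H2 (t - t') ltac:(lra)).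
        assert (C * B * theta (t - t') <= eps / 2).
        { apply Rle_trans with (C * B * (eps / (2 * (C * B)))); [apply Rmult_le_compat_l; lra|].
          right; field; lra. }
        assert (C * (eps / (2 * (C * theta 1))) * theta 1 = eps / 2) by (field; lra). lra. }
    intros s Hs Hst. destruct (Rtotal_order s t0) as [Hlt|[->|Hgt]].
    + apply nle_sym; auto. apply Hinc; try lra. rewrite Rabs_left in Hst; lra.
    + apply nle_sub_refl. lra.
    + apply Hinc; try lra. rewrite Rabs_pos_eq in Hst; lra.
Qed.

(** The integral is coordinatewise while [S(r)] mixes coordinates. Each coordinate of [S(r)] is a
    bounded functional on [l^1_w], of norm at most [/ w n], to which [vint_functional] applies. *)
Lemma S_vint r G a b n : 0 <= r -> a <= b -> cont_on w G a b ->
  Sg r (vint G a b) n = vint (fun s => Sg r (G s)) a b n.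
Proof.
  intros Hr Hab HG. destruct n as [|n].
  - destruct (cont_on_bounded w Hw G a b HG) as [B [HB HGB]].
    assert (H1 : nle w (vint G a b) (B * (b - a))).
    { apply vint_bound; auto; [intros; apply (cont_on_ex_RInt w); auto|intros; apply HGB; lra]. }
    rewrite (proj1 (sg_contr HSG _ _ r Hr H1)).
    rewrite (vint_ext _ (fun _ _ => 0)), vint_const; auto; [lra|].
    intros s Hs. apply (sg_contr HSG _ B r Hr). apply HGB; lra.
  - apply (vint_functional w Hw (fun f => Sg r f (S n)) (/ w (S n))); auto.
    + intros f M Hf. rewrite Rmult_comm.
      apply (nle_coord w Hw _ _ (S n)); [|lia]. apply (sg_contr HSG); auto.
    + intros f g M N Hf Hg. now rewrite (S_sub r f g M N).
    + intros c f M Hf. now rewrite (S_scal r c f M).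
Qed.

(** Split the integral at [t0]. On the first piece [t0 + t - s = t + (t0 - s)] lets [S(t)] factor
    out; the second is translated to start at 0. *)
Lemma conv_restart g t0 t n : 0 <= t0 -> 0 <= t -> cont_on w g 0 (t0 + t) ->
  conv g (t0 + t) n = Sg t (conv g t0) n + conv (fun s => g (t0 + s)) t n.
Proof.
  intros H0 Ht Hg.
  assert (Hg1 : cont_on w g 0 t0) by (apply cont_on_sub with 0 (t0 + t); auto; lra).
  assert (Hg2 : cont_on w g t0 (t0 + t)) by (apply cont_on_sub with 0 (t0 + t); auto; lra).
  unfold conv at 2. rewrite S_vint; auto; [|apply cont_on_S_back; auto; lra].
  unfold conv at 1. rewrite <- (vint_Chasles _ 0 t0 (t0 + t)) by (apply conv_ex_RInt; auto; lra).
  f_equal.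
  - apply vint_ext; auto. intros s Hs. destruct (proj1 Hg1 s ltac:(lra)) as [M HM].
    replace (t0 + t - s) with (t + (t0 - s)) by ring. now rewrite (sg_plus HSG t (t0 - s) _ M) by (auto; lra).
  - pose proof (vint_shift (fun s => Sg (t0 + t - s) (g s)) t0 0 t n) as E.
    replace (0 + t0) with t0 in E by ring. replace (t + t0) with (t0 + t) in E by ring.
    rewrite <- E by (apply conv_ex_RInt; auto; lra). unfold conv.
    apply vint_ext; auto. intros s Hs. replace (s + t0) with (t0 + s) by ring. f_equal. ring.
Qed.

Lemma conv_ext f g t n : 0 <= t -> (forall s, 0 <= s <= t -> f s = g s) -> conv f t n = conv g t n.
Proof. intros Ht H. apply vint_ext; auto. intros s Hs. rewrite H; auto; lra. Qed.

(** * Locally Lipschitz nonlinearities and local mild solutions *)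

Definition lip_on (F : R -> seqR -> seqR) (T1 R1 L : R) : Prop :=
  forall t f g D, 0 <= t <= T1 -> nle wt f R1 -> nle wt g R1 -> nle wt (vsub f g) D ->
    nle w (vsub (F t f) (F t g)) (L * D).

(** Values lie in the larger space [l^1_w]; smoothing recovers the loss. Continuity in time is asked
    at fixed [f], and continuity along curves then comes from the Lipschitz bound in
    [nonlinearity_comp_cont]. *)
Record nonlinearity (F : R -> seqR -> seqR) (T1 : R) : Prop := {
  nl_zero : forall t n, 0 <= t <= T1 -> F t (fun _ => 0) n = 0;
  nl_lip : forall R1, 0 <= R1 -> exists L, 0 <= L /\ lip_on F T1 R1 L;
  nl_cont : forall f M, nle wt f M -> cont_on w (fun t => F t f) 0 T1 }.

Definition shiftF (t0 : R) (F : R -> seqR -> seqR) : R -> seqR -> seqR := fun t => F (t0 + t).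

Lemma lip_on_sub F T1 T2 R1 L : lip_on F T1 R1 L -> T2 <= T1 -> lip_on F T2 R1 L.
Proof. intros H HT t f g D Ht. apply H. lra. Qed.

Lemma lip_on_shift F t0 T1 T2 R1 L : 0 <= t0 -> t0 + T2 <= T1 -> lip_on F T1 R1 L -> lip_on (shiftF t0 F) T2 R1 L.
Proof. intros H0 HT H t f g D Ht. apply H. lra. Qed.

Lemma nonlinearity_shift F t0 T1 T2 : 0 <= t0 -> t0 + T2 <= T1 ->
  nonlinearity F T1 -> nonlinearity (shiftF t0 F) T2.
Proof.
  intros H0 HT [Z L K]. constructor.
  - intros t n Ht. apply Z. lra.
  - intros R1 HR. destruct (L R1 HR) as [l [Hl Hl']]. exists l; split; auto.
    now apply lip_on_shift with T1.
  - intros f M Hf. pose proof (K f M Hf) as Hc.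
    apply cont_on_ext with (fun t => F (t + t0) f); auto.
    + apply (cont_on_shift w (fun t => F t f)). apply cont_on_sub with 0 T1; auto; lra.
    + intros t Ht n. unfold shiftF. now rewrite Rplus_comm.
Qed.

Lemma nonlinearity_comp_cont F T1 u b : nonlinearity F T1 -> b <= T1 -> cont_on wt u 0 b ->
  cont_on w (fun s => F s (u s)) 0 b.
Proof.
  intros HF Hb Hu. destruct (cont_on_bounded wt Hwt u 0 b Hu) as [R1 [HR HuR]].
  destruct (nl_lip _ _ HF R1 ltac:(lra)) as [L [HL HL']].
  split.
  - intros t Ht. destruct (proj1 (nl_cont _ _ HF (u t) R1 (HuR t Ht)) t ltac:(lra)) as [M HM]. now exists M.
  - intros t Ht eps He.
    destruct (proj2 Hu t Ht (eps / (2 * (1 + L)))) as [d [Hd H]]; [apply Rdiv_lt_0_compat; lra|].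
    destruct (proj2 (nl_cont _ _ HF (u t) R1 (HuR t Ht)) t ltac:(lra) (eps / 2) ltac:(lra)) as [d' [Hd' H']].
    exists (Rmin d d'). split; [apply Rmin_pos; auto|]. intros s Hs Hst.
    pose proof (Rmin_l d d'). pose proof (Rmin_r d d').
    replace eps with (eps / 2 + eps / 2) by lra. apply nle_tri with (F s (u t)); auto.
    + apply nle_weaken with (L * (eps / (2 * (1 + L)))).
      * apply HL'; auto; [lra|]. apply H; auto; lra.
      * apply Rmult_le_reg_r with (1 + L); [lra|]. field_simplify; [|lra]. nra.
    + apply H'; lra.
Qed.

Definition duhamel (F : R -> seqR -> seqR) (x : seqR) (u : R -> seqR) (t : R) : seqR :=
  vadd (Sg t x) (conv (fun s => F s (u s)) t).

Definition sol (F : R -> seqR -> seqR) (x : seqR) (b : R) (u : R -> seqR) : Prop :=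
  0 <= b /\ cont_on wt u 0 b /\ forall t, 0 <= t <= b -> forall n, u t n = duhamel F x u t n.

Lemma duhamel_cont F T1 x M u b : nonlinearity F T1 -> b <= T1 -> b <= 1 -> cont_on wt u 0 b ->
  nle wt x M -> cont_on wt (duhamel F x u) 0 b.
Proof.
  intros HF HbT Hb1 Hu Hx. unfold duhamel. apply cont_on_add; auto.
  - apply (sg_cont_wt HSG) with M; auto.
  - apply conv_cont; auto. now apply nonlinearity_comp_cont with T1.
Qed.

(** One estimate with three uses: against the zero curve it keeps Picard iterates in a ball, with
    [x = y] it makes them converge, and iterated on two solutions it gives Lipschitz dependence. The
    condition [C * L * theta d <= 1 / 2] is the source of [D / 2]. *)
Lemma duhamel_contract F T1 x y u v b d R1 L rho D M N :
  nonlinearity F T1 -> b <= T1 -> b <= d -> 0 < d <= 1 ->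
  cont_on wt u 0 b -> cont_on wt v 0 b ->
  (forall s, 0 <= s <= b -> nle wt (u s) R1) -> (forall s, 0 <= s <= b -> nle wt (v s) R1) ->
  0 <= L -> lip_on F b R1 L -> C * L * theta d <= 1 / 2 ->
  (forall s, 0 <= s <= b -> nle wt (vsub (u s) (v s)) D) ->
  nle wt x M -> nle wt y N -> nle wt (vsub x y) rho ->
  forall t, 0 <= t <= b -> nle wt (vsub (duhamel F x u t) (duhamel F y v t)) (C * rho + D / 2).
Proof.
  intros HF HbT Hbd Hd Hu Hv HuR HvR HL HLip Hth HD Hx Hy Hxy t Ht.
  assert (HD0 : 0 <= D) by (apply (nle_nonneg wt (vsub (u 0) (v 0))); apply HD; lra).
  assert (Hu' : cont_on wt u 0 t) by (apply cont_on_sub with 0 b; auto; lra).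
  assert (Hv' : cont_on wt v 0 t) by (apply cont_on_sub with 0 b; auto; lra).
  assert (Hgu := nonlinearity_comp_cont F T1 u t HF ltac:(lra) Hu').
  assert (Hgv := nonlinearity_comp_cont F T1 v t HF ltac:(lra) Hv').
  apply nle_ext with (vadd (Sg t (vsub x y)) (conv (fun s => vsub (F s (u s)) (F s (v s))) t)); auto.
  - apply nle_add; auto.
    + apply (sg_bound_wt HSG); auto; lra.
    + apply nle_weaken with (C * (L * D) * theta d).
      * apply conv_nle; auto; [lra|apply cont_on_vsub; auto|].
        intros s Hs. apply HLip; [lra|apply HuR; lra|apply HvR; lra|apply HD; lra].
      * replace (C * (L * D) * theta d) with (C * L * theta d * D) by ring. nra.
  - intros n. unfold vsub at 1, vadd. rewrite <- conv_sub by (auto; lra).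
    rewrite (S_sub t x y M N) by (try lra; now apply nle_wt_w). unfold duhamel, vadd, vsub. lra.
Qed.

Lemma duhamel_zero F T1 t n : nonlinearity F T1 -> 0 <= t <= T1 ->
  duhamel F (fun _ => 0) (fun _ _ => 0) t n = 0.
Proof.
  intros HF Ht. unfold duhamel, vadd.
  assert (Hz : nle w (fun _ => 0) 0) by (apply nle_zero; auto; lra).
  rewrite (nle_eq0 w Hw (Sg t (fun _ => 0)) (sg_contr HSG _ _ t (proj1 Ht) Hz)).
  unfold conv. rewrite (vint_ext _ (fun _ _ => 0)); [rewrite vint_const; lra|lra|].
  intros s Hs. apply (nle_eq0 w Hw). apply (sg_contr HSG); [lra|].
  apply nle_zero; [|lra]. intros. apply (nl_zero _ _ HF). lra.
Qed.

(** The radius [R1 = 2 * C * R0] solves [C * R0 + R1 / 2 = R1], so iterates starting at 0 stay in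
    that ball; [nl_zero] makes the zero curve the solution they are compared with. *)
Lemma local_existence F x R0 d L :
  0 < d <= 1 -> nonlinearity F d -> nle wt x R0 ->
  0 <= L -> lip_on F d (2 * C * R0) L -> C * L * theta d <= 1 / 2 -> exists u, sol F x d u.
Proof.
  intros Hd HF Hx HL HLip Hth.
  pose proof (nle_nonneg _ _ _ Hx) as HR0. set (R1 := 2 * C * R0) in *.
  assert (HR1 : 0 <= R1) by (apply Rmult_le_pos; lra).
  set (zero := (fun _ _ => 0) : R -> seqR).
  assert (Hz0 : forall M, 0 <= M -> nle wt (fun _ => 0) M) by (intros; apply nle_zero; auto).
  assert (Hzc : cont_on wt zero 0 d).
  { split; [intros; exists 0; apply Hz0; lra|]. intros t Ht eps He. exists 1; split; [lra|].
    intros; apply nle_sub_refl; lra. }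
  set (it := fun m => Nat.iter m (duhamel F x) zero).
  assert (Hit : forall m, cont_on wt (it m) 0 d /\ forall t, 0 <= t <= d -> nle wt (it m t) R1).
  { induction m as [|m [IH1 IH2]].
    - split; [auto|intros; apply Hz0; auto].
    - split; [apply duhamel_cont with d R0; auto; lra|]. intros t Ht.
      apply nle_ext with (vsub (duhamel F x (it m) t) (duhamel F (fun _ => 0) zero t)); auto.
      + replace R1 with (C * R0 + R1 / 2) by (unfold R1; field).
        apply duhamel_contract with d d d R1 L R0 0; auto; try lra.
        * intros s Hs. apply nle_ext with (it m s); auto. intros n. unfold vsub, zero. lra.
        * apply Hz0; lra.
        * apply nle_ext with x; auto. intros n; unfold vsub; lra.
      + intros n. unfold vsub, zero. rewrite (duhamel_zero F d) by (auto; lra).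
        change (it (S m) t n) with (duhamel F x (it m) t n). lra. }
  assert (Hstep : forall m t, 0 <= t <= d -> nle wt (vsub (it (S m) t) (it m t)) (R1 / 2 ^ m)).
  { induction m as [|m IH]; intros t Ht.
    - simpl pow. replace (R1 / 1) with R1 by field.
      apply nle_ext with (it 1%nat t); [auto|apply Hit; auto|]. intros n. unfold vsub. unfold it at 2; simpl. unfold zero. lra.
    - replace (R1 / 2 ^ S m) with (C * 0 + R1 / 2 ^ m / 2) by (simpl; field; apply pow_nonzero; lra).
      apply (duhamel_contract F d x x (it (S m)) (it m) d d R1 L 0 (R1 / 2 ^ m) R0 R0); auto; try lra; try apply Hit.
      apply nle_sub_refl; lra. }
  assert (Hcau : forall m k t, 0 <= t <= d -> nle wt (vsub (it (m + k)%nat t) (it m t)) (2 * R1 / 2 ^ m - 2 * R1 / 2 ^ (m + k))).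
  { intros m k t Ht. induction k as [|k IH].
    - rewrite Nat.add_0_r. rewrite Rminus_diag. apply nle_sub_refl; lra.
    - rewrite Nat.add_succ_r.
      replace (2 * R1 / 2 ^ m - 2 * R1 / 2 ^ S (m + k)) with
        (R1 / 2 ^ (m + k) + (2 * R1 / 2 ^ m - 2 * R1 / 2 ^ (m + k))).
      + apply nle_tri with (it (m + k)%nat t); auto.
      + simpl pow. field. split; apply pow_nonzero; lra. }
  assert (Hpw : forall m, 0 < / 2 ^ m) by (intros; apply Rinv_0_lt_compat, pow_lt; lra).
  assert (Hcau' : forall m p t, 0 <= t <= d -> (m <= p)%nat -> nle wt (vsub (it p t) (it m t)) (2 * R1 / 2 ^ m)).
  { intros m p t Ht Hp. replace p with (m + (p - m))%nat by lia.
    eapply nle_weaken; [apply Hcau; auto|]. pose proof (Hpw (m + (p - m))%nat). unfold Rdiv. nra. }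
  assert (Hsmall : forall K eps, 0 <= K -> 0 < eps -> exists m, K / 2 ^ m < eps).
  { intros K eps HK He. destruct (pow_lt_1_zero (/ 2) ltac:(rewrite Rabs_pos_eq; lra) (eps / (1 + K))) as [m Hm].
    { apply Rdiv_lt_0_compat; lra. }
    exists m. specialize (Hm m (Nat.le_refl m)). rewrite pow_inv in Hm.
    rewrite Rabs_pos_eq in Hm by (left; apply Hpw).
    assert (eps / (1 + K) * (1 + K) = eps) by (field; lra). pose proof (Hpw m). unfold Rdiv in *. nra. }
  (* The limit is taken in each coordinate, and [nle_lim] then transfers the geometric estimates;
     this takes the place of completeness of [l^1_wt]. *)
  set (u := (fun t n => real (Lim_seq (fun m => it m t n))) : R -> seqR).
  assert (Hlim : forall t, 0 <= t <= d -> forall n, is_lim_seq (fun m => it m t n) (u t n)).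
  { intros t Ht n. apply Lim_seq_correct', ex_lim_seq_cauchy_corr. intros eps.
    destruct n as [|n].
    - exists 0%nat. intros p q _ _. destruct (proj2 (Hit p) t Ht) as [-> _]. destruct (proj2 (Hit q) t Ht) as [-> _].
      rewrite Rminus_diag, Rabs_R0. apply cond_pos.
    - destruct (Hsmall (2 * (2 * R1)) (eps * wt (S n))) as [m Hm].
      { lra. } { apply Rmult_lt_0_compat; [apply cond_pos|apply Hwt; lia]. }
      exists m. intros p q Hp Hq.
      pose proof (nle_tri wt Hwt _ _ _ _ _ (Hcau' m p t Ht Hp) (nle_sym wt Hwt _ _ _ (Hcau' m q t Ht Hq))) as H.
      pose proof (nle_coord wt Hwt _ _ (S n) H ltac:(lia)) as H'. unfold vsub in H'.
      eapply Rle_lt_trans; [exact H'|]. pose proof (Hwt (S n) ltac:(lia)).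
      apply Rmult_lt_reg_r with (wt (S n)); auto. unfold Rdiv in *.
      rewrite Rmult_assoc, Rinv_l by lra. lra. }
  assert (Hu : forall m t, 0 <= t <= d -> nle wt (vsub (u t) (it m t)) (2 * R1 / 2 ^ m)).
  { intros m t Ht. apply nle_lim with (fun p => vsub (it p t) (it m t)) m; auto.
    intros n. unfold vsub. apply is_lim_seq_minus'; [now apply Hlim|apply is_lim_seq_const]. }
  assert (HuR : forall t, 0 <= t <= d -> nle wt (u t) R1).
  { intros t Ht. apply nle_lim with (fun p => it p t) 0%nat; [now apply Hlim|]. intros p _. now apply Hit. }
  assert (Huc : cont_on wt u 0 d).
  { apply cont_on_limit; auto.
    - intros t Ht. apply (HuR t Ht).
    - intros eps He. destruct (Hsmall (2 * R1) eps ltac:(lra) He) as [m Hm].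
      exists (it m). split; [apply Hit|]. intros t Ht. apply nle_weaken with (2 * R1 / 2 ^ m); [auto|lra]. }
  exists u. split; [lra|]. split; auto. intros t Ht n.
  apply Rminus_diag_uniq. change (vsub (u t) (duhamel F x u t) n = 0). apply (nle_eq0 wt Hwt).
  apply nle_eps. intros eps He. rewrite Rplus_0_l.
  destruct (Hsmall (2 * R1) eps ltac:(lra) He) as [m Hm].
  apply nle_weaken with (2 * R1 / 2 ^ S m + (C * 0 + 2 * R1 / 2 ^ m / 2)).
  - apply nle_tri with (it (S m) t); auto.
    apply (duhamel_contract F d x x (it m) u d d R1 L 0 (2 * R1 / 2 ^ m) R0 R0); auto; try lra; try apply Hit.
    + intros s Hs. apply nle_sym; auto.
    + apply nle_sub_refl; lra.
  - replace (2 * R1 / 2 ^ S m + (C * 0 + 2 * R1 / 2 ^ m / 2)) with (2 * R1 / 2 ^ m); [lra|].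
    simpl. field. apply pow_nonzero; lra.
Qed.

(** By [duhamel_contract], a bound [D] on the distance improves to [C * rho + D / 2]. Started at
    [2 * R1], this tends to the fixed point [2 * C * rho]. *)
Lemma sol_lipschitz_step F T1 x y u v b d R1 L rho M N :
  nonlinearity F T1 -> b <= T1 -> b <= d -> 0 < d <= 1 ->
  sol F x b u -> sol F y b v ->
  (forall s, 0 <= s <= b -> nle wt (u s) R1) -> (forall s, 0 <= s <= b -> nle wt (v s) R1) ->
  0 <= L -> lip_on F b R1 L -> C * L * theta d <= 1 / 2 ->
  nle wt x M -> nle wt y N -> nle wt (vsub x y) rho ->
  forall t, 0 <= t <= b -> nle wt (vsub (u t) (v t)) (2 * C * rho).
Proof.
  intros HF HbT Hbd Hd [Hb [Hu Eu]] [_ [Hv Ev]] HuR HvR HL HLip Hth Hx Hy Hxy.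
  assert (HR1 : 0 <= R1) by (apply (nle_nonneg wt (u 0)); apply HuR; lra).
  assert (H : forall m t, 0 <= t <= b -> nle wt (vsub (u t) (v t)) (2 * C * rho + 2 * R1 / 2 ^ m)).
  { pose proof (nle_nonneg _ _ _ Hxy) as Hr.
    induction m as [|m IH]; intros t Ht.
    - apply nle_weaken with (R1 + R1).
      + apply nle_sub; auto.
      + simpl. assert (0 <= 2 * C * rho) by (apply Rmult_le_pos; lra). lra.
    - apply nle_ext with (vsub (duhamel F x u t) (duhamel F y v t)); auto.
      + replace (2 * C * rho + 2 * R1 / 2 ^ S m) with (C * rho + (2 * C * rho + 2 * R1 / 2 ^ m) / 2)
          by (simpl; field; apply pow_nonzero; lra).
        apply duhamel_contract with T1 b d R1 L M N; auto.
      + intros n. unfold vsub. now rewrite Eu, Ev. }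
  intros t Ht. apply nle_eps. intros eps He.
  destruct (pow_lt_1_zero (/ 2) ltac:(rewrite Rabs_pos_eq; lra) (eps / (1 + 2 * R1))) as [m Hm].
  { apply Rdiv_lt_0_compat; lra. }
  eapply nle_weaken; [apply (H m t Ht)|]. apply Rplus_le_compat_l.
  specialize (Hm m (Nat.le_refl m)). rewrite pow_inv in Hm.
  assert (0 < / 2 ^ m) by (apply Rinv_0_lt_compat, pow_lt; lra).
  rewrite Rabs_pos_eq in Hm by lra.
  assert (eps / (1 + 2 * R1) * (1 + 2 * R1) = eps) by (field; lra). unfold Rdiv in *. nra.
Qed.

Lemma sol_sub F x b b' u : sol F x b u -> 0 <= b' <= b -> sol F x b' u.
Proof.
  intros [Hb [Hu Eu]] Hb'. split; [lra|]. split; [apply cont_on_sub with 0 b; auto; lra|].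
  intros t Ht. apply Eu. lra.
Qed.

Lemma sol_nle F x b u t : sol F x b u -> 0 <= t <= b -> exists M, nle wt (u t) M.
Proof. intros [_ [[H _] _]] Ht. auto. Qed.

Lemma duhamel_0 F x u M n : nle wt x M -> duhamel F x u 0 n = x n.
Proof.
  intros Hx. unfold duhamel, vadd. rewrite conv_0, (sg_0 HSG x M) by now apply nle_wt_w. lra.
Qed.

Lemma sol_initial F x b u M n : sol F x b u -> nle wt x M -> u 0 n = x n.
Proof. intros [Hb [_ Eu]] Hx. rewrite Eu by lra. now apply duhamel_0 with M. Qed.

Lemma duhamel_restart F T1 x M u t0 t n :
  nonlinearity F T1 -> 0 <= t0 -> 0 <= t -> t0 + t <= T1 -> cont_on wt u 0 (t0 + t) -> nle wt x M ->
  (forall n, u t0 n = duhamel F x u t0 n) ->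
  duhamel F x u (t0 + t) n = duhamel (shiftF t0 F) (u t0) (fun s => u (t0 + s)) t n.
Proof.
  intros HF H0 Ht HT Hu Hx E.
  assert (Hg : cont_on w (fun s => F s (u s)) 0 (t0 + t)) by (apply nonlinearity_comp_cont with T1; auto).
  assert (Hg0 : cont_on w (fun s => F s (u s)) 0 t0) by (apply cont_on_sub with 0 (t0 + t); auto; lra).
  destruct (cont_on_bounded w Hw _ 0 t0 Hg0) as [B [HB HgB]].
  pose proof (nle_wt_w _ _ Hx) as Hxw.
  assert (Es : u t0 = vadd (Sg t0 x) (vscal 1 (conv (fun s => F s (u s)) t0))).
  { extensionality k. rewrite E. unfold duhamel, vadd, vscal. lra. }
  unfold duhamel. unfold vadd at 1. rewrite conv_restart by (auto; lra).
  rewrite Es. rewrite (sg_lin HSG t 1 _ _ M (B * t0)); auto.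
  - rewrite (Rplus_comm t0 t), (sg_plus HSG t t0 x M) by auto.
    unfold vadd, vscal, shiftF. lra.
  - apply (sg_contr HSG); auto.
  - apply conv_nle_w; auto.
Qed.

Lemma sol_restart F T1 x M b u t0 : nonlinearity F T1 -> b <= T1 -> nle wt x M ->
  sol F x b u -> 0 <= t0 <= b -> sol (shiftF t0 F) (u t0) (b - t0) (fun s => u (t0 + s)).
Proof.
  intros HF HbT Hx [Hb [Hu Eu]] Ht0. split; [lra|]. split.
  - apply cont_on_ext with (fun s => u (s + t0)); auto.
    + apply cont_on_shift. apply cont_on_sub with 0 b; auto; lra.
    + intros; now rewrite Rplus_comm.
  - intros t Ht n. rewrite Eu by lra. apply duhamel_restart with T1 M; auto; try lra.
    apply cont_on_sub with 0 b; auto; lra.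
Qed.

(** Beyond [t0] the equation for the glued curve is reduced by [duhamel_restart] to the one
    satisfied by [v]. *)
Lemma sol_glue F T1 x M u t0 v d : nonlinearity F T1 -> t0 + d <= T1 -> nle wt x M ->
  sol F x t0 u -> sol (shiftF t0 F) (u t0) d v ->
  sol F x (t0 + d) (fun t => if Rle_dec t t0 then u t else v (t - t0)).
Proof.
  intros HF HT Hx Hsu Hsv.
  destruct (sol_nle _ _ _ _ t0 Hsu ltac:(destruct Hsu; lra)) as [M0 HM0].
  assert (Ev0 : v 0 = u t0) by (extensionality n; apply (sol_initial _ _ _ _ _ n Hsv HM0)).
  destruct Hsu as [H0 [Hu Eu]]. destruct Hsv as [Hd [Hv Ev]].
  set (z := fun t => if Rle_dec t t0 then u t else v (t - t0)).
  assert (Ez1 : forall t, t <= t0 -> z t = u t) by (intros t Ht; unfold z; destruct (Rle_dec t t0); [auto|lra]).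
  assert (Ez2 : forall t, t0 <= t -> z t = v (t - t0)).
  { intros t Ht; unfold z; destruct (Rle_dec t t0); auto. replace t with t0 by lra. now rewrite Rminus_diag. }
  assert (Hz : cont_on wt z 0 (t0 + d)).
  { split.
    - intros t Ht. destruct (Rle_lt_dec t t0).
      + rewrite Ez1 by auto. apply Hu; lra.
      + rewrite Ez2 by lra. apply Hv; lra.
    - intros t Ht eps He.
      assert (HL : t <= t0 -> exists e, 0 < e /\ forall s, 0 <= s <= t0 -> Rabs (s - t) < e -> nle wt (vsub (z s) (z t)) eps).
      { intros Hle. destruct (proj2 Hu t ltac:(lra) eps He) as [e [He1 H]]. exists e; split; auto.
        intros s Hs Hst. rewrite !Ez1 by lra. auto. }
      assert (HR : t0 <= t -> exists e, 0 < e /\ forall s, t0 <= s <= t0 + d -> Rabs (s - t) < e -> nle wt (vsub (z s) (z t)) eps).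
      { intros Hge. destruct (proj2 Hv (t - t0) ltac:(lra) eps He) as [e [He1 H]]. exists e; split; auto.
        intros s Hs Hst. rewrite !Ez2 by lra. apply H; [lra|]. now replace (s - t0 - (t - t0)) with (s - t) by ring. }
      destruct (Rtotal_order t t0) as [Hlt|[->|Hgt]].
      + destruct (HL ltac:(lra)) as [e [He1 H]]. exists (Rmin e (t0 - t)). split; [apply Rmin_pos; lra|].
        intros s Hs Hst. pose proof (Rmin_l e (t0 - t)). pose proof (Rmin_r e (t0 - t)).
        apply Rabs_def2 in Hst. apply H; [lra|]. apply Rabs_def1; lra.
      + destruct (HL ltac:(lra)) as [e [He1 H]]. destruct (HR ltac:(lra)) as [e' [He1' H']].
        exists (Rmin e e'). split; [apply Rmin_pos; lra|].
        intros s Hs Hst. pose proof (Rmin_l e e'). pose proof (Rmin_r e e').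
        destruct (Rle_lt_dec s t0); [apply H; lra|apply H'; lra].
      + destruct (HR ltac:(lra)) as [e [He1 H]]. exists (Rmin e (t - t0)). split; [apply Rmin_pos; lra|].
        intros s Hs Hst. pose proof (Rmin_l e (t - t0)). pose proof (Rmin_r e (t - t0)).
        apply Rabs_def2 in Hst. apply H; [lra|]. apply Rabs_def1; lra. }
  assert (Hsame : forall t n, 0 <= t <= t0 -> z t n = duhamel F x z t n).
  { intros t n Ht. rewrite Ez1 by lra. rewrite Eu by lra. unfold duhamel, vadd. f_equal.
    apply conv_ext; [lra|]. intros s Hs. now rewrite Ez1 by lra. }
  split; [lra|]. split; auto. intros t Ht n. destruct (Rle_lt_dec t t0); [apply Hsame; lra|].
  replace t with (t0 + (t - t0)) at 2 by ring.
  rewrite (duhamel_restart F T1 x M); auto; try lra.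
  - rewrite Ez2 by lra. rewrite Ev by lra. rewrite (Ez1 t0) by lra. unfold duhamel, vadd. f_equal.
    apply conv_ext; [lra|]. intros s Hs. rewrite Ez2 by lra. now replace (t0 + s - t0) with s by ring.
  - apply cont_on_sub with 0 (t0 + d); auto; lra.
  - intros k. apply Hsame. lra.
Qed.

(** The Lipschitz constant is valid on the ball of radius [R0 + 1], while [v] is not bounded in
    advance. Real induction closes the circle: a distance of at most [2 * C * rho <= 1 / 2] up to
    [t], with [1 / 4] for the continuity of each curve, keeps [v] within 1 of [u] a little longer,
    and there [sol_lipschitz_step] restores the sharper bound. *)
Lemma sol_dependence_short F T1 x y M N u v b d R0 L rho :
  nonlinearity F T1 -> b <= T1 -> b <= d -> 0 < d <= 1 ->
  sol F x b u -> sol F y b v -> nle wt x M -> nle wt y N ->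
  (forall s, 0 <= s <= b -> nle wt (u s) R0) ->
  0 <= L -> lip_on F T1 (R0 + 1) L -> C * L * theta d <= 1 / 2 ->
  nle wt (vsub y x) rho -> 2 * C * rho <= 1 / 2 ->
  forall t, 0 <= t <= b -> nle wt (vsub (v t) (u t)) (2 * C * rho).
Proof.
  intros HF HbT Hbd Hd Hu Hv Hx Hy HuR HL HLip Hth Hxy Hrho.
  pose proof (nle_nonneg _ _ _ Hxy) as Hr0.
  pose proof Hu as [Hb [Huc _]]. pose proof Hv as [_ [Hvc _]].
  apply real_induction.
  - apply nle_ext with (vsub y x); auto.
    + apply nle_weaken with rho; auto. nra.
    + intros n. unfold vsub. now rewrite (sol_initial _ _ _ _ _ n Hu Hx), (sol_initial _ _ _ _ _ n Hv Hy).
  - intros t Ht HQ.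
    destruct (proj2 Huc t ltac:(lra) (1 / 4) ltac:(lra)) as [e [He H]].
    destruct (proj2 Hvc t ltac:(lra) (1 / 4) ltac:(lra)) as [e' [He' H']].
    exists (Rmin e e'). split; [apply Rmin_pos; auto|]. intros s Hs Hsb.
    pose proof (Rmin_l e e'). pose proof (Rmin_r e e').
    assert (Hclose : forall r, 0 <= r <= s -> nle wt (vsub (v r) (u r)) 1).
    { intros r Hr. destruct (Rle_lt_dec r t).
      - apply nle_weaken with (2 * C * rho); [apply HQ; lra|lra].
      - apply nle_weaken with (1 / 4 + (2 * C * rho + 1 / 4)); [|lra].
        apply nle_tri with (v t); auto; [apply H'; [lra|rewrite Rabs_pos_eq; lra]|].
        apply nle_tri with (u t); auto; [apply HQ; lra|].
        apply nle_sym; auto. apply H; [lra|rewrite Rabs_pos_eq; lra]. }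
    apply (sol_lipschitz_step F T1 y x v u s d (R0 + 1) L rho N M); auto; try lra.
    + now apply sol_sub with b; auto; lra.
    + now apply sol_sub with b; auto; lra.
    + intros r Hr. rewrite Rplus_comm. apply nle_of_sub with (u r); auto. apply HuR; lra.
    + intros r Hr. apply nle_weaken with R0; [apply HuR; lra|lra].
    + apply lip_on_sub with T1; auto; lra.
  - intros t Ht HQ. apply nle_eps. intros eps Heps.
    destruct (proj2 Huc t ltac:(lra) (eps / 2) ltac:(lra)) as [e [He H]].
    destruct (proj2 Hvc t ltac:(lra) (eps / 2) ltac:(lra)) as [e' [He' H']].
    pose proof (Rmin_l e e'). pose proof (Rmin_r e e').
    assert (0 < Rmin e e') by (apply Rmin_pos; auto).
    set (s := Rmax 0 (t - Rmin e e' / 2)).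
    assert (Hs : 0 <= s < t /\ t - s < Rmin e e').
    { unfold s. unfold Rmax. destruct (Rle_dec 0 (t - Rmin e e' / 2)); lra. }
    replace (2 * C * rho + eps) with (eps / 2 + (2 * C * rho + eps / 2)) by lra.
    apply nle_tri with (v s); auto.
    + apply nle_sym; auto. apply H'; [lra|]. rewrite Rabs_left; lra.
    + apply nle_tri with (u s); auto; [apply HQ; lra|]. apply H; [lra|]. rewrite Rabs_left; lra.
Qed.

Lemma small_step L : 0 <= L -> exists d, 0 < d <= 1 /\ forall h, 0 < h <= d -> C * L * theta h <= 1 / 2.
Proof.
  intros HL. assert (HCL : 0 <= C * L) by (apply Rmult_le_pos; lra).
  destruct (theta_small (1 / (2 * (1 + C * L)))) as [d [Hd H]]; [apply Rdiv_lt_0_compat; lra|].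
  exists d; split; auto. intros h Hh. specialize (H h Hh).
  apply Rle_trans with (C * L * (1 / (2 * (1 + C * L)))); [apply Rmult_le_compat_l; auto|].
  apply Rmult_le_reg_r with (2 * (1 + C * L)); [lra|]. field_simplify; lra.
Qed.

(* The singular Gronwall lemma is replaced by finitely many short steps of equal length, each of
   which multiplies the distance by at most [2 * C]. *)
Lemma sol_dependence F T1 x M0 tau u :
  nonlinearity F T1 -> tau <= T1 -> nle wt x M0 -> sol F x tau u ->
  exists r M, 0 < r /\ 0 < M /\ forall y N b v rho, nle wt y N -> sol F y b v -> b <= tau ->
    nle wt (vsub y x) rho -> rho <= r ->
    forall t, 0 <= t <= b -> nle wt (vsub (v t) (u t)) (M * rho).
Proof.
  intros HF Htau Hx Hu. pose proof Hu as [Ht0 [Huc _]].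
  destruct (cont_on_bounded wt Hwt u 0 tau Huc) as [R0 [HR0 HuR]].
  destruct (nl_lip _ _ HF (R0 + 1) ltac:(lra)) as [L [HL HLip]].
  destruct (small_step L HL) as [d [Hd Hth]].
  destruct (INR_unbounded (tau / d)) as [K HK].
  assert (HKd : tau < INR K * d).
  { apply Rmult_lt_reg_r with (/ d); [apply Rinv_0_lt_compat; lra|]. rewrite Rmult_assoc, Rinv_r by lra.
    unfold Rdiv in HK. lra. }
  set (q := 2 * C). assert (Hq : 1 <= q) by (unfold q; lra).
  assert (Hqp : forall i, 1 <= q ^ i) by (intros; apply pow_R1_Rle; auto).
  assert (HqK : 0 < q ^ K) by (pose proof (Hqp K); lra).
  (* With this radius no factor [q ^ i], [i <= K], carries [rho] beyond [1 / 2], so every step stays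
     within the range of [sol_dependence_short]. *)
  exists (/ (2 * q ^ K)), (q ^ K). split; [apply Rinv_0_lt_compat; lra|]. split; auto.
  intros y N b v rho Hy Hv Hbt Hxy Hrho.
  pose proof (nle_nonneg _ _ _ Hxy) as Hr0.
  assert (Hsm : q ^ K * rho <= 1 / 2).
  { apply Rle_trans with (q ^ K * / (2 * q ^ K)); [apply Rmult_le_compat_l; lra|]. right; field; lra. }
  assert (Hind : forall i, (i <= K)%nat -> forall t, 0 <= t <= b -> t <= INR i * d ->
     nle wt (vsub (v t) (u t)) (q ^ i * rho)).
  { induction i as [|i IH]; intros Hi t Ht Hti.
    - simpl in Hti. replace t with 0 by lra. simpl. rewrite Rmult_1_l.
      apply nle_ext with (vsub y x); auto. intros n. unfold vsub.
      now rewrite (sol_initial _ _ _ _ _ n Hu Hx), (sol_initial _ _ _ _ _ n Hv Hy).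
    - assert (Hqi : q ^ S i * rho <= q ^ K * rho).
      { apply Rmult_le_compat_r; auto. apply Rle_pow; auto. }
      pose proof (pos_INR i) as Hi0.
      assert (Hs0 : 0 <= INR i * d) by (apply Rmult_le_pos; lra).
      destruct (Rle_lt_dec t (INR i * d)).
      + apply nle_weaken with (q ^ i * rho); [apply IH; auto; lia|].
        apply Rmult_le_compat_r; auto. apply Rle_pow; auto.
      + set (s := INR i * d) in *. rewrite S_INR in Hti.
        assert (Hs : 0 <= s <= b) by (unfold s in *; lra).
        destruct (sol_nle _ _ _ _ s Hu ltac:(lra)) as [Mu HMu].
        destruct (sol_nle _ _ _ _ s Hv ltac:(lra)) as [Mv HMv].
        replace (q ^ S i * rho) with (2 * C * (q ^ i * rho)) by (simpl; unfold q; ring).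
        replace t with (s + (t - s)) by ring.
        apply (sol_dependence_short (shiftF s F) (T1 - s) (u s) (v s) Mu Mv
                (fun r => u (s + r)) (fun r => v (s + r)) (t - s) d R0 L (q ^ i * rho)); auto; try lra.
        * apply nonlinearity_shift with T1; auto; lra.
        * unfold s in *; lra.
        * apply sol_sub with (tau - s); [|lra]. apply sol_restart with T1 x M0; auto; lra.
        * apply sol_sub with (b - s); [|lra]. apply sol_restart with T1 y N; auto; lra.
        * intros r0 Hr. apply HuR. lra.
        * apply lip_on_shift with T1; auto; lra.
        * apply Hth; lra.
        * apply IH; auto; lia || lra.
        * simpl in Hqi. unfold q in *. lra. }
  intros t Ht. apply Hind; auto. lra.
Qed.

(** Lipschitz dependence at distance [rho = 0]. *)
Lemma sol_unique F T1 x M b b' u v t : nonlinearity F T1 -> nle wt x M ->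
  sol F x b u -> sol F x b' v -> 0 <= t -> t <= b -> t <= b' -> t <= T1 -> u t = v t.
Proof.
  intros HF Hx Hu Hv H0 Hb Hb' HT.
  apply (sol_sub _ _ _ t) in Hu; [|lra]. apply (sol_sub _ _ _ t) in Hv; [|lra].
  destruct (sol_dependence F T1 x M t v HF HT Hx Hv) as [r [K [Hr [HK H]]]].
  assert (E : nle wt (vsub (u t) (v t)) (K * 0)).
  { apply (H x M t u 0); auto; try lra. apply nle_sub_refl; lra. }
  rewrite Rmult_0_r in E. extensionality n. pose proof (nle_eq0 wt Hwt _ E n) as En. unfold vsub in En. lra.
Qed.

(** The admissible length [d] depends on [T1] and [R0] but not on the starting time [t0]; this
    uniformity is what forces blow-up at a finite [tmax] below [T]. *)
Lemma local_existence_uniform F T1 R0 : nonlinearity F T1 -> 0 <= R0 ->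
  exists d, 0 < d <= 1 /\ forall t0 h y, 0 <= t0 -> 0 < h <= d -> t0 + h <= T1 -> nle wt y R0 ->
    exists v, sol (shiftF t0 F) y h v.
Proof.
  intros HF HR0.
  destruct (nl_lip _ _ HF (2 * C * R0)) as [L [HL HLip]]; [apply Rmult_le_pos; lra|].
  destruct (small_step L HL) as [d [Hd Hth]]. exists d; split; auto.
  intros t0 h y H0 Hh HT Hy. apply local_existence with R0 L; auto; try lra.
  - apply nonlinearity_shift with T1; auto.
  - apply lip_on_shift with T1; auto.
Qed.

Lemma sol_ext F x b u v : sol F x b u -> (forall t, 0 <= t <= b -> v t = u t) -> sol F x b v.
Proof.
  intros [Hb [Hu Eu]] E. split; auto. split.
  - apply cont_on_ext with u; auto. intros t Ht n. now rewrite E.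
  - intros t Ht n. rewrite E, Eu by auto. unfold duhamel, vadd. f_equal.
    apply conv_ext; [lra|]. intros s Hs. rewrite E; auto; lra.
Qed.

Lemma sol_at_0 F x M : nle wt x M -> sol F x 0 (fun _ => x).
Proof.
  intros Hx. split; [lra|]. split.
  - split; [now exists M|]. intros t Ht eps He. exists 1; split; [lra|]. intros; apply nle_sub_refl; lra.
  - intros t Ht n. replace t with 0 by lra. now rewrite (duhamel_0 F x _ M).
Qed.

(** * Maximal continuation and blow-up *)

Lemma Rbar_between (t : R) (T : Rbar) : Rbar_lt t T -> exists T1 : R, t < T1 /\ Rbar_lt T1 T.
Proof.
  destruct T as [T| |]; simpl; intros H; [|exists (t + 1); split; [lra|auto]|contradiction].
  exists ((t + T) / 2). simpl. lra.
Qed.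

Lemma maximal_solution F (T : Rbar) x M :
  Rbar_lt 0 T -> (forall T1 : R, 0 <= T1 -> Rbar_lt T1 T -> nonlinearity F T1) -> nle wt x M ->
  exists (tmax : Rbar) (u : R -> seqR),
    Rbar_lt 0 tmax /\ Rbar_le tmax T /\
    (forall b : R, 0 <= b -> Rbar_lt b tmax -> sol F x b u) /\
    (forall tm : R, tmax = Finite tm -> Rbar_lt tmax T -> forall R0, exists eta, 0 < eta /\
       forall t, 0 <= t -> tm - eta < t < tm -> ~ nle wt (u t) R0).
Proof.
  intros HT HF Hx. pose proof (nle_nonneg _ _ _ Hx) as HM.
  set (E := fun b : R => 0 <= b /\ Rbar_lt b T /\ exists u, sol F x b u).
  destruct (Lub_Rbar_correct E) as [Hub Hlub]. set (tmax := Lub_Rbar E) in *.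
  assert (Huniq : forall b b' u v t, E b -> sol F x b u -> sol F x b' v -> 0 <= t -> t <= b -> t <= b' -> u t = v t).
  { intros b b' u v t [Hb [HbT _]] Hu Hv H0 H1 H2. apply (sol_unique F b x M b b'); auto. }
  assert (Hex : forall b : R, Rbar_lt b tmax -> exists b' v, b < b' /\ E b' /\ sol F x b' v).
  { intros b Hb. apply NNPP. intros Hno. assert (Hle : Rbar_le tmax b).
    { apply Hlub. intros b' HE. simpl. destruct (Rle_lt_dec b' b); auto. exfalso. apply Hno.
      pose proof HE as [_ [_ [v Hv]]]. now exists b', v. }
    apply Rbar_le_not_lt in Hle. contradiction. }
  (* The value at each [t] is chosen among all solutions reaching [t]; by uniqueness it agrees with
     every one of them, so [u] is a single solution on each interval. *)
  set (u := fun t : R => epsilon (inhabits x) (fun y => exists b v, t <= b /\ E b /\ sol F x b v /\ y = v t)).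
  assert (Hu : forall b v (t : R), sol F x b v -> Rbar_lt t tmax -> 0 <= t <= b -> u t = v t).
  { intros b v t Hv Ht Htb. destruct (Hex t Ht) as [b' [v' [Hb' [HE' Hv']]]].
    assert (Hs : exists y b v, t <= b /\ E b /\ sol F x b v /\ y = v t).
    { exists (v' t), b', v'. split; [lra|auto]. }
    apply (epsilon_spec (inhabits x)) in Hs. destruct Hs as [b2 [v2 [Hb2 [HE2 [Hv2 E2]]]]].
    change (u t = v2 t) in E2. rewrite E2. apply (Huniq b2 b); auto; lra. }
  assert (Hsol : forall b : R, 0 <= b -> Rbar_lt b tmax -> sol F x b u).
  { intros b Hb Hbt. destruct (Hex b Hbt) as [b' [v [Hb' [HE' Hv]]]].
    apply sol_ext with v; [apply sol_sub with b'; auto; lra|]. intros t Ht. apply (Hu b'); auto; try lra.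
    eapply Rbar_le_lt_trans; [|exact Hbt]. simpl. lra. }
  exists tmax, u. split; [|split; [|split; [exact Hsol|]]].
  - destruct (Rbar_between 0 T HT) as [T1 [HT1 HT1']].
    destruct (local_existence_uniform F T1 M (HF T1 ltac:(lra) HT1') HM) as [d [Hd Hloc]].
    set (h := Rmin d T1). assert (Hh : 0 < h <= d /\ h <= T1).
    { unfold h. pose proof (Rmin_l d T1). pose proof (Rmin_r d T1).
      assert (0 < Rmin d T1) by (apply Rmin_pos; lra). lra. }
    destruct (Hloc 0 h x) as [v Hv]; auto; try lra.
    apply Rbar_lt_le_trans with h; [simpl; lra|]. apply Hub. split; [lra|]. split.
    + apply Rbar_le_lt_trans with T1; auto. simpl; lra.
    + exists v. replace F with (shiftF 0 F); auto. extensionality t. unfold shiftF. now rewrite Rplus_0_l.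
  - apply Hlub. intros b [_ [Hb _]]. now apply Rbar_lt_le.
  - intros tm Etm HtT R0. rewrite Etm in HtT.
    destruct (Rbar_between tm T HtT) as [T1 [HT1 HT1']].
    assert (Htm : 0 <= tm).
    { assert (HE0 : E 0) by (split; [lra|split; auto; exists (fun _ => x); now apply sol_at_0 with M]).
      apply Hub in HE0. rewrite Etm in HE0. exact HE0. }
    pose proof (HF T1 ltac:(lra) HT1') as HF1.
    destruct (local_existence_uniform F T1 (Rmax R0 0) HF1 (Rmax_r _ _)) as [d [Hd Hloc]].
    (* If the norm were at most [R0] at some [t > tm - h], a step of length [h] from [t] would glue
       to a solution reaching beyond the supremum [tm]. *)
    set (h := Rmin d (T1 - tm)). assert (Hh : 0 < h <= d /\ h <= T1 - tm).
    { unfold h. pose proof (Rmin_l d (T1 - tm)). pose proof (Rmin_r d (T1 - tm)).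
      assert (0 < Rmin d (T1 - tm)) by (apply Rmin_pos; lra). lra. }
    exists h. split; [lra|]. intros t Ht Htt Hn.
    destruct (Hloc t h (u t)) as [v Hv]; auto; try lra.
    { apply nle_weaken with R0; auto. apply Rmax_l. }
    assert (Hs : sol F x t u) by (apply Hsol; auto; rewrite Etm; simpl; lra).
    pose proof (sol_glue F T1 x M u t v h HF1 ltac:(lra) Hx Hs Hv) as Hg.
    assert (HE : E (t + h)).
    { split; [lra|]. split; [apply Rbar_le_lt_trans with T1; auto; simpl; lra|]. eexists; exact Hg. }
    apply Hub in HE. rewrite Etm in HE. simpl in HE. lra.
Qed.

(** After a restart at [t0] the remainder is the integral over [[0, h]] of [S(h - s) g(s) - g(0)],
    small compared with [h] by continuity of [g] and of the semigroup. The norm is that of [l^1_w],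
    since [g(0) = F(t0, u(t0))] need not lie in [l^1_wt]. *)
Lemma sol_right_expansion F T1 x M b u t0 : nonlinearity F T1 -> b <= T1 -> nle wt x M ->
  sol F x b u -> 0 <= t0 < b -> forall eps, 0 < eps -> exists d, 0 < d /\ forall h, 0 < h < d -> t0 + h <= b ->
    nle w (vsub (vsub (u (t0 + h)) (Sg h (u t0))) (vscal h (F t0 (u t0)))) (eps * h).
Proof.
  intros HF HbT Hx Hu Ht0 eps He.
  pose proof (sol_restart F T1 x M b u t0 HF HbT Hx Hu ltac:(lra)) as [_ [Hc Er]].
  assert (Hg : cont_on w (fun s => shiftF t0 F s (u (t0 + s))) 0 (b - t0)).
  { apply nonlinearity_comp_cont with (T1 - t0); auto; [|lra]. apply nonlinearity_shift with T1; auto; lra. }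
  set (g := fun s => shiftF t0 F s (u (t0 + s))) in *.
  destruct (proj1 Hg 0 ltac:(lra)) as [B HB].
  destruct (proj2 Hg 0 ltac:(lra) (eps / 2) ltac:(lra)) as [d [Hd H]].
  destruct (sg_cont HSG (g 0) B HB 0 ltac:(lra) (eps / 2) ltac:(lra)) as [d' [Hd' H']].
  rewrite (sg_0 HSG _ _ HB) in H'.
  exists (Rmin d d'). split; [apply Rmin_pos; auto|]. intros h Hh Hhb.
  pose proof (Rmin_l d d'). pose proof (Rmin_r d d').
  assert (Eg : g 0 = F t0 (u t0)) by (unfold g, shiftF; now rewrite Rplus_0_r).
  assert (Hg' : cont_on w g 0 h) by (apply cont_on_sub with 0 (b - t0); auto; lra).
  apply nle_ext with (vint (fun s => vsub (Sg (h - s) (g s)) (g 0)) 0 h); auto.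
  - replace (eps * h) with (eps * (h - 0)) by ring. apply vint_bound; auto; [lra| |].
    + intros n. apply (ex_RInt_minus (V := R_CompleteNormedModule)); [|apply ex_RInt_const].
      apply conv_ex_RInt; auto; lra.
    + intros s Hs. replace eps with (eps / 2 + eps / 2) by lra. apply nle_tri with (Sg (h - s) (g 0)); auto.
      * destruct (proj1 Hg s ltac:(lra)) as [Bs HBs]. rewrite <- (S_sub _ _ _ Bs B) by (auto; lra).
        apply (sg_contr HSG); [lra|]. apply H; [lra|]. rewrite Rabs_pos_eq; lra.
      * apply H'; [lra|]. rewrite Rabs_pos_eq; lra.
  - intros n. rewrite <- (vint_sub (fun s => Sg (h - s) (g s)) (fun _ => g 0)).
    2: apply conv_ex_RInt; auto; lra.
    2: apply ex_RInt_const.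
    rewrite vint_const, Eg. unfold vsub at 1, vscal. unfold vsub. rewrite Er by lra.
    unfold duhamel, vadd. fold g. unfold conv. ring.
Qed.

End Semilinear.

(** * The coagulation operator *)

Lemma Series_abs_le F B : F 0%nat = 0 -> (forall J, sum1 J (fun j => Rabs (F j)) <= B) ->
  ex_series F /\ Rabs (Series F) <= B.
Proof.
  intros H0 HB.
  destruct (ex_series_bounded (fun j => Rabs (F j)) B) as [He Hl]; auto.
  - now rewrite H0, Rabs_R0.
  - intros; apply Rabs_pos.
  - split; [now apply ex_series_Rabs|]. eapply Rle_trans; [now apply Series_Rabs|exact Hl].
Qed.

Definition contR (f : R -> R) (a b : R) : Prop :=
  forall t, a <= t <= b -> forall eps, 0 < eps -> exists d, 0 < d /\
    forall s, a <= s <= b -> Rabs (s - t) < d -> Rabs (f s - f t) <= eps.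

Lemma contR_const c a b : contR (fun _ => c) a b.
Proof. intros t Ht eps He. exists 1. split; [lra|]. intros. rewrite Rminus_diag, Rabs_R0. lra. Qed.

Lemma contR_plus f g a b : contR f a b -> contR g a b -> contR (fun t => f t + g t) a b.
Proof.
  intros Hf Hg t Ht eps He. destruct (Hf t Ht (eps / 2) ltac:(lra)) as [d [Hd H]].
  destruct (Hg t Ht (eps / 2) ltac:(lra)) as [d' [Hd' H']].
  exists (Rmin d d'). split; [apply Rmin_pos; auto|]. intros s Hs Hst.
  pose proof (Rmin_l d d'). pose proof (Rmin_r d d').
  specialize (H s Hs ltac:(lra)). specialize (H' s Hs ltac:(lra)).
  replace (f s + g s - (f t + g t)) with ((f s - f t) + (g s - g t)) by ring.
  eapply Rle_trans; [apply Rabs_triang|lra].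
Qed.

Lemma contR_scal c f a b : contR f a b -> contR (fun t => c * f t) a b.
Proof.
  intros Hf t Ht eps He. pose proof (Rabs_pos c).
  destruct (Hf t Ht (eps / (1 + Rabs c))) as [d [Hd H']]; [apply Rdiv_lt_0_compat; lra|].
  exists d. split; auto. intros s Hs Hst. specialize (H' s Hs Hst).
  rewrite <- Rmult_minus_distr_l, Rabs_mult.
  assert (eps / (1 + Rabs c) * (1 + Rabs c) = eps) by (field; lra).
  assert (0 < eps / (1 + Rabs c)) by (apply Rdiv_lt_0_compat; lra).
  pose proof (Rabs_pos (f s - f t)). nra.
Qed.

Lemma contR_sum1 N (f : nat -> R -> R) a b :
  (forall n, (1 <= n <= N)%nat -> contR (f n) a b) -> contR (fun t => sum1 N (fun n => f n t)) a b.
Proof.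
  induction N as [|N IH]; intros H; simpl.
  - apply contR_const.
  - apply contR_plus; [apply IH; intros; apply H; lia|apply H; lia].
Qed.

Lemma contR_ext f g a b : contR f a b -> (forall t, a <= t <= b -> g t = f t) -> contR g a b.
Proof.
  intros Hf E t Ht eps He. destruct (Hf t Ht eps He) as [d [Hd H]]. exists d; split; auto.
  intros s Hs Hst. rewrite !E by auto. auto.
Qed.

Lemma cont_on_finite v (g : R -> seqR) J a b : wpos v ->
  (forall t, a <= t <= b -> g t 0%nat = 0) ->
  (forall t n, a <= t <= b -> (J < n)%nat -> g t n = 0) ->
  (forall n, (1 <= n <= J)%nat -> contR (fun t => g t n) a b) -> cont_on v g a b.
Proof.
  intros Hv H0 HJ Hc. split.
  - intros t Ht. eexists. apply nle_fin with (N := J); auto.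
  - intros t Ht eps He.
    assert (Hc' : contR (fun s => sum1 J (fun n => v n * Rabs (g s n - g t n))) a b).
    { apply (contR_sum1 J (fun n s => v n * Rabs (g s n - g t n))). intros n Hn.
      apply (contR_scal (v n) (fun s => Rabs (g s n - g t n))).
      intros r Hr e Hee. destruct (Hc n Hn r Hr e Hee) as [d [Hd H]]. exists d; split; auto.
      intros s Hs Hsr. eapply Rle_trans; [apply Rabs_triang_inv2|].
      replace (g s n - g t n - (g r n - g t n)) with (g s n - g r n) by ring. auto. }
    destruct (Hc' t Ht eps He) as [d [Hd H]]. exists d; split; auto. intros s Hs Hst.
    specialize (H s Hs Hst). rewrite (sum1_0 J (fun n => v n * Rabs (g t n - g t n))), Rminus_0_r in H.
    2: { intros; rewrite Rminus_diag, Rabs_R0; lra. }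
    apply nle_weaken with (sum1 J (fun n => v n * Rabs (g s n - g t n))).
    + apply (nle_fin v (vsub (g s) (g t)) J); auto; unfold vsub.
      * rewrite !H0 by auto; lra.
      * intros n Hn. rewrite !HJ by auto; lra.
    + eapply Rle_trans; [apply Rle_abs|exact H].
Qed.

(** The bilinear form whose diagonal is [coagK]; the Lipschitz estimate for [coagK] reduces to its
    boundedness. *)
Definition coagQ (k : nat -> nat -> R -> R) (t : R) (f g : seqR) : seqR :=
  fun n => match n with
  | O => 0
  | S _ => / 2 * sum1 (n - 1)%nat (fun j => k (n - j)%nat j t * f (n - j)%nat * g j)
           - Series (fun j => k n j t * f n * g j)
  end.

Section CoagulationAt.
Variables (k : nat -> nat -> R -> R) (w wt : seqR) (t c : R).
Hypothesis Hw : wpos w.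
Hypothesis Hwmon : forall n m, (1 <= n)%nat -> (n <= m)%nat -> w n <= w m.
Hypothesis Hwwt : forall n, (1 <= n)%nat -> w n <= wt n.
Hypothesis Hc : 0 <= c.
Hypothesis Hk0 : forall n j, (1 <= n)%nat -> (1 <= j)%nat -> 0 <= k n j t.
Hypothesis Hkb : forall n j, (1 <= n)%nat -> (1 <= j)%nat -> k n j t <= c * wt n * wt j / w (n + j)%nat.

Let Hwt : wpos wt.
Proof. intros n Hn. pose proof (Hw n Hn). pose proof (Hwwt n Hn). lra. Qed.

Lemma coag_weight_sum n j : (1 <= n)%nat -> (1 <= j)%nat -> w (n + j)%nat * k n j t <= c * wt n * wt j.
Proof.
  intros Hn Hj. pose proof (Hkb n j Hn Hj). pose proof (Hw (n + j)%nat ltac:(lia)).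
  apply Rle_trans with (w (n + j)%nat * (c * wt n * wt j / w (n + j)%nat)).
  - apply Rmult_le_compat_l; lra.
  - right; field; lra.
Qed.

Lemma coag_weight_left n j : (1 <= n)%nat -> (1 <= j)%nat -> w n * k n j t <= c * wt n * wt j.
Proof.
  intros Hn Hj. eapply Rle_trans; [|apply coag_weight_sum; auto].
  apply Rmult_le_compat_r; auto. apply Hwmon; lia.
Qed.

Lemma coag_loss f g M n : (1 <= n)%nat -> nle wt g M ->
  ex_series (fun j => k n j t * f n * g j) /\
  w n * Rabs (Series (fun j => k n j t * f n * g j)) <= c * M * (wt n * Rabs (f n)).
Proof.
  intros Hn Hg. pose proof (Hw n Hn).
  destruct (Series_abs_le (fun j => k n j t * f n * g j) (/ w n * (c * M * (wt n * Rabs (f n))))) as [H1 H2].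
  - rewrite (proj1 Hg). ring.
  - intros J. destruct Hg as [_ Hg].
    apply Rle_trans with (/ w n * (c * (wt n * Rabs (f n))) * sum1 J (fun j => wt j * Rabs (g j))).
    + rewrite <- sum1_scal. apply sum1_le; intros j Hj.
      pose proof (coag_weight_left n j Hn ltac:(lia)).
      rewrite !Rabs_mult, (Rabs_pos_eq (k n j t)) by (apply Hk0; lia).
      apply Rmult_le_reg_l with (w n); auto.
      replace (w n * (k n j t * Rabs (f n) * Rabs (g j))) with (w n * k n j t * (Rabs (f n) * Rabs (g j))) by ring.
      replace (w n * (/ w n * (c * (wt n * Rabs (f n))) * (wt j * Rabs (g j))))
        with (c * wt n * wt j * (Rabs (f n) * Rabs (g j))) by (field; lra).
      apply Rmult_le_compat_r; auto. apply Rmult_le_pos; apply Rabs_pos.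
    + replace (/ w n * (c * M * (wt n * Rabs (f n)))) with (/ w n * (c * (wt n * Rabs (f n))) * M) by ring.
      apply Rmult_le_compat_l; auto. apply Rmult_le_pos; [left; now apply Rinv_0_lt_compat|].
      apply Rmult_le_pos; auto. apply Rmult_le_pos; [left; apply Hwt; auto|apply Rabs_pos].
  - split; auto. apply Rle_trans with (w n * (/ w n * (c * M * (wt n * Rabs (f n))))).
    + apply Rmult_le_compat_l; [lra|auto].
    + right; field; lra.
Qed.

(** In the gain term the weight at [(n - j) + j] cancels the denominator of the kernel bound; in the
    loss term monotonicity gives [w n <= w (n + j)]. Each contributes [c * M * N], the factor [/ 2]
    of the gain being given away. *)
Lemma coagQ_nle f g M N : nle wt f M -> nle wt g N -> nle w (coagQ k t f g) (2 * c * M * N).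
Proof.
  intros Hf Hg. split; [reflexivity|]. intros K.
  pose proof (nle_nonneg _ _ _ Hf) as HM. pose proof (nle_nonneg _ _ _ Hg) as HN.
  set (F := fun i => wt i * Rabs (f i)). set (G := fun i => wt i * Rabs (g i)).
  assert (HF : forall i, (1 <= i)%nat -> 0 <= F i).
  { intros i Hi. apply Rmult_le_pos; [left; auto|apply Rabs_pos]. }
  assert (HG : forall i, (1 <= i)%nat -> 0 <= G i).
  { intros i Hi. apply Rmult_le_pos; [left; auto|apply Rabs_pos]. }
  apply Rle_trans with (sum1 K (fun n => sum1 (n - 1) (fun j => c * F (n - j)%nat * G j)) + sum1 K (fun n => c * N * F n)).
  - rewrite <- sum1_plus. apply sum1_le; intros n Hn. destruct n as [|n]; [lia|].
    unfold coagQ. set (m := S n) in *. pose proof (Hw m ltac:(lia)).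
    destruct (coag_loss f g N m ltac:(lia) Hg) as [_ Hl].
    set (ls := Series (fun j => k m j t * f m * g j)) in *.
    set (gn := sum1 (m - 1) (fun j => k (m - j)%nat j t * f (m - j)%nat * g j)).
    assert (Hgn : w m * Rabs gn <= sum1 (m - 1) (fun j => c * F (m - j)%nat * G j)).
    { apply Rle_trans with (w m * sum1 (m - 1) (fun j => Rabs (k (m - j)%nat j t * f (m - j)%nat * g j))).
      - apply Rmult_le_compat_l; [lra|apply sum1_abs].
      - rewrite <- sum1_scal. apply sum1_le; intros j Hj.
        rewrite !Rabs_mult, (Rabs_pos_eq (k _ _ _)) by (apply Hk0; lia).
        pose proof (coag_weight_sum (m - j) j ltac:(lia) ltac:(lia)) as Hs.
        replace (m - j + j)%nat with m in Hs by lia. unfold F, G.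
        replace (c * (wt (m - j)%nat * Rabs (f (m - j)%nat)) * (wt j * Rabs (g j)))
          with (c * wt (m - j)%nat * wt j * (Rabs (f (m - j)%nat) * Rabs (g j))) by ring.
        replace (w m * (k (m - j)%nat j t * Rabs (f (m - j)%nat) * Rabs (g j)))
          with (w m * k (m - j)%nat j t * (Rabs (f (m - j)%nat) * Rabs (g j))) by ring.
        apply Rmult_le_compat_r; auto. apply Rmult_le_pos; apply Rabs_pos. }
    assert (Ht : Rabs (/ 2 * gn - ls) <= / 2 * Rabs gn + Rabs ls).
    { eapply Rle_trans; [apply Rabs_triang|]. rewrite Rabs_Ropp, Rabs_mult, (Rabs_pos_eq (/ 2)); lra. }
    pose proof (Rabs_pos gn). unfold F at 2.
    assert (w m * Rabs (/ 2 * gn - ls) <= w m * (/ 2 * Rabs gn + Rabs ls)) by (apply Rmult_le_compat_l; lra).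
    pose proof (Rmult_le_pos _ _ (Rlt_le _ _ H) H0). lra.
  - rewrite (sum1_diag K (fun i j => c * F i * G j)), sum1_scal.
    assert (H1 : sum1 K F <= M) by apply Hf. assert (H2 : sum1 K G <= N) by apply Hg.
    assert (sum1 K (fun j => sum1 (K - j) (fun i => c * F i * G j)) <= c * M * N).
    { apply Rle_trans with (sum1 K (fun j => c * M * G j)).
      - apply sum1_le; intros j Hj. rewrite (sum1_ext _ _ (fun i => (c * G j) * F i)) by (intros; ring).
        rewrite sum1_scal. replace (c * M * G j) with (c * G j * M) by ring.
        apply Rmult_le_compat_l; [apply Rmult_le_pos; auto; apply HG; lia|].
        eapply Rle_trans; [|exact H1]. apply sum1_mono; [lia|]. intros; apply HF; lia.
      - rewrite sum1_scal. apply Rmult_le_compat_l; auto. now apply Rmult_le_pos. }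
    assert (c * N * sum1 K F <= c * N * M) by (apply Rmult_le_compat_l; auto; now apply Rmult_le_pos).
    lra.
Qed.

Lemma coagK_diff f g M N n : nle wt f M -> nle wt g N ->
  coagK k t f n - coagK k t g n = coagQ k t f (vsub f g) n + coagQ k t (vsub f g) g n.
Proof.
  intros Hf Hg. destruct n as [|n]; [simpl; lra|]. unfold coagK, coagQ. set (m := S n).
  pose proof (nle_sub wt Hwt f g M N Hf Hg) as Hd.
  destruct (coag_loss f f M m ltac:(lia) Hf) as [E1 _].
  destruct (coag_loss g g N m ltac:(lia) Hg) as [E2 _].
  destruct (coag_loss f _ _ m ltac:(lia) Hd) as [E3 _].
  destruct (coag_loss (vsub f g) _ _ m ltac:(lia) Hg) as [E4 _].
  assert (HS : Series (fun j => k m j t * f m * f j) - Series (fun j => k m j t * g m * g j) =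
               Series (fun j => k m j t * f m * vsub f g j) + Series (fun j => k m j t * vsub f g m * g j)).
  { rewrite <- Series_minus, <- Series_plus by auto. apply Series_ext. intros j. unfold vsub. ring. }
  assert (HG : sum1 (m - 1) (fun j => k (m - j)%nat j t * f (m - j)%nat * f j)
               - sum1 (m - 1) (fun j => k (m - j)%nat j t * g (m - j)%nat * g j) =
               sum1 (m - 1) (fun j => k (m - j)%nat j t * f (m - j)%nat * vsub f g j)
               + sum1 (m - 1) (fun j => k (m - j)%nat j t * vsub f g (m - j)%nat * g j)).
  { rewrite <- sum1_minus, <- sum1_plus. apply sum1_ext; intros j _. unfold vsub. ring. }
  lra.
Qed.

Lemma coagK_lip f g R1 D : nle wt f R1 -> nle wt g R1 -> nle wt (vsub f g) D ->
  nle w (vsub (coagK k t f) (coagK k t g)) (4 * c * R1 * D).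
Proof.
  intros Hf Hg HD. apply nle_ext with (vadd (coagQ k t f (vsub f g)) (coagQ k t (vsub f g) g)); auto.
  - replace (4 * c * R1 * D) with (2 * c * R1 * D + 2 * c * D * R1) by ring.
    apply nle_add; auto; apply coagQ_nle; auto.
  - intros n. unfold vsub at 1. rewrite (coagK_diff f g R1 R1) by auto. reflexivity.
Qed.

Lemma coagK_zero n : coagK k t (fun _ => 0) n = 0.
Proof.
  assert (Hz : nle wt (fun _ => 0) 0) by (apply nle_zero; auto; lra).
  pose proof (coagQ_nle _ _ 0 0 Hz Hz) as H. rewrite Rmult_0_r in H.
  exact (nle_eq0 w Hw _ H n).
Qed.

Lemma coagK_nle f M : nle wt f M -> nle w (coagK k t f) (2 * c * M * M).
Proof. intros Hf. apply coagQ_nle; auto. Qed.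

Lemma coagK_finite f J n : (forall i, (J < i)%nat -> f i = 0) -> f 0%nat = 0 -> (1 <= n)%nat ->
  coagK k t f n = / 2 * sum1 (n - 1) (fun j => k (n - j)%nat j t * f (n - j)%nat * f j)
                  - sum1 J (fun j => k n j t * f n * f j).
Proof.
  intros Hz H0 Hn. destruct n as [|n]; [lia|]. unfold coagK. f_equal.
  refine (proj2 (Series_finite _ J _ _)); [rewrite H0; ring|]. intros j Hj. rewrite (Hz j) by auto. ring.
Qed.

Lemma coagK_finite_supp f J n : (forall i, (J < i)%nat -> f i = 0) -> f 0%nat = 0 -> (2 * J < n)%nat ->
  coagK k t f n = 0.
Proof.
  intros Hz H0 Hn. rewrite (coagK_finite f J) by (auto; lia).
  rewrite !sum1_0; [lra| |].
  - intros j Hj. rewrite (Hz n) by lia. ring.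
  - intros j Hj. destruct (Nat.le_gt_cases j J); [rewrite (Hz (n - j)%nat) by lia; ring|].
    rewrite (Hz j) by lia. ring.
Qed.

Hypothesis Hksym : forall n j, (1 <= n)%nat -> (1 <= j)%nat -> k n j t = k j n t.

(** Writing [n = i + j] on each anti-diagonal splits the weighted gain into two sums that are equal
    by symmetry of [k], and their halves add up to the loss. Nonzero products have [i + j <= 2 J],
    so the triangle may be completed to a square. *)
Lemma coagK_finite_mass f J : (forall i, (J < i)%nat -> f i = 0) -> f 0%nat = 0 -> phi1 (coagK k t f) = 0.
Proof.
  intros Hz H0. unfold phi1.
  destruct (Series_finite (fun n => INR n * coagK k t f n) (2 * J)) as [_ ->]; [simpl; ring| |].
  { intros n Hn. rewrite (coagK_finite_supp f J) by auto. ring. }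
  set (P := (2 * J)%nat). set (G := fun i j => k i j t * f i * f j).
  assert (HGz : forall i j, (P < i + j)%nat -> G i j = 0).
  { intros i j Hij. unfold G. destruct (Nat.le_gt_cases j J); [rewrite (Hz i) by (unfold P in *; lia); ring|].
    rewrite (Hz j) by lia. ring. }
  rewrite (sum1_ext P _ (fun n => sum1 (n - 1) (fun j => / 2 * INR (n - j + j) * G (n - j)%nat j)
                                  - sum1 P (fun j => INR n * G n j))).
  2: { intros n Hn. rewrite (coagK_finite f P) by (auto; try lia; intros; apply Hz; unfold P in *; lia).
       rewrite Rmult_minus_distr_l, <- !sum1_scal. f_equal.
       apply sum1_ext; intros j Hj. replace (n - j + j)%nat with n by lia. unfold G. ring. }
  rewrite sum1_minus, (sum1_diag P (fun i j => / 2 * INR (i + j) * G i j)).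
  rewrite (sum1_ext P (fun j => sum1 (P - j) _) (fun j => sum1 P (fun i => / 2 * (INR i * G i j)) + sum1 P (fun i => / 2 * (INR j * G j i)))).
  2: { intros j Hj. rewrite <- sum1_plus. rewrite <- (sum1_pad (P - j) P); [|lia|].
       - apply sum1_ext; intros i Hi. rewrite plus_INR. unfold G. rewrite (Hksym j i) by lia. ring.
       - intros i Hi. rewrite !HGz by lia. ring. }
  rewrite sum1_plus, sum1_swap.
  rewrite <- sum1_plus.
  rewrite (sum1_ext P _ (fun n => sum1 P (fun j => INR n * G n j))); [ring|].
  intros n Hn. rewrite <- sum1_plus. apply sum1_ext; intros j Hj. field.
Qed.

(** Truncations of [f] conserve mass exactly; [coagK_lip] and the continuity of [phi1] on [l^1_w]
    carry this to the limit. *)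
Lemma coagK_mass f M : (forall n, (1 <= n)%nat -> INR n <= w n) -> nle wt f M -> phi1 (coagK k t f) = 0.
Proof.
  intros Hwn Hf. pose proof (nle_nonneg _ _ _ Hf) as HM.
  apply Rabs_eq_0, Rle_antisym; [|apply Rabs_pos]. apply le_epsilon. intros eps He.
  assert (Hp : 0 <= 4 * c * M) by (apply Rmult_le_pos; lra).
  destruct (nle_tail wt Hwt f M (eps / (1 + 4 * c * M)) Hf) as [N HN]; [apply Rdiv_lt_0_compat; lra|].
  specialize (HN N (Nat.le_refl N)). pose proof (nle_trunc wt Hwt N f M Hf) as HT.
  pose proof (coagK_lip f _ M _ Hf HT HN) as HD.
  pose proof (phi1_lip w Hw Hwn _ _ _ _ _ (coagK_nle f M Hf) (coagK_nle _ M HT) HD) as H.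
  rewrite (coagK_finite_mass (trunc N f) N) in H; [|apply trunc_supp|apply HT].
  rewrite Rminus_0_r in H. eapply Rle_trans; [exact H|].
  apply Rmult_le_reg_r with (1 + 4 * c * M); [lra|]. field_simplify; [|lra]. nra.
Qed.

Lemma coagK_pos_lower f M n : nle wt f M -> (forall n, 0 <= f n) -> (1 <= n)%nat ->
  - (c * M * wt n / w n * f n) <= coagK k t f n.
Proof.
  intros Hf Hp Hn. destruct (coag_loss f f M n Hn Hf) as [_ Hl]. pose proof (Hw n Hn).
  destruct n as [|n]; [lia|]. unfold coagK. set (m := S n) in *.
  set (ls := Series (fun j => k m j t * f m * f j)) in *.
  assert (0 <= sum1 (m - 1) (fun j => k (m - j)%nat j t * f (m - j)%nat * f j)).
  { apply sum1_ge0. intros j Hj. apply Rmult_le_pos; auto. apply Rmult_le_pos; auto. apply Hk0; lia. }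
  rewrite (Rabs_pos_eq (f m)) in Hl by auto. pose proof (Rle_abs ls).
  assert (ls <= c * M * wt m / w m * f m); [|lra].
  apply Rmult_le_reg_l with (w m); auto.
  replace (w m * (c * M * wt m / w m * f m)) with (c * M * (wt m * f m)) by (field; lra). nra.
Qed.

Lemma coagK_pos_gain f n : (forall n, 0 <= f n) -> (1 <= n)%nat -> f n = 0 -> 0 <= coagK k t f n.
Proof.
  intros Hp Hn H0. destruct n as [|n]; [lia|]. unfold coagK. rewrite H0.
  rewrite (Series_zero (fun j => k (S n) j t * 0 * f j)) by (intros; ring).
  assert (0 <= sum1 (S n - 1) (fun j => k (S n - j)%nat j t * f (S n - j)%nat * f j)); [|lra].
  apply sum1_ge0. intros j Hj. apply Rmult_le_pos; auto. apply Rmult_le_pos; auto. apply Hk0; lia.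
Qed.

Definition pospart (f : seqR) : seqR := fun n => Rmax (f n) 0.

Lemma pospart_nle v f M : wpos v -> nle v f M -> nle v (pospart f) M.
Proof.
  intros Hv Hf. apply nle_le_abs with f; auto; unfold pospart.
  - rewrite (proj1 Hf). apply Rmax_left; lra.
  - intros n _. rewrite (Rabs_pos_eq (Rmax _ _)) by apply Rmax_r.
    apply Rmax_lub; [apply Rle_abs|apply Rabs_pos].
Qed.

Lemma pospart_lip v f g D : wpos v -> nle v (vsub f g) D -> f 0%nat = 0 -> g 0%nat = 0 ->
  nle v (vsub (pospart f) (pospart g)) D.
Proof.
  intros Hv H F0 G0. apply nle_le_abs with (vsub f g); auto; unfold vsub, pospart.
  - rewrite F0, G0. lra.
  - intros n _. pose proof (Rmax_0_lip (f n) (g n)). pose proof (Rmax_0_lip (g n) (f n)).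
    rewrite (Rabs_minus_sym (g n)) in H1. apply Rabs_le. lra.
Qed.

(* The loss rate at [n] is at most [c * M * wt n / w n], which is unbounded in [n]; hence for a given
   step [h] only the coordinates [n <= N] are kept non-negative, and the tail of [f] in l^1_wt
   pays for the others. *)
Lemma coag_step_positivity f M : nle wt f M -> forall eps, 0 < eps -> exists d, 0 < d /\ forall h, 0 < h < d ->
  halfnorm w (vscal (-1) (vadd f (vscal h (coagK k t (pospart f))))) <= halfnorm w (vscal (-1) f) + eps * h.
Proof.
  intros Hf eps He. pose proof (nle_nonneg _ _ _ Hf) as HM.
  pose proof (pospart_nle wt f M Hwt Hf) as Hfp.
  assert (Hww : forall n, (1 <= n)%nat -> 0 <= w n <= w n) by (intros n Hn; pose proof (Hw n Hn); lra).
  assert (Hfw : nle w f M) by (apply nle_mono_weight with wt; auto).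
  assert (Hmf : nle w (vscal (-1) f) (Rabs (-1) * M)) by (apply nle_scal; auto).
  assert (HcM : 0 <= c * M) by (apply Rmult_le_pos; auto).
  destruct (nle_tail wt Hwt f M (eps / (1 + c * M)) Hf) as [N HN]; [apply Rdiv_lt_0_compat; lra|].
  specialize (HN N (Nat.le_refl N)). destruct HN as [_ HN].
  set (lam := fun n => c * M * wt n / w n). set (g := coagK k t (pospart f)).
  assert (Hlam : forall n, (1 <= n)%nat -> 0 <= lam n).
  { intros n Hn. apply Rmult_le_pos; [apply Rmult_le_pos; auto; left; auto|].
    left; apply Rinv_0_lt_compat; auto. }
  assert (Hl0 : 0 <= sum1 N lam) by (apply sum1_ge0; intros; apply Hlam; lia).
  (* Below this value [h * lam n <= 1] for every [n <= N], so one explicit loss step cannot carry a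
     positive entry below 0 there. *)
  exists (/ (1 + sum1 N lam)). split; [apply Rinv_0_lt_compat; lra|]. intros h Hh.
  apply halfnorm_le with w; auto.
  { unfold vscal, vadd. rewrite (proj1 Hf). simpl. lra. }
  intros K. pose proof (sum1_le_halfnorm w w Hww _ _ K Hmf) as HK. specialize (HN K).
  apply Rle_trans with (sum1 K (fun n => w n * Rmax (vscal (-1) f n) 0)
                       + h * (c * M) * sum1 K (fun n => wt n * Rabs (vsub f (trunc N f) n))).
  - rewrite <- sum1_scal, <- sum1_plus. apply sum1_le; intros n Hn.
    pose proof (Hw n ltac:(lia)) as Hwn. pose proof (Hwt n ltac:(lia)) as Hwtn.
    pose proof (Hlam n ltac:(lia)) as Hln.
    assert (HR : 0 <= h * (c * M) * (wt n * Rabs (vsub f (trunc N f) n))).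
    { apply Rmult_le_pos; [apply Rmult_le_pos; lra|]. apply Rmult_le_pos; [lra|apply Rabs_pos]. }
    unfold vscal at 1, vadd at 1, vscal at 1. unfold vscal at 1.
    destruct (Rle_lt_dec (f n) 0) as [Hle|Hgt].
    + assert (Hg : 0 <= g n).
      { apply coagK_pos_gain; [intros; apply Rmax_r|lia|]. unfold pospart. now apply Rmax_right. }
      assert (0 <= h * g n) by (apply Rmult_le_pos; lra).
      assert (Rmax (-1 * (f n + h * g n)) 0 <= Rmax (-1 * f n) 0).
      { apply Rmax_lub; [|apply Rmax_r]. eapply Rle_trans; [|apply Rmax_l]. lra. }
      assert (w n * Rmax (-1 * (f n + h * g n)) 0 <= w n * Rmax (-1 * f n) 0) by (apply Rmult_le_compat_l; lra).
      fold g. lra.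
    + assert (Hg : - (lam n * f n) <= g n).
      { pose proof (coagK_pos_lower (pospart f) M n Hfp ltac:(intros; apply Rmax_r) ltac:(lia)) as H.
        unfold pospart at 1 in H. rewrite Rmax_left in H by lra. exact H. }
      assert (Hhg : - (h * lam n * f n) <= h * g n).
      { apply Rle_trans with (h * (- (lam n * f n))); [right; ring|apply Rmult_le_compat_l; lra]. }
      rewrite (Rmax_right (-1 * f n)) by lra. fold g. rewrite Rmult_0_r, Rplus_0_l.
      unfold vsub, trunc in *. destruct (Nat.leb_spec n N) as [HnN|HnN].
      * assert (h * lam n <= 1).
        { apply Rle_trans with (/ (1 + sum1 N lam) * (1 + sum1 N lam)); [|right; field; lra].
          apply Rmult_le_compat; try lra.
          assert (lam n <= sum1 N lam); [|lra].
          apply (sum1_term N lam); [lia|]. intros; apply Hlam; lia. }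
        rewrite Rmax_right; [lra|]. nra.
      * rewrite Rminus_0_r, (Rabs_pos_eq (f n)) by lra.
        replace (h * (c * M) * (wt n * f n)) with (w n * (h * lam n * f n)) by (unfold lam; field; lra).
        apply Rmult_le_compat_l; [lra|]. apply Rmax_lub; [lra|].
        apply Rmult_le_pos; [apply Rmult_le_pos|]; lra.
  - apply Rplus_le_compat; auto.
    apply Rle_trans with (h * (c * M) * (eps / (1 + c * M))).
    + apply Rmult_le_compat_l; auto. apply Rmult_le_pos; lra.
    + apply Rmult_le_reg_r with (1 + c * M); [lra|].
      replace (h * (c * M) * (eps / (1 + c * M)) * (1 + c * M)) with (eps * h * (c * M)) by (field; lra).
      assert (0 <= eps * h) by (apply Rmult_le_pos; lra). nra.
Qed.

End CoagulationAt.

(** * Positivity and mass balance for the coagulation equation *)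

Section CoagulationEquation.
Variables (T : Rbar) (k : nat -> nat -> R -> R) (w wt : seqR) (Sg : R -> seqR -> seqR) (alpha C : R).
Hypothesis HSG : smoothing_semigroup w wt Sg alpha C.
Hypothesis Hwmon : forall n m, (1 <= n)%nat -> (n <= m)%nat -> w n <= w m.
Hypothesis Hk0 : forall n j t, (1 <= n)%nat -> (1 <= j)%nat -> 0 <= t -> Rbar_lt t T -> 0 <= k n j t.
Hypothesis Hksym : forall n j t, (1 <= n)%nat -> (1 <= j)%nat -> 0 <= t -> Rbar_lt t T -> k n j t = k j n t.
Hypothesis Hkcont : forall n j t, (1 <= n)%nat -> (1 <= j)%nat -> 0 <= t -> Rbar_lt t T ->
  forall eps, 0 < eps -> exists delta, 0 < delta /\
    forall s, 0 <= s -> Rbar_lt s T -> Rabs (s - t) < delta -> Rabs (k n j s - k n j t) < eps.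
Hypothesis Hkbound : forall t', 0 < t' -> Rbar_lt t' T -> exists c, 0 < c /\
  forall n j t, (1 <= n)%nat -> (1 <= j)%nat -> 0 <= t -> t <= t' ->
    k n j t <= c * wt n * wt j / w (n + j)%nat.

Let Hw : wpos w := sg_w HSG.
Let Hwwt : forall n, (1 <= n)%nat -> w n <= wt n := sg_wt HSG.
Let Hwt : wpos wt := wt_pos _ _ _ _ _ HSG.

Lemma Rbar_lt_mono (s t : R) (T' : Rbar) : s <= t -> Rbar_lt t T' -> Rbar_lt s T'.
Proof. intros H H'. apply Rbar_le_lt_trans with t; auto. Qed.

Lemma coag_bound (T1 : R) : 0 <= T1 -> Rbar_lt T1 T -> exists c, 0 <= c /\
  (forall t, 0 <= t <= T1 -> forall n j, (1 <= n)%nat -> (1 <= j)%nat -> k n j t <= c * wt n * wt j / w (n + j)%nat) /\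
  (forall t, 0 <= t <= T1 -> forall n j, (1 <= n)%nat -> (1 <= j)%nat -> 0 <= k n j t).
Proof.
  intros H0 HT. destruct (Rbar_between T1 T HT) as [T2 [H1 H2]].
  destruct (Hkbound T2 ltac:(lra) H2) as [c [Hc Hb]]. exists c. split; [lra|]. split.
  - intros t Ht n j Hn Hj. apply Hb; auto; lra.
  - intros t Ht n j Hn Hj. apply Hk0; auto; [lra|]. apply Rbar_lt_mono with T1; auto; lra.
Qed.

Lemma coagK_cont (T1 : R) f M : 0 <= T1 -> Rbar_lt T1 T -> nle wt f M ->
  cont_on w (fun t => coagK k t f) 0 T1.
Proof.
  intros H0 HT Hf. destruct (coag_bound T1 H0 HT) as [c [Hc [Hb Hp]]].
  pose proof (nle_nonneg _ _ _ Hf) as HM.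
  assert (HcM : 0 <= 4 * c * M) by (apply Rmult_le_pos; lra).
  apply cont_on_limit; auto. intros eps He.
  destruct (nle_tail wt Hwt f M (eps / (1 + 4 * c * M)) Hf) as [N HN]; [apply Rdiv_lt_0_compat; lra|].
  specialize (HN N (Nat.le_refl N)). pose proof (nle_trunc wt Hwt N f M Hf) as HTr.
  exists (fun t => coagK k t (trunc N f)). split.
  - apply cont_on_finite with (2 * N)%nat; auto.
    + intros t n Ht Hn. apply (coagK_finite_supp k t _ N); auto; [apply trunc_supp|apply HTr].
    + intros n Hn.
      apply contR_ext with (fun t => / 2 * sum1 (n - 1) (fun j => (trunc N f (n - j)%nat * trunc N f j) * k (n - j)%nat j t)
                   + (-1) * sum1 N (fun j => (trunc N f n * trunc N f j) * k n j t)).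
      * assert (Hkc : forall i j x, (1 <= i)%nat -> (1 <= j)%nat -> contR (fun t => x * k i j t) 0 T1).
        { intros i j x Hi Hj. apply contR_scal. intros t Ht e Hee.
          assert (HtT : Rbar_lt t T) by (apply Rbar_lt_mono with T1; auto; lra).
          destruct (Hkcont i j t Hi Hj (proj1 Ht) HtT e Hee) as [d [Hd H]].
          exists d; split; auto. intros s Hs Hst. left. apply H; auto; [lra|].
          apply Rbar_lt_mono with T1; auto; lra. }
        apply contR_plus; apply contR_scal.
        -- apply (contR_sum1 (n - 1) (fun j t => trunc N f (n - j)%nat * trunc N f j * k (n - j)%nat j t)).
           intros j Hj. apply Hkc; lia.
        -- apply (contR_sum1 N (fun j t => trunc N f n * trunc N f j * k n j t)).
           intros j Hj. apply Hkc; lia.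
      * intros t Ht. rewrite (coagK_finite k t _ N); [|apply trunc_supp|apply HTr|lia].
        unfold Rminus. f_equal.
        -- f_equal. apply sum1_ext; intros; ring.
        -- rewrite <- (Rmult_1_l (sum1 N (fun j => k n j t * _ * _))), Ropp_mult_distr_l.
           f_equal. apply sum1_ext; intros; ring.
  - intros t Ht. apply nle_weaken with (4 * c * M * (eps / (1 + 4 * c * M))).
    + apply (coagK_lip k w wt t c); auto.
    + apply Rmult_le_reg_r with (1 + 4 * c * M); [lra|]. field_simplify; [|lra]. nra.
Qed.

Lemma coagK_nonlinearity (T1 : R) : 0 <= T1 -> Rbar_lt T1 T -> nonlinearity w wt (coagK k) T1.
Proof.
  intros H0 HT. destruct (coag_bound T1 H0 HT) as [c [Hc [Hb Hp]]]. constructor.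
  - intros t n Ht. apply (coagK_zero k w wt t c); auto.
  - intros R1 HR. exists (4 * c * R1). split; [apply Rmult_le_pos; lra|].
    intros t f g D Ht Hf Hg HD. apply (coagK_lip k w wt t c); auto.
  - intros f M Hf. now apply coagK_cont with M.
Qed.

Definition coagP (t : R) (f : seqR) : seqR := coagK k t (pospart f).

Lemma coagP_nonlinearity (T1 : R) : 0 <= T1 -> Rbar_lt T1 T -> nonlinearity w wt coagP T1.
Proof.
  intros H0 HT. destruct (coagK_nonlinearity T1 H0 HT) as [Z L K]. constructor.
  - intros t n Ht. unfold coagP. replace (pospart (fun _ => 0)) with (fun _ : nat => 0); [now apply Z|].
    extensionality i. unfold pospart. rewrite Rmax_left; lra.
  - intros R1 HR. destruct (L R1 HR) as [l [Hl Hlip]]. exists l; split; auto.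
    intros t f g D Ht Hf Hg HD. apply Hlip; auto; try (apply pospart_nle; auto).
    apply pospart_lip; auto; [apply Hf|apply Hg].
  - intros f M Hf. apply (K _ M). now apply pospart_nle.
Qed.

(** As [phi] changes by at most the [w]-distance, [sol_right_expansion] lets its Dini derivative
    along [u] be computed on the split step [S(h) u + h F] instead. *)
Lemma sol_functional_le F T1 x M b u (phi : seqR -> R) :
  nonlinearity w wt F T1 -> b <= T1 -> nle wt x M -> sol wt Sg F x b u ->
  (forall f g N D, f 0%nat = 0 -> nle w g N -> nle w (vsub f g) D -> phi f <= phi g + D) ->
  (forall t, 0 <= t < b -> forall eps, 0 < eps -> exists d, 0 < d /\ forall h, 0 < h < d ->
     phi (vadd (Sg h (u t)) (vscal h (F t (u t)))) <= phi (u t) + eps * h) ->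
  phi (u b) <= phi x.
Proof.
  intros HF HbT Hx Hu Hlip Hd.
  replace x with (u 0).
  2: { extensionality n. now apply (sol_initial w wt Sg alpha C HSG F x b u M). }
  assert (Huw : forall t, 0 <= t <= b -> exists N, nle w (u t) N).
  { intros t Ht. destruct (sol_nle _ _ _ _ _ _ t Hu Ht) as [N HN]. exists N. now apply (nle_wt_w w wt Sg alpha C HSG). }
  apply (dini_nonincreasing 0 b (fun t => phi (u t))); [apply Hu| |].
  - intros t Ht eps He. destruct Hu as [_ [Hc _]].
    destruct (proj2 (cont_on_wt_w w wt Sg alpha C HSG u 0 b Hc) t ltac:(lra) eps He) as [d [Hd0 H]].
    exists d; split; auto. intros s Hs Hst. destruct (Huw s ltac:(lra)) as [N HN].
    destruct (Huw t ltac:(lra)) as [N' HN'].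
    apply Hlip with N; auto; [apply HN'|]. apply nle_sym; auto. apply H; [lra|].
    rewrite Rabs_left; lra.
  - intros t Ht eps He. destruct (Hd t Ht (eps / 2) ltac:(lra)) as [d [Hd0 H]].
    destruct (sol_right_expansion w wt Sg alpha C HSG F T1 x M b u t HF HbT Hx Hu Ht (eps / 2) ltac:(lra)) as [d' [Hd' H']].
    exists (Rmin d d'). split; [apply Rmin_pos; auto|]. intros h Hh Hhb.
    pose proof (Rmin_l d d'). pose proof (Rmin_r d d').
    specialize (H h ltac:(lra)). specialize (H' h ltac:(lra) Hhb).
    destruct (sol_nle _ _ _ _ _ _ t Hu ltac:(lra)) as [N HN].
    destruct (Huw (t + h) ltac:(lra)) as [N' HN'].
    assert (HFt : exists B, nle w (F t (u t)) B) by (apply (proj1 (nl_cont _ _ _ _ HF _ _ HN)); lra).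
    destruct HFt as [B HB].
    assert (E : phi (u (t + h)) <= phi (vadd (Sg h (u t)) (vscal h (F t (u t)))) + eps / 2 * h).
    { apply Hlip with (N + Rabs h * B).
      - apply HN'.
      - apply nle_add; auto; [|now apply nle_scal].
        apply (sg_contr HSG); [lra|]. now apply (nle_wt_w w wt Sg alpha C HSG).
      - apply nle_ext with (vsub (vsub (u (t + h)) (Sg h (u t))) (vscal h (F t (u t)))); auto.
        intros n. unfold vsub, vadd. lra. }
    lra.
Qed.

Hypothesis Hhalf : forall f M t, 0 <= t -> nle w f M -> halfnorm w (Sg t f) <= halfnorm w f.

Let Hww : forall n, (1 <= n)%nat -> 0 <= w n <= w n.
Proof. intros n Hn. pose proof (Hw n Hn). lra. Qed.

Lemma coagP_sol_pos (T1 : R) x M b u : 0 <= T1 -> Rbar_lt T1 T -> b <= T1 -> nle wt x M -> (forall n, 0 <= x n) ->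
  sol wt Sg coagP x b u -> forall t n, 0 <= t <= b -> 0 <= u t n.
Proof.
  intros H0 HT HbT Hx Hxp Hu t n Ht.
  apply (sol_sub _ _ _ _ _ t) in Hu; [|lra].
  destruct (coag_bound T1 H0 HT) as [c [Hc [Hb Hp]]].
  assert (Hlip : forall f g N D, f 0%nat = 0 -> nle w g N -> nle w (vsub f g) D ->
            halfnorm w (vscal (-1) f) <= halfnorm w (vscal (-1) g) + D).
  { intros f g N D F0 Hg HD. apply (halfnorm_lip w w Hww) with (Rabs (-1) * N).
    - unfold vscal. rewrite F0. lra.
    - now apply nle_scal.
    - apply nle_ext with (vsub g f); [auto|now apply nle_sym|]. intros i. unfold vsub, vscal. lra. }
  assert (H : halfnorm w (vscal (-1) (u t)) <= halfnorm w (vscal (-1) x)).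
  { apply (sol_functional_le coagP T1 x M t u (fun f => halfnorm w (vscal (-1) f))); auto; [now apply coagP_nonlinearity|lra|].
    intros s Hs eps He. destruct (sol_nle _ _ _ _ _ _ s Hu ltac:(lra)) as [N HN].
    set (f := u s) in *. set (g := coagP s f).
    assert (Hgw : nle w g (2 * c * N * N)).
    { apply (coagK_nle k w wt s c); auto; [apply Hp; lra|apply Hb; lra|]. now apply pospart_nle. }
    destruct (coag_step_positivity k w wt s c Hw Hwmon Hwwt Hc ltac:(apply Hp; lra) ltac:(apply Hb; lra)
               f N HN (eps / 2) ltac:(lra)) as [d [Hd H]].
    destruct (sg_cont HSG g _ Hgw 0 ltac:(lra) (eps / 2) ltac:(lra)) as [d' [Hd' H']].
    rewrite (sg_0 HSG _ _ Hgw) in H'.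
    exists (Rmin d d'). split; [apply Rmin_pos; auto|]. intros h Hh.
    pose proof (Rmin_l d d'). pose proof (Rmin_r d d').
    specialize (H h ltac:(lra)). specialize (H' h ltac:(lra) ltac:(rewrite Rabs_pos_eq; lra)).
    change (coagK k s (pospart f)) with g in H. pose proof (nle_wt_w w wt Sg alpha C HSG _ _ HN) as HNw.
    set (y := vadd f (vscal h g)) in *.
    assert (Hy : nle w y (N + Rabs h * (2 * c * N * N))) by (apply nle_add; auto; now apply nle_scal).
    (* [S(h) f + h g] differs from [S(h) (f + h g)] by [h (S(h) g - g)], which is [o(h)]. In the
       second form [S(h)] can be removed, as it does not increase the half-norm, and the pure
       coagulation step remains. *)
    assert (E1 : halfnorm w (vscal (-1) (vadd (Sg h f) (vscal h g))) <= halfnorm w (vscal (-1) (Sg h y)) + h * (eps / 2)).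
    { apply Hlip with (N + Rabs h * (2 * c * N * N)).
      - unfold vadd, vscal. rewrite (proj1 Hgw), (proj1 (sg_contr HSG _ _ h ltac:(lra) HNw)). lra.
      - apply (sg_contr HSG); auto; lra.
      - unfold y. rewrite (sg_lin HSG h h f g N (2 * c * N * N)) by (auto; lra).
        apply nle_ext with (vscal (- h) (vsub (Sg h g) g)); auto.
        + replace (h * (eps / 2)) with (Rabs (- h) * (eps / 2)) by (rewrite Rabs_Ropp, Rabs_pos_eq; lra).
          now apply nle_scal.
        + intros i. unfold vsub, vadd, vscal. lra. }
    assert (E2 : halfnorm w (vscal (-1) (Sg h y)) <= halfnorm w (vscal (-1) y)).
    { rewrite <- (S_scal w wt Sg alpha C HSG h (-1) y _ ltac:(lra) Hy).
      apply Hhalf with (Rabs (-1) * (N + Rabs h * (2 * c * N * N))); [lra|]. now apply nle_scal. }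
    lra. }
  destruct (sol_nle _ _ _ _ _ _ t Hu ltac:(lra)) as [N HN].
  destruct n as [|n]; [right; symmetry; apply HN|].
  assert (HNw : nle w (vscal (-1) (u t)) (Rabs (-1) * N)).
  { apply nle_scal; auto. now apply (nle_wt_w w wt Sg alpha C HSG). }
  assert (Hle : vscal (-1) (u t) (S n) <= 0).
  { apply (halfnorm_0_nonpos w w _ _ _ Hww HNw); [|lia|apply Hw; lia].
    eapply Rle_trans; [exact H|]. apply (halfnorm_le w w Hww).
    - unfold vscal. rewrite (proj1 Hx). lra.
    - intros K. rewrite sum1_0; [lra|]. intros i _. unfold vscal. specialize (Hxp i). rewrite Rmax_right; lra. }
  unfold vscal in Hle. lra.
Qed.

(** [K] has zero first moment, so only the behaviour of the moment under [S(h)] remains. The sign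
    [sg] lets one proof give the upper bound and, used twice, the equality. *)
Lemma coag_sol_mass (T1 : R) x M b u sg : (forall n, (1 <= n)%nat -> INR n <= w n) ->
  0 <= T1 -> Rbar_lt T1 T -> b <= T1 -> nle wt x M -> Rabs sg = 1 ->
  sol wt Sg (coagK k) x b u -> 
  (forall t h, 0 <= t <= b -> 0 <= h -> sg * phi1 (Sg h (u t)) <= sg * phi1 (u t)) -> sg * phi1 (u b) <= sg * phi1 x.
Proof.
  intros Hwn H0 HT HbT Hx Hsg Hu Hm.
  destruct (coag_bound T1 H0 HT) as [c [Hc [Hb Hp]]].
  apply (sol_functional_le (coagK k) T1 x M b u (fun f => sg * phi1 f)); auto; [now apply coagK_nonlinearity| |].
  - intros f g N D F0 Hg HD.
    assert (Hf : nle w f (D + N)) by (apply nle_of_sub with g; auto).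
    pose proof (phi1_lip w Hw Hwn f g _ _ D Hf Hg HD) as H.
    pose proof (Rle_abs (sg * (phi1 f - phi1 g))) as H'. rewrite Rabs_mult, Hsg in H'. lra.
  - intros t Ht eps He. exists 1. split; [lra|]. intros h Hh.
    destruct (sol_nle _ _ _ _ _ _ t Hu ltac:(lra)) as [N HN].
    rewrite (phi1_lin w Hwn h (Sg h (u t)) (coagK k t (u t)) N (2 * c * N * N)).
    + assert (Hz : phi1 (coagK k t (u t)) = 0).
      { apply (coagK_mass k w wt t c) with (M := N); auto; [apply Hp; lra|apply Hb; lra|].
        intros n j Hn Hj. apply Hksym; auto; [lra|]. apply Rbar_lt_mono with T1; auto; lra. }
      rewrite Hz. specialize (Hm t h ltac:(lra) ltac:(lra)).
      assert (0 < eps * h) by (apply Rmult_lt_0_compat; lra). lra.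
    + apply (sg_contr HSG); [lra|]. now apply (nle_wt_w w wt Sg alpha C HSG).
    + apply (coagK_nle k w wt t c); auto; [apply Hp; lra|apply Hb; lra].
Qed.

End CoagulationEquation.

(** * Maximal mild solutions *)

Section MildSolutions.
Variables (T : Rbar) (k : nat -> nat -> R -> R) (w wt : seqR) (Sg : R -> seqR -> seqR) (alpha C : R).
Hypothesis HSG : smoothing_semigroup w wt Sg alpha C.
Hypothesis HF : forall T1 : R, 0 <= T1 -> Rbar_lt T1 T -> nonlinearity w wt (coagK k) T1.

Let Hw : wpos w := sg_w HSG.
Let Hwt : wpos wt := wt_pos _ _ _ _ _ HSG.

Lemma mild_solution_sol x t1 u : mild_solution T w wt Sg k x t1 u ->
  forall b : R, 0 <= b -> Rbar_lt b t1 -> sol wt Sg (coagK k) x b u.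
Proof.
  intros [H0 [HT [Hin [Hc Hint]]]] b Hb Hbt.
  assert (Hlt : forall t : R, t <= b -> Rbar_lt t t1) by (intros t Ht; now apply Rbar_lt_mono with b).
  split; auto. split; [split|].
  - intros t Ht. exists (l1norm wt (u t)). apply in_l1_nle; auto. apply Hin; [lra|apply Hlt; lra].
  - intros t Ht eps He. destruct (Hc t ltac:(lra) (Hlt t ltac:(lra)) eps He) as [d [Hd H]].
    exists d; split; auto. intros s Hs Hst. apply nle_weaken with (l1norm wt (vsub (u s) (u t))).
    + apply in_l1_nle; auto. eapply nle_in_l1; auto.
      apply nle_sub; auto; apply in_l1_nle; auto; apply Hin; try lra; apply Hlt; lra.
    + left. apply H; auto; [lra|apply Hlt; lra].
  - intros t Ht n. apply Hint; [lra|apply Hlt; lra].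
Qed.

Lemma sol_mild_solution x t1 u : Rbar_lt 0 t1 -> Rbar_le t1 T ->
  (forall b : R, 0 <= b -> Rbar_lt b t1 -> sol wt Sg (coagK k) x b u) -> mild_solution T w wt Sg k x t1 u.
Proof.
  intros H0 HT Hs. split; auto. split; auto.
  assert (Hb : forall t : R, Rbar_lt t t1 -> exists b : R, t < b /\ Rbar_lt b t1) by (intros; now apply Rbar_between).
  split; [|split].
  - intros t Ht Htt. destruct (sol_nle _ _ _ _ _ _ t (Hs t Ht Htt) ltac:(lra)) as [M HM].
    eapply nle_in_l1; eauto.
  - intros t Ht Htt eps He. destruct (Hb t Htt) as [b [Htb Hbt]].
    destruct (Hs b ltac:(lra) Hbt) as [_ [Hc _]].
    destruct (proj2 Hc t ltac:(lra) (eps / 2) ltac:(lra)) as [d [Hd H]].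
    exists (Rmin d (b - t)). split; [apply Rmin_pos; lra|]. intros s Hs0 Hst Hd'.
    pose proof (Rmin_l d (b - t)). pose proof (Rmin_r d (b - t)).
    apply Rle_lt_trans with (eps / 2); [|lra]. eapply nle_in_l1; auto. apply H; [|lra].
    pose proof (Rle_abs (s - t)). lra.
  - intros t Ht Htt n. pose proof (Hs t Ht Htt) as Hst. split; [|apply Hst; lra].
    apply (conv_ex_RInt w wt Sg alpha C HSG t (fun s => coagK k s (u s))); [lra|].
    apply (nonlinearity_comp_cont w wt Sg alpha C HSG) with t; [|lra|apply Hst].
    apply HF; auto. destruct T, t1; simpl in *; lra || auto.
Qed.

Lemma l1norm_unbounded x u (tm : R) : (forall b : R, 0 <= b -> Rbar_lt b tm -> sol wt Sg (coagK k) x b u) -> 0 < tm ->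
  (forall R0, exists eta, 0 < eta /\ forall t, 0 <= t -> tm - eta < t < tm -> ~ nle wt (u t) R0) ->
  filterlim (fun t => l1norm wt (u t)) (at_left tm) (Rbar_locally p_infty).
Proof.
  intros Hs Htm H P [M HM]. destruct (H M) as [eta [He Hn]].
  assert (He' : 0 < Rmin eta tm) by (apply Rmin_pos; auto).
  exists (mkposreal _ He'). intros t Ht Htt.
  unfold ball in Ht; simpl in Ht; unfold AbsRing_ball, abs, minus, plus, opp in Ht; simpl in Ht.
  rewrite Rabs_left in Ht by lra.
  pose proof (Rmin_l eta tm). pose proof (Rmin_r eta tm).
  apply HM. apply Rnot_le_lt. intros Hle. apply (Hn t); [lra|lra|].
  destruct (sol_nle _ _ _ _ _ _ t (Hs t ltac:(lra) Htt) ltac:(lra)) as [N HN].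
  apply nle_weaken with (l1norm wt (u t)); auto. apply in_l1_nle; auto. eapply nle_in_l1; eauto.
Qed.

(* An extension of [u] beyond [t1] would be continuous, hence bounded, near [t1]. *)
Lemma blowup_maximal x M t1 u : nle wt x M -> mild_solution T w wt Sg k x t1 u ->
  (forall tm : R, t1 = Finite tm -> Rbar_lt tm T -> forall R0, exists eta, 0 < eta /\
     forall t, 0 <= t -> tm - eta < t < tm -> ~ nle wt (u t) R0) ->
  maximal_mild_solution T w wt Sg k x t1 u /\
  forall t2 v, maximal_mild_solution T w wt Sg k x t2 v ->
    t2 = t1 /\ forall t, 0 <= t -> Rbar_lt t t1 -> v t = u t.
Proof.
  intros Hx Hm Hblow. pose proof (mild_solution_sol _ _ _ Hm) as Hs.
  pose proof Hm as [H0 [HT _]].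
  assert (Hno : forall t2 v, Rbar_lt t1 t2 -> mild_solution T w wt Sg k x t2 v ->
            (forall t : R, 0 <= t -> Rbar_lt t t1 -> v t = u t) -> False).
  { intros t2 v Hlt Hv E. pose proof Hv as [_ [HT2 _]].
    destruct t1 as [tm| |]; [|destruct t2; simpl in Hlt; auto|simpl in H0; auto].
    simpl in H0. destruct (Rbar_between tm t2 Hlt) as [b [Hb1 Hb2]].
    destruct (mild_solution_sol _ _ _ Hv b ltac:(lra) Hb2) as [_ [Hc _]].
    destruct (cont_on_bounded wt Hwt v 0 b Hc) as [B [HB HvB]].
    destruct (Hblow tm eq_refl) with (R0 := B) as [eta [He Hn]].
    { apply Rbar_lt_le_trans with t2; auto. }
    set (t := Rmax (tm - eta / 2) (tm / 2)).
    assert (Ht : 0 <= t /\ tm - eta < t < tm).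
    { unfold t, Rmax. destruct (Rle_dec (tm - eta / 2) (tm / 2)); lra. }
    apply (Hn t); [lra|lra|]. rewrite <- E; [|lra|simpl; lra]. apply HvB. lra. }
  assert (Huniq : forall t2 v, mild_solution T w wt Sg k x t2 v ->
            forall t : R, 0 <= t -> Rbar_lt t t1 -> Rbar_lt t t2 -> v t = u t).
  { intros t2 v Hv t Ht Ht1 Ht2.
    apply (sol_unique w wt Sg alpha C HSG (coagK k) t x M t t); auto; try lra.
    - apply HF; auto. apply Rbar_lt_le_trans with t1; auto.
    - now apply (mild_solution_sol _ _ _ Hv). }
  split.
  - split; auto. intros [t2 [v [Hlt [Hv E]]]]. now apply (Hno t2 v).
  - intros t2 v [Hv Hvmax]. assert (Et : t2 = t1).
    { destruct (Rbar_total_order t2 t1) as [[Hlt|Heq]|Hgt]; auto; exfalso.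
      - apply Hvmax. exists t1, u. split; auto. split; auto. intros t Ht Htt.
        symmetry. apply (Huniq t2 v); auto. now apply Rbar_lt_trans with t2.
      - apply (Hno t2 v); auto. intros t Ht Htt. apply (Huniq t2 v); auto. now apply Rbar_lt_trans with t1. }
    split; auto. subst t2. intros t Ht Htt. apply (Huniq t1 v); auto.
Qed.

End MildSolutions.

Lemma fragmentation_smoothing_semigroup w a b kappa alpha Sg :
  (forall n, (1 <= n)%nat -> 0 <= a n) ->
  (forall n j, (1 <= n)%nat -> (1 <= j)%nat -> 0 <= b n j) -> wpos w -> 0 < kappa <= 1 ->
  (forall j, (2 <= j)%nat -> sum1 (j - 1) (fun n => w n * b n j) <= kappa * w j) ->
  C0_semigroup_generated_by w Sg (frag_G_graph w a b) -> 0 <= alpha < 1 ->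
  (0 < kappa <= 1 /\ alpha = 0) \/ (0 < kappa < 1 /\ 0 < alpha < 1) ->
  exists C, smoothing_semigroup w (wtilde a w alpha) Sg alpha C.
Proof.
  intros Ha Hb Hw Hk Hwb HS Hal Hcase.
  destruct (Sg_wtilde_bounds w a b kappa Sg Ha Hb Hw Hk Hwb HS alpha Hal Hcase) as [C [HC [H1 H2]]].
  exists C. constructor; auto.
  - intros n Hn. apply wtilde_ge; auto.
  - intros. eapply Sg_lin; eauto.
  - intros. eapply Sg_0; eauto.
  - intros. eapply Sg_plus; eauto.
  - intros f M Hf. eapply Sg_cont; eauto.
  - intros. eapply Sg_contr; eauto.
  - intros. eapply Sg_wtilde_cont; eauto.
Qed.
Theorem theorem4p11
  (T : Rbar) (a : nat -> R) (b : nat -> nat -> R) (k : nat -> nat -> R -> R)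
  (w : nat -> R) (kappa alpha : R) (Sg : R -> seqR -> seqR) (u0 : seqR)
  (* 0 < T <= oo *)
  (HT : Rbar_lt 0 T)
  (* coefficients *)
  (Ha : forall n, (1 <= n)%nat -> 0 <= a n)
  (Hb : forall n j, (1 <= n)%nat -> (1 <= j)%nat -> 0 <= b n j)
  (Hb0 : forall n j, (1 <= n)%nat -> (1 <= j)%nat -> (j <= n)%nat -> b n j = 0)
  (Hk0 : forall n j t, (1 <= n)%nat -> (1 <= j)%nat -> 0 <= t -> Rbar_lt t T ->
           0 <= k n j t)
  (Hksym : forall n j t, (1 <= n)%nat -> (1 <= j)%nat -> 0 <= t -> Rbar_lt t T ->
           k n j t = k j n t)
  (* weight *)
  (Hw : forall n, (1 <= n)%nat -> INR n <= w n)
  (Hwmon : forall n m, (1 <= n)%nat -> (n <= m)%nat -> w n <= w m)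
  (Hkappa : 0 < kappa <= 1)
  (Hwb : forall j, (2 <= j)%nat ->
           sum1 (j - 1)%nat (fun n => w n * b n j) <= kappa * w j)
  (* fragmentation semigroup *)
  (HS : C0_semigroup_generated_by w Sg (frag_G_graph w a b))
  (* coagulation *)
  (Halpha : 0 <= alpha < 1)
  (Hcase : (0 < kappa <= 1 /\ alpha = 0) \/ (0 < kappa < 1 /\ 0 < alpha < 1))
  (Hkcont : forall n j t, (1 <= n)%nat -> (1 <= j)%nat -> 0 <= t -> Rbar_lt t T ->
     forall eps, 0 < eps -> exists delta, 0 < delta /\
       forall s, 0 <= s -> Rbar_lt s T -> Rabs (s - t) < delta ->
         Rabs (k n j s - k n j t) < eps)
  (Hkbound : forall t', 0 < t' -> Rbar_lt t' T -> exists c, 0 < c /\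
     forall n j t, (1 <= n)%nat -> (1 <= j)%nat -> 0 <= t -> t <= t' ->
       k n j t <= c * wtilde a w alpha n * wtilde a w alpha j / w (n + j)%nat)
  (* initial value *)
  (Hu0 : in_l1_pos (wtilde a w alpha) u0) :
  exists (tmax : Rbar) (u : R -> seqR),
    (* (i) *)
    Rbar_lt 0 tmax /\ Rbar_le tmax T /\
    maximal_mild_solution T w (wtilde a w alpha) Sg k u0 tmax u /\
    positive_on tmax u /\
    (forall (t1 : Rbar) (v : R -> seqR),
       maximal_mild_solution T w (wtilde a w alpha) Sg k u0 t1 v ->
       t1 = tmax /\ forall t, 0 <= t -> Rbar_lt t tmax -> v t = u t) /\
    (* (ii) *)
    (forall tm : R, tmax = Finite tm -> Rbar_lt tmax T ->
       filterlim (fun t => l1norm (wtilde a w alpha) (u t)) (at_left tm)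
                 (Rbar_locally p_infty)) /\
    (* (iii) *)
    (forall tau, 0 < tau -> Rbar_lt tau tmax ->
       exists r M, 0 < r /\ 0 < M /\
         forall (v0 : seqR) (t1 : Rbar) (v : R -> seqR),
           in_l1_pos (wtilde a w alpha) v0 ->
           l1norm (wtilde a w alpha) (vsub v0 u0) <= r ->
           maximal_mild_solution T w (wtilde a w alpha) Sg k v0 t1 v ->
           Rbar_lt tau t1 /\
           forall t, 0 <= t <= tau ->
             l1norm (wtilde a w alpha) (vsub (v t) (u t))
               <= M * l1norm (wtilde a w alpha) (vsub v0 u0)) /\
    (* (iv) *)
    ((forall j, (2 <= j)%nat -> sum1 (j - 1)%nat (fun n => INR n * b n j) <= INR j) ->
       forall t, 0 <= t -> Rbar_lt t tmax -> phi1 (u t) <= phi1 u0) /\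
    (a 1%nat = 0 ->
     (forall j, (2 <= j)%nat -> sum1 (j - 1)%nat (fun n => INR n * b n j) = INR j) ->
       forall t, 0 <= t -> Rbar_lt t tmax -> phi1 (u t) = phi1 u0).
Proof.
  assert (Hwp : wpos w).
  { intros n Hn. pose proof (Hw n Hn). apply lt_0_INR in Hn. lra. }
  destruct (fragmentation_smoothing_semigroup w a b kappa alpha Sg Ha Hb Hwp Hkappa Hwb HS Halpha Hcase) as [C HSG].
  set (wt := wtilde a w alpha) in *.
  pose proof (wt_pos _ _ _ _ _ HSG) as Hwt.
  assert (Hhalf : forall f M t, 0 <= t -> nle w f M -> halfnorm w (Sg t f) <= halfnorm w f).
  { intros f M t Ht Hf. now apply (Sg_w_halfnorm_le w a b kappa Sg Ha Hb Hwp Hkappa Hwb HS f M t). }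
  assert (HF : forall T1 : R, 0 <= T1 -> Rbar_lt T1 T -> nonlinearity w wt (coagK k) T1).
  { intros. eapply coagK_nonlinearity; eauto. }
  assert (HFP : forall T1 : R, 0 <= T1 -> Rbar_lt T1 T -> nonlinearity w wt (coagP k) T1).
  { intros. eapply coagP_nonlinearity; eauto. }
  (* Stated for every non-negative initial value, because part (iii) needs the blow-up alternative
     for the perturbed solution as well. *)
  assert (Hpos : forall v0, in_l1_pos wt v0 -> exists (tmax : Rbar) (u : R -> seqR),
    mild_solution T w wt Sg k v0 tmax u /\ positive_on tmax u /\
    (forall tm : R, tmax = Finite tm -> Rbar_lt tm T -> forall R0, exists eta, 0 < eta /\
       forall t, 0 <= t -> tm - eta < t < tm -> ~ nle wt (u t) R0)).
  { intros v0 [Hv0 Hv0p]. pose proof (in_l1_nle wt Hwt v0 Hv0) as Hx.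
    destruct (maximal_solution w wt Sg alpha C HSG (coagP k) T v0 _ HT HFP Hx) as [tmax [u [H0 [HtT [Hs Hbl]]]]].
    assert (HTt : forall t : R, Rbar_lt t tmax -> Rbar_lt t T) by (intros; now apply Rbar_lt_le_trans with tmax).
    assert (Hup : positive_on tmax u).
    { intros t Ht Htt n.
      apply (coagP_sol_pos T k w wt Sg alpha C HSG Hwmon Hk0 Hkcont Hkbound Hhalf t v0 _ t u Ht (HTt t Htt) (Rle_refl t) Hx Hv0p);
        [now apply Hs|lra]. }
    exists tmax, u. split; [|split; auto].
    (* Since [u >= 0], taking positive parts changes nothing along [u], which therefore solves the
       original equation on the same interval. *)
    - apply (sol_mild_solution T k w wt Sg alpha C HSG HF); auto. intros t Ht Htt.
      destruct (Hs t Ht Htt) as [_ [Hc E]]. split; auto. split; auto. intros s Hs' n. rewrite E by auto.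
      unfold duhamel, vadd. f_equal. apply conv_ext; [lra|]. intros r Hr. unfold coagP. f_equal.
      extensionality i. unfold pospart. apply Rmax_left, Hup; [lra|]. now apply Rbar_lt_mono with t; [lra|].
    - intros tm Etm HtmT. apply Hbl; auto. now rewrite Etm. }
  destruct (Hpos u0 Hu0) as [tmax [u [Hm [Hup Hbl]]]].
  pose proof (in_l1_nle wt Hwt u0 (proj1 Hu0)) as Hx.
  pose proof Hm as [H0 [HtT _]].
  pose proof (mild_solution_sol T k w wt Sg alpha C HSG u0 tmax u Hm) as Hs.
  destruct (blowup_maximal T k w wt Sg alpha C HSG HF u0 _ tmax u Hx Hm Hbl) as [Hmax Huniq].
  assert (HTt : forall t : R, Rbar_lt t tmax -> Rbar_lt t T) by (intros; now apply Rbar_lt_le_trans with tmax).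
  exists tmax, u. split; [auto|]. split; [auto|]. split; [auto|]. split; [auto|]. split; [auto|].
  split; [|split; [|split]].
  - intros tm Etm HtmT. rewrite Etm in *.
    apply (l1norm_unbounded k w wt Sg alpha C HSG u0); auto.
  - intros tau Htau Htt.
    destruct (sol_dependence w wt Sg alpha C HSG (coagK k) tau u0 _ tau u (HF tau ltac:(lra) (HTt tau Htt)) (Rle_refl tau) Hx
       (Hs tau ltac:(lra) Htt)) as [r [M [Hr [HM Hdep]]]].
    exists r, M. split; auto. split; auto. intros v0 t1 v Hv0 Hd Hv.
    pose proof (in_l1_nle wt Hwt v0 (proj1 Hv0)) as Hy.
    set (rho := l1norm wt (vsub v0 u0)) in *.
    assert (Hrho : nle wt (vsub v0 u0) rho).
    { apply in_l1_nle; auto. eapply nle_in_l1; auto. apply nle_sub; eauto. }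
    destruct (Hpos v0 Hv0) as [t1' [v' [Hm' [_ Hbl']]]].
    destruct (blowup_maximal T k w wt Sg alpha C HSG HF v0 _ t1' v' Hy Hm' Hbl') as [_ Huniq'].
    destruct (Huniq' t1 v Hv) as [<- Ev].
    pose proof (mild_solution_sol T k w wt Sg alpha C HSG v0 t1 v (proj1 Hv)) as Hsv.
    (* If [v] ended at some [tm <= tau], it would stay within [M * rho] of [u], which is bounded on
       [[0, tau]], and so could not blow up at [tm]. *)
    assert (Htau1 : Rbar_lt tau t1).
    { apply Rbar_not_le_lt. intros Hle. destruct Hm' as [Hp1 [HT1 _]].
      destruct t1 as [tm| |]; simpl in Hp1, Hle; try contradiction.
      destruct (cont_on_bounded wt Hwt u 0 tau) as [B [HB HuB]]; [apply (Hs tau); [lra|auto]|].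
      destruct (Hbl' tm eq_refl ltac:(apply Rbar_lt_mono with tau; auto) (M * rho + B)) as [eta [He Hn]].
      set (t := Rmax (tm - eta / 2) (tm / 2)).
      assert (Ht : 0 <= t /\ tm - eta < t < tm).
      { unfold t, Rmax. destruct (Rle_dec (tm - eta / 2) (tm / 2)); lra. }
      apply (Hn t); [lra|lra|]. rewrite <- Ev by (simpl; lra).
      apply nle_of_sub with (u t); auto; [|apply HuB; lra].
      apply (Hdep v0 _ t v rho Hy); auto; try lra. apply Hsv; simpl; lra. }
    split; auto. intros t Ht. eapply nle_in_l1; auto.
    apply (Hdep v0 _ tau v rho Hy); auto; try lra. apply Hsv; auto; lra.
  - intros Hmass t Ht Htt. rewrite <- (Rmult_1_l (phi1 (u t))), <- (Rmult_1_l (phi1 u0)).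
    apply (coag_sol_mass T k w wt Sg alpha C HSG Hwmon Hk0 Hksym Hkcont Hkbound t u0 (l1norm wt u0) t u 1);
      auto; [lra|apply Rabs_R1|].
    intros s h Hs' Hh. rewrite !Rmult_1_l.
    assert (Hst : Rbar_lt s tmax) by (apply Rbar_lt_mono with t; auto; lra).
    destruct (sol_nle _ _ _ _ _ _ s (Hs s ltac:(lra) Hst) ltac:(lra)) as [N HN].
    apply (Sg_phi1_le w a b kappa Sg Ha Hb Hwp Hkappa Hwb HS Hw (u s) N h); auto.
    + now apply (nle_wt_w _ _ _ _ _ HSG).
    + apply Hup; auto; lra.
  - intros Ha1 Hmass t Ht Htt.
    assert (Hsg : forall sg, Rabs sg = 1 -> sg * phi1 (u t) <= sg * phi1 u0).
    { intros sg Hsg.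
      apply (coag_sol_mass T k w wt Sg alpha C HSG Hwmon Hk0 Hksym Hkcont Hkbound t u0 (l1norm wt u0) t u sg);
        auto; [lra|].
      intros s h Hs' Hh.
      assert (Hst : Rbar_lt s tmax) by (apply Rbar_lt_mono with t; auto; lra).
      destruct (sol_nle _ _ _ _ _ _ s (Hs s ltac:(lra) Hst) ltac:(lra)) as [N HN].
      rewrite (Sg_phi1_eq w a b kappa Sg Ha Hb Hwp Hkappa Hwb HS Hw (u s) N h); auto; [lra|].
      now apply (nle_wt_w _ _ _ _ _ HSG). }
    pose proof (Hsg 1 Rabs_R1). pose proof (Hsg (-1) ltac:(rewrite Rabs_left; lra)). lra.
Qed.
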